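(* Assume that $u\in H^2(\Omega)$ and that $u_h\in\mathcal{V}_h$ is a numerical solution satisfying $\|u-u_h\|_{L^2(\Omega)}\le C_0h^2|u|_{H^2(\Omega)}$ with a constant $C_0$ independent of $h$. Let the boundary values of $\mathcal{I}^W(u_h)$ all be taken from $u$. Then the reconstructed solution $\mathcal{I}^W(u_h)\in\mathcal{W}_{h/2}$ also has second-order accuracy: $$\|u-\mathcal{I}^W(u_h)\|_{L^2(\Omega)}\le Ch^2|u|_{H^2(\Omega)},$$ where the constant $C$ is independent of $h$, $u$ and $u_h$, and depends on the maximum number of sides among the polygons in $\mathcal{T}_h$ (and on $C_0$ and the shape-regularity of the mesh family).
   Context: $\{\mathcal{K}_h\}_{h>0}$ is a shape-regular (in the sense of Ciarlet) family of triangulations without hanging nodes of an open (bounded) polygonal domain $\Omega\subset\mathbb{R}^2$, and $h$ is the maximum over $K\in\mathcal{K}_h$ of the diameter of the circumscribed circle of $K$. $\mathbf{x}_1,\dots,\mathbf{x}_N$ are the midpoints of all edges of $\mathcal{K}_h$. The Crouzeix-Raviart space $\mathcal{V}_h$ consists of functions that are affine on each triangle and whose jump across each interior edge has zero mean; such functions are determined by their values at $\mathbf{x}_1,\dots,\mathbf{x}_N$. Functions in $H^2(\Omega)$ are identified with their continuous representatives. The $\frac h2$-mesh $\mathcal{K}_{h/2}$ is obtained by subdividing each triangle into four by connecting its edge midpoints. $\mathcal{W}_{h/2}$ is the space of continuous functions on $\Omega$ that are affine on each triangle of $\mathcal{K}_{h/2}$. Polygons. For each interior vertex $\mathbf{y}_0$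 of $\mathcal{K}_h$, connecting in cyclic order the midpoints $\mathbf{y}_1,\dots,\mathbf{y}_s$ of the edges of $\mathcal{K}_h$ emanating from $\mathbf{y}_0$ gives a polygon containing $\mathbf{y}_0$ in its interior, assumed to be convex. $\mathcal{T}_h$ is the set of these polygons. Wachspress coordinates. For an $s$-sided convex polygon with vertices $\mathbf{y}_1,\dots,\mathbf{y}_s$ in cyclic order and a point $\mathbf{x}$ in its interior, $$w_i(\mathbf{x})=\frac{\tilde w_i(\mathbf{x})}{\sum_{j=1}^s\tilde w_j(\mathbf{x})},\qquad\tilde w_i(\mathbf{x})=\frac{\mathcal{A}(\mathbf{y}_{i-1},\mathbf{y}_i,\mathbf{y}_{i+1})}{\mathcal{A}(\mathbf{x},\mathbf{y}_{i-1},\mathbf{y}_i)\,\mathcal{A}(\mathbf{x},\mathbf{y}_i,\mathbf{y}_{i+1})},$$ where indices are cyclic and $\mathcal{A}(\mathbf{a},\mathbf{b},\mathbf{c})$ is the signed area of the triangle with vertices $\mathbf{a},\mathbf{b},\mathbf{c}$. These coordinates are nonnegative, sum to $1$, and reproduce affine functions. Reconstruction. For $v_h\in\mathcal{V}_h$, $\mathcal{I}^W(v_h)\in\mathcal{W}_{h/2}$ is defined by its values at the vertices of $\mathcal{K}_{h/2}$: at midpoints of interior edges of $\mathcal{K}_h$ it equals $v_h$; at an interior vertex $\mathbf{y}_0$ of $\mathcal{K}_h$ it equals $\sum_{j=1}^sw_j(\mathbf{y}_0)v_h(\mathbf{y}_j)$; and, under the convention of this statement, at all vertices of $\mathcal{K}_{h/2}$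 on $\partial\Omega$ it takes the values of $u$. *)

(* Defs.v *)
From HB Require Import structures.
From mathcomp Require Import all_boot all_order all_algebra finmap.
From mathcomp Require Import all_classical all_reals all_analysis.

Set Implicit Arguments.
Unset Strict Implicit.
Unset Printing Implicit Defensive.

Import Order.TTheory GRing.Theory Num.Theory.
Import numFieldNormedType.Exports.

Local Open Scope classical_set_scope.
Local Open Scope ring_scope.

(* Points, sets and functions of the plane live in [R * R].  The library norm
   on this product is the max norm: it is used for the topology only, and
   lengths are measured with [edist]. *)
Notation plane R := (R * R)%type.

Section Plane.
Context {R : realType}.
Implicit Types (x y z : plane R) (A : set (plane R)).

Definition edist x y : R := Num.sqrt ((x.1 - y.1) ^+ 2 + (x.2 - y.2) ^+ 2).

Definition midpoint x y : plane R := (2^-1 : R) *: (x + y).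

Definition signed_area x y z : R :=
  ((y.1 - x.1) * (z.2 - x.2) - (z.1 - x.1) * (y.2 - x.2)) / 2.

Definition hull (V : {fset plane R}) : set (plane R) :=
  [set x | exists w : plane R -> R,
    [/\ forall v, v \in V -> 0 <= w v,
        \sum_(v <- V) w v = 1
      & x = \sum_(v <- V) w v *: v]].

Definition affine (p : plane R -> R) :=
  exists a b c : R, forall x, p x = a * x.1 + b * x.2 + c.

Definition euclid_diam A : R :=
  sup [set d | exists x y, [/\ A x, A y & d = edist x y]].

Definition inscribed_diam A : R :=
  sup [set d | exists c, exists r : R,
    [/\ 0 <= r, d = r *+ 2 & [set x | edist c x <= r] `<=` A]].

Definition segment x y : set (plane R) := hull [fset x; y]%fset.

Definition polygonal_domain (Omega : set (plane R)) :=
  [/\ open Omega, connected Omega, bounded_set Omega,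
      (* no slits *) Omega = (closure Omega)°
    & exists s : seq (plane R * plane R),
        closure Omega `\` Omega `<=` \bigcup_(e in [set` s]) segment e.1 e.2].

End Plane.

Section Sobolev.
Context {R : realType}.
Implicit Types (Omega : set (plane R)) (u g phi : plane R -> R).

Definition mu2 : {measure set (measurableTypeR R * measurableTypeR R) -> \bar R} :=
  (@lebesgue_measure R \x @lebesgue_measure R)%E.

Definition L2norm Omega u : \bar R := 'N[mu2]_2%:E[EFin \o (u \_ Omega)].

Definition L2 Omega u := u \_ Omega \in Lfun mu2 2%:E.

(* classical partial derivative for the multi-index (i, j) *)
Definition partial (i j : nat) phi : plane R -> R :=
  iter i (fun f x => 'D_((1, 0) : plane R) f x)
    (iter j (fun f x => 'D_((0, 1) : plane R) f x) phi).

Definition test_function Omega phi :=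
  [/\ forall i j x, differentiable (partial i j phi) x,
      compact (closure [set x | phi x != 0])
    & closure [set x | phi x != 0] `<=` Omega].

Definition weak_partial Omega (i j : nat) u g :=
  forall phi, test_function Omega phi ->
    (\int[mu2]_(x in Omega) (u x * partial i j phi x) =
     (-1) ^+ (i + j) * \int[mu2]_(x in Omega) (g x * phi x))%R.

Definition H2 Omega u :=
  L2 Omega u /\
  forall i j, (i + j <= 2)%N -> exists g, L2 Omega g /\ weak_partial Omega i j u g.

(* the weak derivative is unique up to null sets; any version is chosen *)
Definition wD Omega (i j : nat) u : plane R -> R :=
  xget (cst 0) [set g | L2 Omega g /\ weak_partial Omega i j u g].

Definition H2seminorm Omega u : \bar R :=
  ((\sum_(i < 3) L2norm Omega (wD Omega i (2 - i) u) ^+ 2) `^ 2^-1)%E.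

End Sobolev.

Section Mesh.
Context {R : realType}.

(* A mesh is the finite set of its triangles, a triangle being given by its
   set of vertices. *)
Definition mesh := {fset {fset plane R}}.

Implicit Types (Omega : set (plane R)) (K : mesh) (T : {fset plane R}).

Definition is_triangle T :=
  exists x y z, T = [fset x; y; z]%fset /\ signed_area x y z != 0.

(* Two triangles meet in the convex hull of their common vertices: a whole
   edge, a vertex, or nothing. *)
Definition triangulation Omega K :=
  [/\ forall T, T \in K -> is_triangle T,
      closure Omega = \bigcup_(T in [set` K]) hull T
    & forall T T', T \in K -> T' \in K ->
        hull T `&` hull T' = hull (T `&` T')%fset].

Definition circum_diameter T (d : R) :=
  exists c : plane R, forall v, v \in T -> edist c v *+ 2 = d.

Definition mesh_size K (h : R) :=
  (exists2 T, T \in K & circum_diameter T h) /\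
  (forall T d, T \in K -> circum_diameter T d -> d <= h).

Definition mesh_family Omega (H : set R) (K : R -> mesh) :=
  forall h, H h -> [/\ 0 < h, triangulation Omega (K h) & mesh_size (K h) h].

Definition shape_regular (sigma : R) (H : set R) (K : R -> mesh) :=
  forall h T, H h -> T \in K h ->
    euclid_diam (hull T) <= sigma * inscribed_diam (hull T).

Definition mesh_edge K (x y : plane R) :=
  x != y /\ exists2 T, T \in K & (x \in T) && (y \in T).

Definition interior_vertex Omega K (y : plane R) :=
  Omega y /\ exists2 T, T \in K & y \in T.

Definition corner_triangle T (x : plane R) : {fset plane R} :=
  [fset midpoint x y | y in T]%fset.  (* [midpoint x x = x] *)

Definition medial_triangle T : {fset plane R} :=
  [fset midpoint x y | x in T, y in (T `\ x)%fset]%fset.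

Definition half_mesh K : mesh :=
  ([fset corner_triangle T x | T in K, x in T] `|`
   [fset medial_triangle T | T in K])%fset.

End Mesh.
Arguments mesh R : clear implicits.

Section Polygons.
Context {R : realType}.
Implicit Types (Omega : set (plane R)) (K : mesh R) (ys : seq (plane R)).

(* [ys] lists the midpoints of the edges emanating from [y0] in
   counterclockwise order: cyclically consecutive edges bound a common
   triangle.  [next] and [prev] are cyclic in [ys]. *)
Definition cyclic_midpoints K (y0 : plane R) ys :=
  [/\ uniq ys,
      forall y, y \in ys <-> exists2 a, mesh_edge K y0 a & y = midpoint y0 a
    & forall y, y \in ys -> exists a b,
        [/\ exists2 T, T \in K & T = [fset y0; a; b]%fset,
            y = midpoint y0 a, next ys y = midpoint y0 b
          & 0 < signed_area y0 a b]].

Definition vertex_polygon K (y0 : plane R) : seq (plane R) :=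
  xget [::] [set ys | cyclic_midpoints K y0 ys].

(* The region bounded by the closed polygonal line [ys] around [y0]. *)
Definition polygon_region (y0 : plane R) ys : set (plane R) :=
  \bigcup_(y in [set` ys]) hull [fset y0; y; next ys y]%fset.

Definition convex_polygons Omega K :=
  forall y0, interior_vertex Omega K y0 ->
    cyclic_midpoints K y0 (vertex_polygon K y0) /\
    convex_set (polygon_region y0 (vertex_polygon K y0)).

Definition polygon_sides_le Omega K (s : nat) :=
  forall y0, interior_vertex Omega K y0 -> (size (vertex_polygon K y0) <= s)%N.

Definition wachspress_weight ys (x y : plane R) : R :=
  signed_area (prev ys y) y (next ys y) /
  (signed_area x (prev ys y) y * signed_area x y (next ys y)).

Definition wachspress ys (x y : plane R) : R :=
  wachspress_weight ys x y / \sum_(z <- ys) wachspress_weight ys x z.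

End Polygons.

Section Reconstruction.
Context {R : realType}.
Implicit Types (Omega : set (plane R)) (K : mesh R) (u v w : plane R -> R).

(* [p T] is the affine function given by [v] on the open triangle [T].  The
   values of [v] on the edges do not matter for the function class, except
   that at an edge midpoint [v] takes the value of its affine pieces (they
   agree there, because the jump has zero mean). *)
Definition CR_space Omega K v :=
  L2 Omega v /\
  exists p : {fset plane R} -> plane R -> R,
    [/\ forall T, T \in K ->
          affine (p T) /\ (forall x, (hull T)° x -> v x = p T x),
        forall T T' x y, T \in K -> T' \in K -> T != T' -> x != y ->
          x \in (T `&` T')%fset -> y \in (T `&` T')%fset ->
          \int[@lebesgue_measure R]_(t in `[0, 1])
             (p T (x + t *: (y - x)) - p T' (x + t *: (y - x))) = 0
      & forall T x y, T \in K -> x \in T -> y \in T -> x != y ->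
          v (midpoint x y) = p T (midpoint x y)].

Definition half_space Omega K w :=
  {within closure Omega, continuous w} /\
  forall S, S \in half_mesh K ->
    exists2 p, affine p & forall x, hull S x -> w x = p x.

(* [y] is meant to be a vertex of the half mesh: outside [Omega] it lies on
   the boundary; inside it is a mesh vertex or the midpoint of an interior
   edge. *)
Definition nodal_value Omega K u v (y : plane R) : R :=
  if `[< ~ Omega y >] then u y
  else if `[< interior_vertex Omega K y >] then
    \sum_(z <- vertex_polygon K y) wachspress (vertex_polygon K y) y z * v z
  else v y.

Definition IW Omega K u v : plane R -> R :=
  xget (cst 0) [set w | half_space Omega K w /\
    forall S y, S \in half_mesh K -> y \in S -> w y = nodal_value Omega K u v y].

End Reconstruction.

(* Main.v *)
Require Import Defs.
From mathcomp Require Import all_boot all_order all_algebra finmap.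
From mathcomp Require Import all_classical all_reals all_analysis.
From mathcomp Require Import measurable_realfun ring lra.

(** Write d for the diameter of a triangle, |u| for the L2 norm of the second
    derivatives of [u], and e = u - uh.  The proof is local: on each triangle,
    u - IW is bounded pointwise by d |u| + |e| / d, both norms being taken over
    the triangle and its neighbours around interior vertices.  Squaring,
    multiplying by the area, which is at most 4 d^2, and summing gives
    h^4 |u|^2 + |e|^2, and the hypothesis on [uh] bounds the second term by the
    first.  Each triangle is counted boundedly often, because at most [s]
    triangles meet at an interior vertex.

    The pointwise bound rests on an averaged Taylor polynomial.  Let phi be a
    smooth bump of mass one in a square around [c], and let phi_t be its image
    under the contraction of ratio t towards [x].  The function
    U(t) = int u phi_t tends to u(x) as t tends to 0, and the value at 0 of its
    tangent at t = 1 is int u k for a kernel k supported where phi is.  As a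
    function of [x], this is an affine function, and it is [u] itself when [u]
    is affine ([avg_taylor_affine], [avg_taylor_id]).  The second derivative
    of U is the pairing of the weak second derivatives of [u] with test
    functions in the squares swept by the contraction, so by the
    Cauchy-Schwarz inequality it is at most a constant times |u| / t.  A Taylor
    expansion then gives |u(x) - int u k| <= C d |u| ([local_estimate]); the
    continuity of [u] identifies the limit at t = 0.

    The same kernel compares [u] with [uh].  On a triangle [uh] is affine, so
    int u k - uh(z) = int (u - uh) k, which is at most C |e| / d
    ([tker_pairing]).  This bounds u - uh at edge midpoints
    ([mid_estimate]).  At an interior vertex y0 the polygon of midpoints is
    convex and contains a disc of radius comparable to d around y0, so the
    averaged Taylor polynomial also works on the whole polygon
    ([patch_estimate]); Wachspress coordinates are nonnegative, sum to one and
    reproduce affine functions, hence the averaged value at y0 inherits the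
    midpoint bounds ([vertex_estimate]).  All triangles around y0 have
    comparable diameters because consecutive ones share an edge, which costs
    a power of the regularity constant with exponent [s] ([fan_diam]).

    Inside a triangle, IW differs from an affine function by at most its
    largest nodal difference ([IW_error]); that the choice operator in the
    definition of [IW] picks a genuine reconstruction requires building one
    ([IW_spec]), here from barycentric coordinates.  Since closed triangles
    overlap along edges, sums of integrals run over disjoint cells contained
    in the triangles ([cell]), which makes null sets irrelevant. *)

Set Implicit Arguments.
Unset Strict Implicit.
Unset Printing Implicit Defensive.

Import Order.TTheory GRing.Theory Num.Theory.
Import numFieldNormedType.Exports.

Local Open Scope classical_set_scope.
Local Open Scope ring_scope.

Local Notation edist := Defs.edist.

(** * A smooth monotone step function *)

Section Smooth.
Context {R : realType}.
Implicit Types (f g : R -> R) (x y : R).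

(** Differentiability is iterated through [derive1], so that [smooth] is closed
    under differentiation by definition. *)
Fixpoint Ck (n : nat) f : Prop :=
  if n is m.+1 then (forall x, derivable f x 1) /\ Ck m (derive1 f) else True.

Definition smooth f := forall n, Ck n f.

Lemma derive1_funE f (f' : R -> R) : (forall x, is_derive x 1 f (f' x)) -> (derive1 f) = f'.
Proof.
by move=> ff'; apply/funext => x; rewrite derive1E; have [_ ->] := ff' x.
Qed.

Lemma CkS n f (f' : R -> R) :
  (forall x, is_derive x 1 f (f' x)) -> Ck n f' -> Ck n.+1 f.
Proof.
by move=> ff' nf'; split; [move=> x; case: (ff' x)|rewrite (derive1_funE ff')].
Qed.

Lemma Ck_is_derive n f x : Ck n.+1 f -> is_derive x 1 f ((derive1 f) x).
Proof. by case=> df _; apply: DeriveDef => //; rewrite derive1E. Qed.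

Lemma Ck_pred n f : Ck n.+1 f -> Ck n f.
Proof.
elim: n f => [//|n IH] f [df nf]; split => //; exact: IH.
Qed.

Lemma smooth_derivable f x : smooth f -> derivable f x 1.
Proof. by move=> /(_ 1%N)[df _]; exact: df. Qed.

Lemma smooth_is_derive f x : smooth f -> is_derive x 1 f ((derive1 f) x).
Proof. by move=> sf; apply: (@Ck_is_derive 0); exact: sf. Qed.

Lemma smooth_derive1 f : smooth f -> smooth (derive1 f).
Proof. by move=> sf n; have [] := sf n.+1. Qed.

Lemma smooth_continuous f : smooth f -> continuous f.
Proof.
move=> sf x; apply: differentiable_continuous.
by apply/derivable1_diffP; exact: smooth_derivable.
Qed.

Lemma Ck_cst n (c : R) : Ck n (cst c).
Proof.
elim: n c => [//|n IH] c; apply: (@CkS _ _ (cst 0)); last exact: IH.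
Qed.

Lemma CkD n f g : Ck n f -> Ck n g -> Ck n (fun x => f x + g x).
Proof.
elim: n f g => [//|n IH] f g cf cg.
apply: (@CkS _ _ (fun x => (derive1 f) x + (derive1 g) x)); last first.
  by case: cf cg => [_ cf] [_ cg]; exact: IH.
by move=> x; exact: is_deriveD (Ck_is_derive x cf) (Ck_is_derive x cg).
Qed.

Lemma CkM n f g : Ck n f -> Ck n g -> Ck n (fun x => f x * g x).
Proof.
elim: n f g => [//|n IH] f g cf cg.
apply: (@CkS _ _ (fun x => f x * (derive1 g) x + g x * (derive1 f) x)); last first.
  by apply: CkD; apply: IH; first [exact: Ck_pred | by case: cf | by case: cg].
by move=> x; exact: is_deriveM (Ck_is_derive x cf) (Ck_is_derive x cg).
Qed.

Lemma is_derive_affine_arg f (a b x df : R) :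
  is_derive (a * x + b) 1 f df -> is_derive x 1 (fun y => f (a * y + b)) (a * df).
Proof.
move=> fd.
have ga : is_derive x 1 (fun y => a * y + b) a.
  have := is_deriveD (is_deriveZ a (is_derive_id x (1:R))) (is_derive_cst b x (1:R)).
  by rewrite addr0 /GRing.scale /= mulr1.
by have := @is_derive1_comp _ f (fun y => a * y + b) _ _ _ fd ga; rewrite mulrC.
Qed.

Lemma Ck_affine_arg n f (a b : R) : Ck n f -> Ck n (fun y => f (a * y + b)).
Proof.
elim: n f => [//|n IH] f cf.
apply: (@CkS _ _ (fun y => a * (derive1 f) (a * y + b))).
  by move=> x; exact: is_derive_affine_arg (Ck_is_derive _ cf).
by apply: CkM; [exact: Ck_cst|apply: IH; case: cf].
Qed.

Lemma smooth_cst c : smooth (cst c). Proof. by move=> n; exact: Ck_cst. Qed.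

Lemma smooth_id : smooth (@id R).
Proof.
case=> [//|n]; apply: (@CkS _ _ (cst 1)); last exact: Ck_cst.

Qed.

Lemma smoothD f g : smooth f -> smooth g -> smooth (fun x => f x + g x).
Proof. by move=> sf sg n; exact: CkD. Qed.

Lemma smoothM f g : smooth f -> smooth g -> smooth (fun x => f x * g x).
Proof. by move=> sf sg n; exact: CkM. Qed.

Lemma smooth_affine_arg f (a b : R) : smooth f -> smooth (fun y => f (a * y + b)).
Proof. by move=> sf n; exact: Ck_affine_arg. Qed.

(** The functions x^-n exp(-1/x), extended by 0: the span of this family is
    closed under differentiation, which is why all of them are smooth. *)
Definition flat (n : nat) (x : R) : R := if 0 < x then x^-1 ^+ n * expR (- x^-1) else 0.

Lemma flat_ge0 n x : 0 <= flat n x.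
Proof.
by rewrite /flat; case: ifP => // x0; rewrite mulr_ge0 ?expR_ge0// exprn_ge0// invr_ge0 ltW.
Qed.

(** exp y dominates y^(n+2) / (n+2)!, at y = 1/x. *)
Lemma flat_le n x : flat n x <= (n.+2)`!%:R * x ^+ 2.
Proof.
rewrite /flat; case: ifPn => [x0|_]; last by rewrite mulr_ge0// sqr_ge0.
have y0 : 0 < x^-1 by rewrite invr_gt0.
have := @expR_ge1Dxn R x^-1 n.+1 (ltW y0).
set y := x^-1; move=> H.
have {}H : y ^+ n.+2 / n.+2`!%:R <= expR y by apply: le_trans H; rewrite lerDr.
have F0 : (0 : R) < n.+2`!%:R by rewrite ltr0n fact_gt0.
rewrite expRN -(@ler_pM2r _ (expR y)) ?expR_gt0// mulfVK ?gt_eqF ?expR_gt0//.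
have -> : y ^+ n = n.+2`!%:R * x ^+ 2 * (y ^+ n.+2 / n.+2`!%:R).
  rewrite -[n.+2]addn2 exprD.
  have -> : y ^+ 2 = (x ^+ 2)^-1 by rewrite exprVn.
  field; rewrite -?lt0r_neq0// addn2; apply/andP; split; apply: lt0r_neq0 => //.
by rewrite ler_wpM2l// mulr_ge0// ?sqr_ge0// ltW.
Qed.

(** Differentiability of [flat] at 0, the only delicate point. *)
Lemma is_derive_quadratic_zero f (C : R) :
  f 0 = 0 -> (forall x, `|f x| <= C * x ^+ 2) -> is_derive (0:R) 1 f 0.
Proof.
move=> f0 fC.
have K : h^-1 *: (f (h *: (1:R^o) + 0) - f 0) @[h --> (0:R)^'] --> (0:R^o).
  apply/cvgrPdist_le => /= e e0.
  near=> h.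
  rewrite sub0r normrN addr0 f0 subr0 /GRing.scale /= mulr1.
  have h0 : h != 0 by near: h; exact: nbhs_dnbhs_neq.
  rewrite normrM normfV.
  have nh : 0 < `|h| by rewrite normr_gt0.
  rewrite ler_pdivrMl// (le_trans (fC h))//.
  rewrite -[h ^+ 2]real_normK ?num_real// expr2 mulrCA ler_wpM2l//.
  have [C0|C0] := leP C 0.
    by apply: le_trans (ltW e0); rewrite mulr_le0_ge0.
  rewrite -ler_pdivlMl//.
  suff : `|h| <= (`|C| + 1)^-1 * e.
    move=> /le_trans; apply; rewrite ler_wpM2r ?ltW//.
    have CC := ler_norm C; rewrite ltf_pV2 ?posrE//; lra.
  near: h; apply: dnbhs0_le.
  by rewrite mulr_gt0// invr_gt0 ltr_wpDl.
apply: DeriveDef; first by apply/cvg_ex; exists 0.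
by rewrite /derive; apply: cvg_lim.
Unshelve. all: end_near. Qed.

Lemma is_derive_flat n x :
  is_derive x 1 (flat n) (- n%:R * flat n.+1 x + flat n.+2 x).
Proof.
have [x0|x0|->] := ltgtP x 0.
- rewrite /flat !ltNge (ltW x0)/= mulr0 addr0.
  apply: (@near_eq_is_derive _ _ _ (cst 0)).
  near=> y; rewrite /cst; case: ifPn => //; rewrite ltNge => /negP; case.
  by apply: ltW; near: y; exact: lt_nbhsl.
- have d1 : is_derive x 1 (fun y : R => y^-1) (- x ^- 2).
    have := @is_deriveV _ id x 1 1 (lt0r_neq0 x0) (is_derive_id x 1).
    by rewrite /= /GRing.scale /= mulr1.
  have d2 : is_derive x 1 (fun y : R => y^-1 ^+ n * expR (- y^-1))
     (x^-1 ^+ n *: (- (- x ^- 2) * expR (- x^-1)) + expR (- x^-1) *: ((n%:R * x^-1 ^+ n.-1) *: (- x ^- 2))).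
    apply: is_deriveM; first by have := is_deriveX n d1; rewrite exprfctE.
    have := @is_derive1_comp _ expR (fun y => - y^-1) x _ _ (is_derive_expR (- x^-1)) (is_deriveN d1).
    by rewrite mulrC.
  rewrite /flat x0.
  have -> : - n%:R * (x^-1 ^+ n.+1 * expR (- x^-1)) + x^-1 ^+ n.+2 * expR (- x^-1)
   = (x^-1 ^+ n *: (- (- x ^- 2) * expR (- x^-1)) + expR (- x^-1) *: ((n%:R * x^-1 ^+ n.-1) *: (- x ^- 2))).
    rewrite /GRing.scale /= opprK.
    rewrite -(exprVn x 2); case: n {d2} => [|m] /=; rewrite !exprS; ring.
  apply: (near_eq_is_derive _ d2).
  near=> y; case: ifPn => //; rewrite -leNgt => /le_gtF; rewrite (_ : 0 < y)//.
  by near: y; exact: lt_nbhsr.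
- rewrite /flat ltxx mulr0 addr0.
  apply: (@is_derive_quadratic_zero _ (n.+2)`!%:R); first by rewrite ltxx.
  by move=> y; rewrite -/(flat n y) ger0_norm ?flat_ge0 ?flat_le.
Unshelve. all: end_near. Qed.

Lemma smooth_flat n : smooth (flat n).
Proof.
move=> k; elim: k n => [//|k IH] n; apply: (CkS (is_derive_flat n)).
by apply: CkD => //; apply: CkM => //; exact: Ck_cst.
Qed.

Lemma Ck_inv n f : (forall x, f x != 0) -> Ck n f -> Ck n (fun x => (f x)^-1).
Proof.
move=> f0; elim: n => [//|n IH] cf.
have cf' : Ck n f by exact: Ck_pred.
apply: (@CkS _ _ (fun x => -1 * ((f x)^-1 * (f x)^-1 * derive1 f x))).
  move=> x; have := is_deriveV (f0 x) (Ck_is_derive x cf).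
  by rewrite /GRing.scale/= -exprVn expr2 mulN1r mulNr.
apply: CkM; first exact: Ck_cst.
by apply: CkM; [apply: CkM; exact: IH | case: cf].
Qed.

Lemma flat_le0 n x : x <= 0 -> flat n x = 0.
Proof. by move=> x0; rewrite /flat ltNge x0. Qed.

Lemma flat0_gt0 x : 0 < x -> 0 < flat 0 x.
Proof. by move=> x0; rewrite /flat x0 expr0 mul1r expR_gt0. Qed.

(** A smooth step from 0 at -1 to 1 at 1; its derivative is a bump of mass one. *)
Definition step (x : R) : R := flat 0 (x + 1) / (flat 0 (x + 1) + flat 0 (1 - x)).

Let smooth_flatD : smooth (fun x : R => flat 0 (x + 1)).
Proof.
rewrite (_ : (fun x => _) = (fun x => flat 0 (1 * x + 1))).
  by apply: smooth_affine_arg; exact: smooth_flat.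
by apply/funext => x; rewrite mul1r.
Qed.

Let smooth_flatB : smooth (fun x : R => flat 0 (1 - x)).
Proof.
rewrite (_ : (fun x => _) = (fun x => flat 0 (-1 * x + 1))).
  by apply: smooth_affine_arg; exact: smooth_flat.
by apply/funext => x; rewrite mulN1r addrC.
Qed.

Let den_gt0 x : 0 < flat 0 (x + 1) + flat 0 (1 - x).
Proof.
have [x0|x0] := leP x 0.
  by rewrite ltr_wpDl ?flat_ge0// flat0_gt0//; lra.
by rewrite ltr_pwDl ?flat_ge0// flat0_gt0//; lra.
Qed.

Lemma smooth_step : smooth step.
Proof.
apply: smoothM => // n; apply: Ck_inv; first by move=> x; rewrite gt_eqF.
by apply: CkD; [exact: smooth_flatD|exact: smooth_flatB].
Qed.

Lemma step_le x : x <= -1 -> step x = 0.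
Proof. by move=> x1; rewrite /step flat_le0 ?mul0r//; lra. Qed.

Lemma step_ge x : 1 <= x -> step x = 1.
Proof.
move=> x1; rewrite /step (@flat_le0 _ (1 - x)) ?addr0 ?divff//; last by lra.
by rewrite gt_eqF// flat0_gt0//; lra.
Qed.

Lemma step_derive1_ge0 x : 0 <= derive1 step x.
Proof.
pose f (x : R) : R := flat 0 (x + 1); pose g (x : R) : R := flat 0 (1 - x).
have df : is_derive x 1 f (flat 2 (x + 1)).
  have h := is_derive_flat 0 (1 * x + 1).
  have := is_derive_affine_arg h.
  rewrite mul1r oppr0 mul0r add0r mul1r.
  by under eq_fun do rewrite mul1r.
have dg : is_derive x 1 g (- flat 2 (1 - x)).
  have h := is_derive_flat 0 (-1 * x + 1).
  have := is_derive_affine_arg h.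
  rewrite mulN1r oppr0 mul0r add0r mulN1r (addrC (- x)).
  by under eq_fun do rewrite mulN1r addrC.
have d0 : f x + g x != 0 by rewrite gt_eqF// den_gt0.
have := is_deriveM df (@is_deriveV _ (fun y => f y + g y) _ _ _ d0 (is_deriveD df dg)).
rewrite derive1E => -[_]; rewrite -[_ * _]/step => ->.
rewrite /GRing.scale /=.
have -> : f x * (- (f x + g x) ^- 2 * (flat 2 (x + 1) - flat 2 (1 - x))) +
   (f x + g x)^-1 * flat 2 (x + 1) =
   (f x + g x) ^- 2 * (g x * flat 2 (x + 1) + f x * flat 2 (1 - x)).
  by field.
rewrite mulr_ge0//; first by rewrite invr_ge0 sqr_ge0.
by rewrite addr_ge0// mulr_ge0// flat_ge0.
Qed.

Lemma step_derive1_supp x : derive1 step x != 0 -> `|x| <= 1.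
Proof.
apply: contraNT; rewrite -ltNge => x1; rewrite derive1E; apply/eqP.
have [x0|x0] := leP 0 x.
  rewrite (@near_eq_derive _ R R step (cst (1:R))) ?derive_cst//.
  rewrite ger0_norm// in x1.
  by near=> y; rewrite step_ge//; apply: ltW; near: y; exact: lt_nbhsr.
rewrite ltr0_norm// in x1.
have {}x1 : x < -1 by lra.
rewrite (@near_eq_derive _ R R step (cst (0:R))) ?derive_cst//.
by near=> y; rewrite step_le//; apply: ltW; near: y; exact: lt_nbhsl.
Unshelve. all: end_near. Qed.

End Smooth.

(** * Integrals of tensor products over the plane *)

Section Integrals.
Context {R : realType}.
Implicit Types (f g F : R -> R) (d : R).

(** Only the radius matters: a bump centred elsewhere is supported in a larger
    interval around 0. *)
Definition supp d f := forall x, f x != 0 -> `|x| <= d.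

Lemma supp_itv d f : supp d f -> f = f \_ `[- d, d].
Proof.
move=> sf; apply/funext => x; rewrite patchE; case: ifPn => // xd.
apply/eqP; apply: contraNT xd => /sf; rewrite ler_norml => xd.
by rewrite inE /= in_itv.
Qed.

Lemma integrable_supp d f : continuous f -> supp d f ->
  (@lebesgue_measure R).-integrable setT (EFin \o f).
Proof.
move=> cf sf; rewrite (supp_itv sf) -restrict_EFin.
suff : (@lebesgue_measure R).-integrable `[- d, d] (EFin \o f).
  by rewrite integrable_mkcond//; exact: measurable_itv.
apply: continuous_compact_integrable; first exact: segment_compact.
by apply: continuous_subspaceT.
Qed.

Lemma int_derive1 d F : smooth F -> 0 < d -> supp d (derive1 F) ->
  \int[@lebesgue_measure R]_x derive1 F x = F d - F (- d).
Proof.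
move=> sF d0 sf.
rewrite [X in \int[_]_x X x](supp_itv sf) -Rintegral_mkcond /Rintegral.
rewrite (@continuous_FTC2 _ (derive1 F) F)//; first by lra.
- apply: continuous_subspaceT; exact/smooth_continuous/smooth_derive1.
- split.
  + by move=> x _; exact: smooth_derivable.
  + by apply: cvg_at_right_filter; exact: smooth_continuous.
  + by apply: cvg_at_left_filter; exact: smooth_continuous.
Qed.

Lemma supp_bounded d f : continuous f -> supp d f ->
  exists2 M : R, 0 <= M & forall x, `|f x| <= M.
Proof.
move=> cf sf.
have [d0|d0] := ltP d 0.
  exists 0 => // x; rewrite normr_le0; apply: contraT => /sf.
  by move=> /(le_lt_trans)/(_ d0); rewrite normr_lt0.
have cn : {within `[- d, d], continuous (fun x => `|f x|)}.
  apply: continuous_subspaceT => x; apply: continuous_comp; first exact: cf.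
  exact: norm_continuous.
have [|c _ cmax] := EVT_max _ cn; first by lra.
exists `|f c| => // x.
have [->|fx] := eqVneq (f x) 0; first by rewrite normr0.
by apply: cmax; rewrite in_itv/= -ler_norml; exact: sf.
Qed.

Definition tens f g (z : plane R) : R := f z.1 * g z.2.

Definition box (x : plane R) (r : R) : set (plane R) :=
  `[x.1 - r, x.1 + r] `*` `[x.2 - r, x.2 + r].

Lemma boxP x r z : box x r z <-> `|z.1 - x.1| <= r /\ `|z.2 - x.2| <= r.
Proof.
rewrite /box /= !in_itv/= !ler_distl.
by split => [[] //|[-> ->]].
Qed.

Lemma measurable_box x (r : R) :
  measurable (box x r : set (measurableTypeR R * measurableTypeR R)).
Proof. by apply: measurableX; exact: measurable_itv. Qed.

Lemma mu2_box x (r : R) : 0 <= r -> mu2 (box x r) = (4 * r ^+ 2)%:E.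
Proof.
move=> r0.
have -> : mu2 (box x r) = (@lebesgue_measure R `[(x.1 - r)%R, (x.1 + r)%R] *
    @lebesgue_measure R `[(x.2 - r)%R, (x.2 + r)%R])%E.
  by apply: product_measure1E; exact: measurable_itv.
rewrite !lebesgue_measure_itv /= !lte_fin.
case: ltP => h1; last first.
  have -> : r = 0 by lra.
  by rewrite mul0e expr0n/= mulr0.
have -> : x.2 - r < x.2 + r by lra.
by rewrite -!EFinD -EFinM; congr EFin; ring.
Qed.

(** Bounded measurable functions supported in a box are the only integrands
    against which [u] is paired. *)
Lemma integrable_box (w : plane R -> R) x r C :
  measurable_fun setT (w : measurableTypeR R * measurableTypeR R -> R) ->
  (forall z, `|w z| <= C) ->
  (forall z, w z != 0 -> box x r z) ->
  mu2.-integrable setT (EFin \o w).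
Proof.
move=> mw wC ws.
have -> : w = w \_ (box x r).
  apply/funext => z; rewrite patchE; case: ifPn => // xd.
  by apply/eqP; apply: contraNT xd => /ws ?; rewrite inE.
rewrite -restrict_EFin.
apply: (iffLR (integrable_mkcond _ (measurable_box x r))).
apply: measurable_bounded_integrable; first exact: measurable_box.
- have [r0|r0] := leP 0 r; first by rewrite mu2_box// ltry.
  rewrite (_ : box x r = set0) ?measure0 ?ltry//.
  rewrite -subset0 => z /boxP[+ _] => /le_lt_trans/(_ r0).
  by rewrite normr_lt0.
- exact: measurable_funS mw.
- exists C; split; first exact: num_real.
  by move=> y Cy z _; apply: le_trans (wC z) (ltW Cy).
Qed.

Lemma measurable_tens f g : continuous f -> continuous g ->
  measurable_fun setT (tens f g : measurableTypeR R * measurableTypeR R -> R).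
Proof.
move=> cf cg; apply: measurable_funM.
- apply: (@measurableT_comp _ _ _ _ _ _ f) => //.
  exact: continuous_measurable_fun.
- apply: (@measurableT_comp _ _ _ _ _ _ g) => //.
  exact: continuous_measurable_fun.
Qed.

Lemma tens_supp d f g z : supp d f -> supp d g -> tens f g z != 0 -> box 0 d z.
Proof.
move=> sf sg; rewrite mulf_eq0 negb_or => /andP[/sf h1 /sg h2].
by apply/boxP; rewrite !subr0.
Qed.

Lemma tens_bounded d f g : continuous f -> continuous g -> supp d f -> supp d g ->
  exists2 M : R, 0 <= M & forall z, `|tens f g z| <= M.
Proof.
move=> cf cg sf sg.
have [M M0 fM] := supp_bounded cf sf; have [N N0 gN] := supp_bounded cg sg.
by exists (M * N) => [|z]; rewrite ?mulr_ge0// normrM ler_pM.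
Qed.

Lemma integrable_tens d f g : continuous f -> continuous g -> supp d f -> supp d g ->
  mu2.-integrable setT (EFin \o tens f g).
Proof.
move=> cf cg sf sg; have [M _ hM] := tens_bounded cf cg sf sg.
apply: integrable_box (measurable_tens cf cg) hM _ => z.
exact: (tens_supp sf sg).
Qed.

Lemma int_tens d f g : continuous f -> continuous g -> supp d f -> supp d g ->
  \int[mu2]_z tens f g z =
  (\int[@lebesgue_measure R]_x f x) * (\int[@lebesgue_measure R]_x g x).
Proof.
move=> cf cg sf sg; rewrite /Rintegral.
have ig := integrable_supp cg sg.
have if_ := integrable_supp cf sf.
rewrite -(integral12_prod_meas1 (integrable_tens cf cg sf sg))/=.
rewrite /fubini_F /=.
have -> : (fun x : measurableTypeR R => \int[@lebesgue_measure R]_y (tens f g (x, y))%:E)%E =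
  (fun x => (f x)%:E * (\int[@lebesgue_measure R]_y g y)%:E)%E.
  apply/funext => x; rewrite /tens/=.
  under eq_integral do rewrite EFinM.
  rewrite integralZl//=; congr (_ * _)%E.
  by rewrite /Rintegral fineK// integrable_fin_num.
by rewrite integralZr//= fineM// ?integrable_fin_num//.
Qed.

End Integrals.

(** * Tensor products as test functions *)

Section TestFunctions.
Context {R : realType}.
Implicit Types (f g : R -> R) (d : R).

Lemma derive_tens1 f g z : smooth f ->
  'D_((1, 0) : plane R) (tens f g) z = tens (derive1 f) g z.
Proof.
move=> sf; rewrite /derive /tens.
have dM := is_deriveM (smooth_is_derive z.1 sf) (is_derive_cst (g z.2) z.1 (1 : R)).
case: dM => _; rewrite /derive /GRing.scale/= mulr0 add0r => E; rewrite [RHS]mulrC -E.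
apply: (congr1 (fun F : R -> R => lim (F @ (0 : R)^'))); apply/funext => h /=.
by rewrite /GRing.scale/= !mulr1 mulr0 add0r.
Qed.

Lemma derive_tens2 f g z : smooth g ->
  'D_((0, 1) : plane R) (tens f g) z = tens f (derive1 g) z.
Proof.
move=> sg; rewrite /derive /tens.
have dM := is_deriveM (is_derive_cst (f z.1) z.2 (1 : R)) (smooth_is_derive z.2 sg).
case: dM => _; rewrite /derive /GRing.scale/= mulr0 addr0 => E; rewrite -E.
apply: (congr1 (fun F : R -> R => lim (F @ (0 : R)^'))); apply/funext => h /=.
by rewrite /GRing.scale/= !mulr1 mulr0 add0r.
Qed.

Lemma smooth_derive1n n f : smooth f -> smooth (derive1n n f).
Proof.
by move=> sf; elim: n => [//|n IH]; rewrite derive1nS; exact: smooth_derive1.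
Qed.

Lemma partial_tens i j f g : smooth f -> smooth g ->
  partial i j (tens f g) = tens (derive1n i f) (derive1n j g).
Proof.
move=> sf sg; rewrite /partial.
have -> : iter j (fun (f : plane R -> R) x => 'D_((0, 1) : plane R) f x) (tens f g) = tens f (derive1n j g).
  elim: j => [//|j IH]; rewrite iterS IH; apply/funext => z.
  by rewrite derive_tens2 ?derive1nS//; exact: smooth_derive1n.
elim: i => [//|i IH]; rewrite iterS IH; apply/funext => z.
by rewrite derive_tens1 ?derive1nS//; exact: smooth_derive1n.
Qed.

Lemma differentiable_tens f g z : smooth f -> smooth g -> differentiable (tens f g) z.
Proof.
move=> sf sg; apply: differentiableM.
  apply: (@differentiable_comp _ _ _ _ (fst : plane R -> R) f).
    by apply: linear_differentiable => ?; exact: cvg_fst.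
  exact/derivable1_diffP/smooth_derivable.
apply: (@differentiable_comp _ _ _ _ (snd : plane R -> R) g).
  by apply: linear_differentiable => ?; exact: cvg_snd.
exact/derivable1_diffP/smooth_derivable.
Qed.

(** Products of one-variable bumps are enough test functions for the whole
    argument: their dilates are again products. *)
Lemma test_function_tens Omega f g x r : smooth f -> smooth g ->
  (forall z, tens f g z != 0 -> box x r z) -> box x r `<=` Omega ->
  test_function Omega (tens f g).
Proof.
move=> sf sg sb bO.
have cb : compact (box x r) by apply: compact_setX; exact: segment_compact.
have clb : closed (box x r) by apply: compact_closed.
have scl : closure [set z | tens f g z != 0] `<=` box x r.
  by rewrite [X in _ `<=` X]((closure_id _).1 clb); apply: closure_subset => z /sb.
split.
- move=> i j z; rewrite partial_tens//.
  by apply: differentiable_tens; exact: smooth_derive1n.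
- by apply: subclosed_compact scl => //; exact: closed_closure.
- exact: subset_trans bO.
Qed.

End TestFunctions.

(** * Pairing with a dilated bump *)

Section Flow.
Context {R : realType}.
Implicit Types (f g : R -> R) (k : nat) (s t : R).

Lemma supp_derive1 (d : R) f : supp d f -> supp d (derive1 f).
Proof.
move=> sf x; apply: contraNT; rewrite -ltNge => dx.
rewrite derive1E (@near_eq_derive _ R R f (cst (0:R))) ?derive_cst//.
have [x0|x0] := leP 0 x.
  rewrite ger0_norm// in dx.
  near=> y; apply/eqP; apply: contraT => /sf; rewrite leNgt.
  by rewrite (lt_le_trans _ (ler_norm y))//; near: y; exact: lt_nbhsr.
rewrite ltr0_norm// in dx.
near=> y; apply/eqP; apply: contraT => /sf; rewrite leNgt -normrN.
rewrite (lt_le_trans _ (ler_norm _))// ltrNr; near: y; apply: lt_nbhsl.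
by rewrite ltrNr.
Unshelve. all: end_near. Qed.

(** The Euler operator: dilation derivatives of [f] are expressed by it. *)
Definition euler f : R -> R := fun s => s * derive1 f s.

Lemma smooth_euler f : smooth f -> smooth (euler f).
Proof. by move=> sf; apply: smoothM; [exact: smooth_id|exact: smooth_derive1]. Qed.

Lemma supp_euler (d : R) f : supp d f -> supp d (euler f).
Proof.
by move=> /supp_derive1 sf s; rewrite mulf_eq0 negb_or => /andP[_ /sf].
Qed.

Definition dil (x : plane R) (t : R) (z : plane R) : plane R :=
  (t^-1 * (z.1 - x.1), t^-1 * (z.2 - x.2)).

(** The derivative in t of t^-k F(z / t) is t^-(k+1) times this combination. *)
Definition dtens k f g (z : plane R) : R :=
  - (k%:R * tens f g z + tens (euler f) g z + tens f (euler g) z).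

Lemma is_derive_dil_tens k f g x z (t : R) : smooth f -> smooth g -> 0 < t ->
  is_derive t 1 (fun t => t^-1 ^+ k * tens f g (dil x t z))
    (t^-1 ^+ k.+1 * dtens k f g (dil x t z)).
Proof.
move=> sf sg t0; set p := z.1 - x.1; set q := z.2 - x.2.
have dt : is_derive t 1 (fun y : R => y^-1) (- t ^- 2).
  have := @is_deriveV _ id t 1 1 (lt0r_neq0 t0) (is_derive_id t 1).
  by rewrite /= /GRing.scale /= mulr1.
have dcomp h c : smooth h -> is_derive t^-1 1 (fun y => h (y * c)) (c * derive1 h (t^-1 * c)).
  move=> sh; have := @is_derive_affine_arg _ h c 0 t^-1 (derive1 h (c * t^-1 + 0)).
  rewrite addr0 (mulrC c) => H.
  have := H (smooth_is_derive _ sh).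
  by under eq_fun do rewrite addr0 mulrC.
have dX : is_derive t^-1 1 (fun y : R => y ^+ k) (k%:R * t^-1 ^+ k.-1).
  have := is_deriveX k (is_derive_id t^-1 (1 : R)).
  by rewrite exprfctE /GRing.scale/= mulr1.
have dh := is_deriveM dX (is_deriveM (dcomp f p sf) (dcomp g q sg)).
have := @is_derive1_comp _ _ (fun y : R => y^-1) t _ _ dh dt.
rewrite /tens /dil /dtens /euler /tens /= -/p -/q.
move=> H; refine (is_derive_eq H _); rewrite /GRing.scale/= -exprVn.
clear H; rewrite mulrfctE.
by case: k {dX dh} => [|k] /=; rewrite !exprS; ring.
Qed.

Section Linear.
Context dd (T : measurableType dd) (mu : {measure set T -> \bar R}).
Implicit Types (w : T -> R).

Lemma integrable_lin2 a b w1 w2 :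
  mu.-integrable setT (EFin \o w1) -> mu.-integrable setT (EFin \o w2) ->
  mu.-integrable setT (EFin \o (fun z => a * w1 z + b * w2 z)).
Proof.
move=> i1 i2; have := integrableD measurableT (integrableZl measurableT a i1)
  (integrableZl measurableT b i2).
by apply: eq_integrable => // z _; rewrite /= !EFinM EFinD.
Qed.

Lemma Rintegral_lin2 a b w1 w2 :
  mu.-integrable setT (EFin \o w1) -> mu.-integrable setT (EFin \o w2) ->
  \int[mu]_z (a * w1 z + b * w2 z) = a * \int[mu]_z w1 z + b * \int[mu]_z w2 z.
Proof.
move=> i1 i2; rewrite RintegralD//; first by rewrite !RintegralZl.
- exact: (integrableZl measurableT a i1).
- exact: (integrableZl measurableT b i2).
Qed.
End Linear.

Section Integrate.
Variables (v : plane R -> R) (M : R) (x : plane R) (d : R).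
Hypothesis mv : measurable_fun setT (v : measurableTypeR R * measurableTypeR R -> R).
Hypothesis vM : forall z, `|v z| <= M.

(** With k = 2 this is the pairing of [v] with the dilate of mass one; higher k
    come from differentiating in t. *)
Definition flow k f g (t : R) : R :=
  \int[mu2]_z (v z * (t^-1 ^+ k * tens f g (dil x t z))).

Lemma box_dil (t : R) z : 0 < t -> box 0 d (dil x t z) -> box x (d * t) z.
Proof.
move=> t0 /boxP; rewrite !subr0 /= !normrM (@gtr0_norm _ t^-1) ?invr_gt0// => -[h1 h2].
by apply/boxP; split; rewrite -ler_pdivrMr// mulrC.
Qed.

Lemma measurable_dil_tens f g t : continuous f -> continuous g ->
  measurable_fun setT (tens f g \o dil x t : measurableTypeR R * measurableTypeR R -> R).
Proof.
move=> cf cg; apply: (measurableT_comp (measurable_tens cf cg)).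
apply/measurable_fun_pairP; split => /=; rewrite /comp/=.
  by apply: measurable_funM => //; apply: measurable_funB.
by apply: measurable_funM => //; apply: measurable_funB.
Qed.

Lemma integrable_flow k f g (t : R) : continuous f -> continuous g ->
  supp d f -> supp d g -> 0 < t ->
  mu2.-integrable setT (EFin \o (fun z => v z * (t^-1 ^+ k * tens f g (dil x t z)))).
Proof.
move=> cf cg sf sg t0; have [N N0 hN] := tens_bounded cf cg sf sg.
apply: (@integrable_box _ _ x (d * t) (M * (t^-1 ^+ k * N))).
- apply: measurable_funM => //; apply: measurable_funM => //.
  exact: measurable_dil_tens.
- move=> z; rewrite normrM ler_pM// normrM ler_pM//.
  by rewrite ger0_norm// exprn_ge0// invr_ge0 ltW.
- move=> z; rewrite mulf_eq0 negb_or => /andP[_]; rewrite mulf_eq0 negb_or => /andP[_] h.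
  by apply: box_dil => //; exact: (tens_supp sf sg).
Qed.

(** Differentiation under the integral sign: for s between t/2 and 2t the
    integrands live in a fixed box and are bounded there. *)
Lemma is_derive_flow k f g (t : R) : smooth f -> smooth g ->
  supp d f -> supp d g -> 0 < t ->
  is_derive t 1 (flow k f g)
    (- (k%:R * flow k.+1 f g t + flow k.+1 (euler f) g t + flow k.+1 f (euler g) t)).
Proof.
move=> sf sg ssf ssg t0.
have cf := smooth_continuous sf; have cg := smooth_continuous sg.
have cef := smooth_continuous (smooth_euler sf).
have ceg := smooth_continuous (smooth_euler sg).
have sef := supp_euler ssf; have seg := supp_euler ssg.
have [N1 N10 h1] := tens_bounded cf cg ssf ssg.
have [N2 N20 h2] := tens_bounded cef cg sef ssg.
have [N3 N30 h3] := tens_bounded cf ceg ssf seg.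
have hd z : `|dtens k f g z| <= k%:R * N1 + N2 + N3.
  rewrite normrN; apply: le_trans (ler_normD _ _) _; apply: lerD => //.
  apply: le_trans (ler_normD _ _) _; apply: lerD => //.
  by rewrite normrM ger0_norm// ler_wpM2l.
have M0 : 0 <= M by apply: le_trans (vM 0).
pose h (s : R) (z : plane R) : R := v z * (s^-1 ^+ k * tens f g (dil x s z)).
have dh (z : plane R) (s : R) : 0 < s -> is_derive s 1 (h^~ z) (v z * (s^-1 ^+ k.+1 * dtens k f g (dil x s z))).
  move=> s0; have := is_deriveZ (v z) (is_derive_dil_tens k x z sf sg s0).
  by rewrite /GRing.scale.
(* the bound at the smallest parameter, t / 2 *)
pose C := M * ((t / 2)^-1 ^+ k.+1 * (k%:R * N1 + N2 + N3)).
have C0 : 0 <= C.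
  rewrite mulr_ge0// mulr_ge0//; first by rewrite exprn_ge0// invr_ge0 divr_ge0// ltW.
  by rewrite !addr_ge0// mulr_ge0.
pose G := fun z : plane R => C * \1_(box x (d * (2 * t))) z.
have Ioo (s : R) : `](t / 2), (2 * t)[%classic s -> 0 < s.
  by rewrite /= in_itv/= => /andP[+ _]; apply: lt_trans; rewrite divr_gt0.
have d1 (s : R) z : `](t / 2), (2 * t)[%classic s -> partial1of2 h s z = v z * (s^-1 ^+ k.+1 * dtens k f g (dil x s z)).
  by move=> /Ioo s0; rewrite partial1of2E; have [_ ->] := dh z s s0.
have It : `](t / 2), (2 * t)[%classic t by rewrite /= in_itv/=; apply/andP; split; lra.
have ih (s : R) : `](t / 2), (2 * t)[%classic s -> mu2.-integrable setT (EFin \o h s).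
  by move=> /Ioo s0; exact: integrable_flow.
have dh' (s : R) z : `](t / 2), (2 * t)[%classic s -> setT z -> derivable (h ^~ z) s 1.
  by move=> /Ioo s0 _; case: (dh z s s0).
have G0 z : 0 <= G z by rewrite mulr_ge0.
have iG : mu2.-integrable setT (EFin \o G).
  apply: (@integrable_box _ _ x (d * (2 * t)) C).
  - apply: measurable_funM; first exact: measurable_cst.
    by apply: measurable_indic; exact: measurable_box.
  - move=> z; rewrite ger0_norm// -[leRHS]mulr1 ler_wpM2l//.
  - move=> z; rewrite /G indicE; have [|_] := boolP (z \in _); first by rewrite inE.
    by rewrite mulr0 eqxx.
have hG (s : R) z : `](t / 2), (2 * t)[%classic s -> setT z -> `|partial1of2 h s z| <= G z.
  move=> Is _; rewrite d1//.
  have s0 := Ioo s Is.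
  have [/eqP|nz] := eqVneq (dtens k f g (dil x s z)) 0.
    by move/eqP ->; rewrite !mulr0 normr0.
  have bz : box x (d * (2 * t)) z.
    have bd : box 0 d (dil x s z).
      apply: contrapT => nb; move: nz; rewrite /dtens.
      have z0 u w : supp d u -> supp d w -> tens u w (dil x s z) = 0.
        by move=> su sw; apply/eqP; apply: contrapT => /negP /(tens_supp su sw).
      by rewrite !z0// mulr0 !addr0 oppr0 eqxx.
    have d0 : 0 <= d by move/boxP : bd => -[b _]; apply: le_trans b.
    have /boxP[b1 b2] := box_dil s0 bd.
    move: Is; rewrite /= in_itv/= => /andP[_ st].
    by apply/boxP; split; [apply: le_trans b1 _|apply: le_trans b2 _]; rewrite ler_wpM2l// ltW.
  rewrite /G indicE mem_set// mulr1 /C !normrM ler_pM//.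
  rewrite ler_pM//.
  rewrite ger0_norm ?exprn_ge0// ?invr_ge0 ?(ltW s0)//.
  rewrite lerXn2r ?nnegrE ?invr_ge0 ?divr_ge0 ?(ltW s0) ?(ltW t0)//.
  rewrite lef_pV2 ?posrE ?divr_gt0//.
  by move: Is; rewrite /= in_itv/= => /andP[/ltW].
have dF := derivable_under_integral measurableT It ih dh' G0 iG hG.
have eF := differentiation_under_integral measurableT It ih dh' G0 iG hG.
apply: DeriveDef => //; rewrite -derive1E eF.
have i1 := @integrable_flow k.+1 f g t cf cg ssf ssg t0.
have i2 := @integrable_flow k.+1 (euler f) g t cef cg sef ssg t0.
have i3 := @integrable_flow k.+1 f (euler g) t cf ceg ssf seg t0.
have := Rintegral_lin2 (- k%:R) (-1) i1 (integrable_lin2 1 1 i2 i3).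
rewrite [X in _ = _ + -1 * X -> _](Rintegral_lin2 1 1 i2 i3) -!/(flow _ _ _ _) => E.
transitivity (- k%:R * flow k.+1 f g t +
  -1 * (1 * flow k.+1 (euler f) g t + 1 * flow k.+1 f (euler g) t)); last by ring.
rewrite -E.
by apply: eq_Rintegral => y _; rewrite d1// /dtens; ring.
Qed.

End Integrate.
End Flow.

(** * Taylor expansion along dilations *)

Section LocalEstimate.
Context {R : realType}.
Implicit Types (f g S : R -> R) (k : nat) (s t e y : R).

(** (s^2 f)'' and (s f)', written with the Euler operator as they come out of
    differentiating [flow] twice. *)
Definition deriv2_moment2 f : R -> R := fun s => 2 * f s + 3 * euler f s + euler (euler f) s.
Definition deriv1_moment1 f : R -> R := fun s => f s + euler f s.

Lemma derive1M f g : smooth f -> smooth g ->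
  derive1 (fun s => f s * g s) = fun s => f s * derive1 g s + g s * derive1 f s.
Proof.
move=> sf sg; apply: derive1_funE => s.
exact: is_deriveM (smooth_is_derive s sf) (smooth_is_derive s sg).
Qed.

Lemma derive1D f g : smooth f -> smooth g ->
  derive1 (fun s => f s + g s) = fun s => derive1 f s + derive1 g s.
Proof.
move=> sf sg; apply: derive1_funE => s.
exact: is_deriveD (smooth_is_derive s sf) (smooth_is_derive s sg).
Qed.

Lemma derive1_id : derive1 (@id R) = cst 1.
Proof. by apply: derive1_funE => s; exact: is_derive_id. Qed.

Lemma deriv1_moment1E f : smooth f -> deriv1_moment1 f = derive1 (fun s => s * f s).
Proof.
move=> sf; rewrite (derive1M (@smooth_id R) sf) derive1_id.
by apply/funext => s; rewrite /deriv1_moment1 /euler /=; ring.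
Qed.

Lemma deriv2_moment2E f : smooth f -> deriv2_moment2 f = derive1 (derive1 (fun s => s * (s * f s))).
Proof.
move=> sf.
have se := smooth_euler sf.
have sm : smooth (fun s => s * f s) by apply: smoothM => //; exact: smooth_id.
have sl : smooth (deriv1_moment1 f) by exact: smoothD.
have -> : derive1 (fun s => s * (s * f s)) = fun s => s * deriv1_moment1 f s + s * f s.
  rewrite (derive1M (@smooth_id R) sm) derive1_id -deriv1_moment1E//.
  by apply/funext => s; rewrite /cst /= mulr1.
rewrite derive1D//; last by apply: smoothM => //; exact: smooth_id.
rewrite -deriv1_moment1E// -deriv1_moment1E// /deriv1_moment1 /euler derive1D//.
by apply/funext => s; rewrite /deriv2_moment2 /euler /=; ring.
Qed.

Lemma supp_lin (d a b : R) f g : supp d f -> supp d g ->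
  supp d (fun s => a * f s + b * g s).
Proof.
move=> sf sg s nz; have [f0|/sf//] := eqVneq (f s) 0.
have [g0|/sg//] := eqVneq (g s) 0.
by rewrite f0 g0 !mulr0 addr0 eqxx in nz.
Qed.

(** The tangent of U at 1, evaluated at e, minus U e: its derivative in the
    point of tangency t is (e - t) U''(t), which is at most N because U'' is
    at most N / t. *)
Lemma tangent_bound (U dU W : R -> R) (N e : R) :
  (forall t, 0 < t -> is_derive t 1 U (dU t)) ->
  (forall t, 0 < t -> is_derive t 1 dU (W t)) ->
  (forall t, 0 < t -> t <= 1 -> `|W t| <= N / t) ->
  0 < e -> e < 1 -> `|U 1 + (e - 1) * dU 1 - U e| <= N.
Proof.
move=> is_derive_U is_derive_dU WN e0 e1.
pose G t := U t + (e - t) * dU t.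
have dG t : 0 < t -> is_derive t 1 G ((e - t) * W t).
  move=> t0.
  have d1 := is_derive_U t t0; have d2 := is_derive_dU t t0.
  have d3 : is_derive t 1 (fun s : R => e - s) (- 1).
    have := is_deriveB (is_derive_cst e t 1) (is_derive_id t (1 : R)).
    by rewrite sub0r.
  have := is_deriveD d1 (is_deriveM d3 d2).
  move=> H; refine (is_derive_eq H _).
  by rewrite /GRing.scale/=; ring.
have cG : {within `[e, 1], continuous G}.
  apply: derivable_within_continuous => t; rewrite in_itv/= => /andP[te _].
  by case: (dG t (lt_le_trans e0 te)).
have dG' t : t \in `]e, 1[ -> is_derive t 1 G ((e - t) * W t).
  by rewrite in_itv/= => /andP[te _]; apply: dG; exact: lt_trans te.
have [c] := MVT e1 dG' cG.
rewrite in_itv/= => /andP[ec c1] E.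
have c0 : 0 < c by exact: lt_trans ec.
have -> : U 1 + (e - 1) * dU 1 - U e = G 1 - G e by rewrite /G subrr mul0r addr0.
rewrite E normrM normrM.
have hc := WN c c0 (ltW c1).
have N0 : 0 <= N.
  by have := le_trans (normr_ge0 _) hc; rewrite pmulr_lge0// invr_gt0.
rewrite (ltr0_norm (_ : e - c < 0)) ?subr_lt0// opprB (@gtr0_norm _ (1 - e)) ?subr_gt0//.
apply: (@le_trans _ _ ((c - e) * (N / c))).
  have h1 : (c - e) * `|W c| <= (c - e) * (N / c) by rewrite ler_wpM2l//; lra.
  by rewrite -[leRHS]mulr1 ler_pM ?mulr_ge0//; lra.
rewrite mulrCA -[leRHS]mulr1 ler_wpM2l// ler_pdivrMr//; lra.
Qed.

(** The limit e -> 0 of the tangent bound. *)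
Lemma tangent_limit (U : R -> R) (v0 N a b : R) :
  (forall e, 0 < e -> e < 1 -> `|a + (e - 1) * b - U e| <= N) ->
  (forall e, 0 < e -> exists2 t0, 0 < t0 &
    forall t, 0 < t -> t < t0 -> `|U t - v0| <= e) ->
  `|v0 - (a - b)| <= N.
Proof.
move=> taylor near.
apply/ler_addgt0Pr => e e0.
have e2 : 0 < e / 2 by rewrite divr_gt0.
have [t0 t00 ht] := near _ e2.
have D0 : 0 < `|b| + 1 by rewrite ltr_wpDl.
pose t := Num.min (t0 / 2) (Num.min (1 / 2) (e / 2 / (`|b| + 1))).
have tp : 0 < t by rewrite !lt_min !divr_gt0.
have t1 : t < 1.
  by rewrite /t !gt_min; apply/orP; right; apply/orP; left; lra.
have tt : t < t0 by rewrite /t gt_min; apply/orP; left; lra.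
have te : t * `|b| <= e / 2.
  apply: (@le_trans _ _ (t * (`|b| + 1))); first by rewrite ler_wpM2l ?(ltW tp)//; lra.
  by rewrite -ler_pdivlMr// /t !ge_min lexx !orbT.
have h1 := ht t tp tt; have h2 := taylor _ tp t1.
have -> : v0 - (a - b) = - (a + (t - 1) * b - U t) - (U t - v0) + t * b by ring.
apply: le_trans (ler_normD _ _) _.
apply: le_trans (lerD (ler_normB _ _) (lexx _)) _.
rewrite normrN (normrM t) (gtr0_norm tp).
by lra.
Qed.

Definition stepfun (d : R) S := [/\ smooth S, supp d (derive1 S),
  forall s, 0 <= derive1 S s, forall s, d <= s -> S s = 1
  & forall s, s <= - d -> S s = 0].

Variables (v : plane R -> R) (M : R) (x : plane R) (d : R) (S1 S2 : R -> R).
Hypothesis d0 : 0 < d.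
Hypothesis mv : measurable_fun setT (v : measurableTypeR R * measurableTypeR R -> R).
Hypothesis vM : forall z, `|v z| <= M.
Hypothesis S1s : stepfun d S1.
Hypothesis S2s : stepfun d S2.

Let A := derive1 S1.
Let B := derive1 S2.

Let sA : smooth A. Proof. by apply: smooth_derive1; case: S1s. Qed.
Let sB : smooth B. Proof. by apply: smooth_derive1; case: S2s. Qed.
Let sd1 : supp d A. Proof. by case: S1s. Qed.
Let sd2 : supp d B. Proof. by case: S2s. Qed.

Lemma flow_linl k a b f f' g t : continuous f -> continuous f' -> continuous g ->
  supp d f -> supp d f' -> supp d g -> 0 < t ->
  flow v x k (fun s => a * f s + b * f' s) g t =
  a * flow v x k f g t + b * flow v x k f' g t.
Proof.
move=> cf cf' cg sf sf' sg t0.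
have i1 := integrable_flow x mv vM k cf cg sf sg t0.
have i2 := integrable_flow x mv vM k cf' cg sf' sg t0.
have E := Rintegral_lin2 a b i1 i2; rewrite /flow -E.
by apply: eq_Rintegral => z _; rewrite /tens; ring.
Qed.

Lemma flow_linr k a b f g g' t : continuous f -> continuous g -> continuous g' ->
  supp d f -> supp d g -> supp d g' -> 0 < t ->
  flow v x k f (fun s => a * g s + b * g' s) t =
  a * flow v x k f g t + b * flow v x k f g' t.
Proof.
move=> cf cg cg' sf sg sg' t0.
have i1 := integrable_flow x mv vM k cf cg sf sg t0.
have i2 := integrable_flow x mv vM k cf cg' sf sg' t0.
have E := Rintegral_lin2 a b i1 i2; rewrite /flow -E.
by apply: eq_Rintegral => z _; rewrite /tens; ring.
Qed.

(** The second derivative of the pairing, as a pairing with second derivatives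
    of compactly supported functions, so that weak derivatives can be shifted
    onto [v]. *)
Definition hess t := flow v x 4 (deriv2_moment2 A) B t + 2 * flow v x 4 (deriv1_moment1 A) (deriv1_moment1 B) t
  + flow v x 4 A (deriv2_moment2 B) t.

Let U t := flow v x 2 A B t.
Let dU t := - (2 * flow v x 3 A B t + flow v x 3 (euler A) B t + flow v x 3 A (euler B) t).

Let is_derive_U t : 0 < t -> is_derive t 1 U (dU t).
Proof. by move=> t0; exact: (is_derive_flow x mv vM 2 sA sB sd1 sd2 t0). Qed.

Let is_derive_dU t : 0 < t -> is_derive t 1 dU (hess t).
Proof.
move=> t0.
have sA1 := smooth_euler sA; have sB1 := smooth_euler sB.
have sA2 := smooth_euler sA1; have sB2 := smooth_euler sB1.
have pA1 := supp_euler sd1; have pB1 := supp_euler sd2.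
have pA2 := supp_euler pA1; have pB2 := supp_euler pB1.
have h1 := is_derive_flow x mv vM 3 sA sB sd1 sd2 t0.
have h2 := is_derive_flow x mv vM 3 sA1 sB pA1 sd2 t0.
have h3 := is_derive_flow x mv vM 3 sA sB1 sd1 pB1 t0.
have := is_deriveN (is_deriveD (is_deriveD (is_deriveZ 2 h1) h2) h3).
move=> H; refine (is_derive_eq H _).
have cc := @smooth_continuous R.
rewrite /hess.
have cA := cc _ sA; have cB := cc _ sB.
have cA1 := cc _ sA1; have cB1 := cc _ sB1.
have cA2 := cc _ sA2; have cB2 := cc _ sB2.
have cA' : continuous (fun s => 2 * A s + 3 * euler A s).
  by apply/cc/smoothD; apply: smoothM => //; exact: smooth_cst.
have cB' : continuous (fun s => 2 * B s + 3 * euler B s).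
  by apply/cc/smoothD; apply: smoothM => //; exact: smooth_cst.
have pA' : supp d (fun s => 2 * A s + 3 * euler A s).
  by apply: supp_lin.
have pB' : supp d (fun s => 2 * B s + 3 * euler B s).
  by apply: supp_lin.
have -> : deriv2_moment2 A = fun s => 1 * (2 * A s + 3 * euler A s) + 1 * euler (euler A) s.
  by apply/funext => s; rewrite /deriv2_moment2 !mul1r.
have -> : deriv2_moment2 B = fun s => 1 * (2 * B s + 3 * euler B s) + 1 * euler (euler B) s.
  by apply/funext => s; rewrite /deriv2_moment2 !mul1r.
have fB : deriv1_moment1 B = fun s => 1 * B s + 1 * euler B s.
  by apply/funext => s; rewrite /deriv1_moment1 !mul1r.
have cfB : continuous (deriv1_moment1 B) by apply/cc/smoothD.
have pfB : supp d (deriv1_moment1 B) by rewrite fB; exact: supp_lin.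
have -> : deriv1_moment1 A = fun s => 1 * A s + 1 * euler A s.
  by apply/funext => s; rewrite /deriv1_moment1 !mul1r.
rewrite (flow_linl 4 1 1 cA' cA2 cB pA' pA2 sd2 t0).
rewrite (flow_linl 4 2 3 cA cA1 cB sd1 pA1 sd2 t0).
rewrite (flow_linr 4 1 1 cA cB' cB2 sd1 pB' pB2 t0).
rewrite (flow_linr 4 2 3 cA cB cB1 sd1 sd2 pB1 t0).
rewrite (flow_linl 4 1 1 cA cA1 cfB sd1 pA1 pfB t0) fB.
rewrite (flow_linr 4 1 1 cA cB cB1 sd1 sd2 pB1 t0).
rewrite (flow_linr 4 1 1 cA1 cB cB1 pA1 sd2 pB1 t0).
move: (flow v x 4 A B t) (flow v x 4 (euler A) B t) (flow v x 4 A (euler B) t)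
  (flow v x 4 (euler A) (euler B) t) (flow v x 4 (euler (euler A)) B t)
  (flow v x 4 A (euler (euler B)) t) => ? ? ? ? ? ?.
rewrite /GRing.scale/=; ring.
Qed.

Variable N : R.
Hypothesis hessN : forall t, 0 < t -> t <= 1 -> `|hess t| <= N / t.

Lemma flow_taylor e : 0 < e -> e < 1 -> `|U 1 + (e - 1) * dU 1 - U e| <= N.
Proof. exact: tangent_bound is_derive_U is_derive_dU hessN. Qed.

(** A dilated bump is the derivative of a dilated step function. *)
Lemma mass1 S y t : stepfun d S -> 0 < t ->
  \int[@lebesgue_measure R]_p (t^-1 * derive1 S (t^-1 * (p - y))) = 1.
Proof.
move=> [sS pS _ S1' S0'] t0.
pose F p := S (t^-1 * p + - (t^-1 * y)).
have sF : smooth F by exact: smooth_affine_arg.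
have dF : derive1 F = fun p => t^-1 * derive1 S (t^-1 * (p - y)).
  apply: derive1_funE => p; rewrite mulrBr.
  by apply: is_derive_affine_arg; exact: smooth_is_derive.
have nt : 0 < t^-1 by rewrite invr_gt0.
have D0 : 0 < `|y| + d * t by rewrite ltr_wpDl// mulr_gt0.
have pF : supp (`|y| + d * t) (derive1 F).
  move=> p; rewrite dF mulf_eq0 negb_or => /andP[_ /pS].
  rewrite normrM gtr0_norm// mulrC ler_pdivrMr// => h.
  rewrite -[p](subrK y) addrC; apply: le_trans (ler_normD _ _) _.
  by rewrite lerD2l.
rewrite -dF (int_derive1 sF D0 pF) /F -!mulrBr S1' ?S0' ?subr0//.
- rewrite mulrC ler_pdivrMr// -opprD mulNr lerN2.
  by rewrite addrAC lerDr; have := ler_norm (- y); rewrite normrN; lra.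
- rewrite mulrC ler_pdivlMr//; have := ler_norm y; lra.
Qed.

Lemma mass t : 0 < t ->
  \int[mu2]_z (t^-1 ^+ 2 * tens A B (dil x t z)) = 1.
Proof.
move=> t0.
rewrite (_ : (fun z : plane R => _) = tens (fun p => t^-1 * A (t^-1 * (p - x.1)))
   (fun p => t^-1 * B (t^-1 * (p - x.2)))); last first.
  by apply/funext => z; rewrite /tens/=; ring.
have cont f y : smooth f -> continuous (fun p => t^-1 * f (t^-1 * (p - y))).
  move=> sf; apply: smooth_continuous.
  rewrite (_ : (fun p => _) = fun p => cst t^-1 p * f (t^-1 * p + - (t^-1 * y))).
    by apply: smoothM; [exact: smooth_cst|exact: smooth_affine_arg].
  by apply/funext => p; rewrite mulrBr.
have su f y : supp d f -> supp (`|y| + d * t) (fun p => t^-1 * f (t^-1 * (p - y))).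
  move=> sf p; rewrite mulf_eq0 negb_or => /andP[_ /sf].
  rewrite normrM gtr0_norm ?invr_gt0// mulrC ler_pdivrMr// => h.
  rewrite -[p](subrK y) addrC; apply: le_trans (ler_normD _ _) _.
  by rewrite lerD2l.
rewrite (@int_tens _ (`|x.1| + `|x.2| + d * t)); try exact: cont.
- by rewrite !mass1// mulr1.
- by move=> p /(su _ x.1 sd1) h; apply: le_trans h _; rewrite lerD2r lerDl.
- by move=> p /(su _ x.2 sd2) h; apply: le_trans h _; rewrite lerD2r lerDr.
Qed.

Variable v0 : R.
Hypothesis v0c : forall e, 0 < e -> exists2 t0, 0 < t0 &
  forall t z, 0 < t -> t < t0 -> tens A B (dil x t z) != 0 -> `|v z - v0| <= e.

(** The dilates concentrate at [x], and have mass one. *)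
Lemma flow_near e : 0 < e -> exists2 t0, 0 < t0 & forall t, 0 < t -> t < t0 -> `|U t - v0| <= e.
Proof.
move=> e0; have [t0 t00 ht] := v0c e0; exists t0 => // t tp tt.
pose ph z := t^-1 ^+ 2 * tens A B (dil x t z).
have ph0 z : 0 <= ph z.
  rewrite mulr_ge0 ?exprn_ge0 ?invr_ge0 ?(ltW tp)// mulr_ge0//.
    by case: S1s.
  by case: S2s.
have cA := smooth_continuous sA; have cB := smooth_continuous sB.
have i1 := integrable_flow x mv vM 2 cA cB sd1 sd2 tp.
have i2 : mu2.-integrable setT (EFin \o ph).
  have m1 : measurable_fun setT (cst 1 : measurableTypeR R * measurableTypeR R -> R).
    exact: measurable_cst.
  have b1 (z : plane R) : `|cst 1 z| <= 1 :> R by rewrite normr1.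
  have := integrable_flow x m1 b1 2 cA cB sd1 sd2 tp.
  by under eq_fun do rewrite mul1r.
have -> : U t - v0 = \int[mu2]_z (1 * (v z * ph z) + (- v0) * ph z).
  by rewrite (Rintegral_lin2 1 (- v0) i1 i2) (mass tp) mulr1 mul1r.
have i3 := integrable_lin2 1 (- v0) i1 i2.
apply: (le_trans (le_normr_Rintegral measurableT i3)).
have -> : e = \int[mu2]_z (e * ph z) by rewrite RintegralZl// (mass tp) mulr1.
apply: le_Rintegral => //.
- exact: integrable_norm i3.
- exact: (integrableZl measurableT e i2).
move=> z _; rewrite mul1r -mulrDl normrM (ger0_norm (ph0 z)).
have [->|nz] := eqVneq (ph z) 0; first by rewrite !mulr0.
rewrite ler_wpM2r//; apply: (ht t) => //.
by apply: contraNN nz => /eqP h; rewrite /ph h mulr0.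
Qed.

(** The dilate at t = 1 minus its derivative in t. *)
Definition kappa (z : plane R) : R :=
  3 * tens A B z + tens (euler A) B z + tens A (euler B) z.

Lemma taylor_estimate : `|v0 - \int[mu2]_z (v z * kappa (dil x 1 z))| <= N.
Proof.
have cA := smooth_continuous sA; have cB := smooth_continuous sB.
have cA1 := smooth_continuous (smooth_euler sA).
have cB1 := smooth_continuous (smooth_euler sB).
have -> : \int[mu2]_z (v z * kappa (dil x 1 z)) = U 1 - dU 1.
  have i1 := integrable_flow x mv vM 2 cA cB sd1 sd2 ltr01.
  have i2 := integrable_flow x mv vM 3 cA cB sd1 sd2 ltr01.
  have i3 := integrable_flow x mv vM 3 cA1 cB (supp_euler sd1) sd2 ltr01.
  have i4 := integrable_flow x mv vM 3 cA cB1 sd1 (supp_euler sd2) ltr01.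
  have E1 := Rintegral_lin2 1 2 i1 i2.
  have E2 := Rintegral_lin2 1 1 i3 i4.
  have E := Rintegral_lin2 1 1 (integrable_lin2 1 2 i1 i2) (integrable_lin2 1 1 i3 i4).
  rewrite E1 E2 in E.
  transitivity (1 * (1 * U 1 + 2 * flow v x 3 A B 1) +
     1 * (1 * flow v x 3 (euler A) B 1 + 1 * flow v x 3 A (euler B) 1)); last first.
    by rewrite /dU; ring.
  rewrite -E; apply: eq_Rintegral => z _; rewrite /kappa invr1 !expr1n; ring.
exact: tangent_limit flow_taylor flow_near.
Qed.

End LocalEstimate.

(** * Weak second derivatives tested on boxes *)

Section WeakEstimate.
Context {R : realType}.
Implicit Types (F G : R -> R) (s t y r d : R) (v g w q : plane R -> R).

(** The Cauchy-Schwarz inequality follows from Young inequalities with a free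
    parameter by optimizing it. *)
Lemma le_mean_sqrt (X a b : R) : 0 <= a -> 0 <= b ->
  (forall l, 0 < l -> X <= l * a + b / l) -> X <= 2 * Num.sqrt (a * b).
Proof.
move=> a0 b0 H.
have [a1|a1] := ltP 0 a.
  have [b1|b1] := ltP 0 b.
    have sa : 0 < Num.sqrt a by rewrite sqrtr_gt0.
    have sb : 0 < Num.sqrt b by rewrite sqrtr_gt0.
    have := H (Num.sqrt b / Num.sqrt a) (divr_gt0 sb sa).
    rewrite sqrtrM//; move: (sqr_sqrtr a0) (sqr_sqrtr b0).
    move: (Num.sqrt a) (Num.sqrt b) sa sb => sa sb sa0 sb0 <- <-.
    suff -> : sb / sa * sa ^+ 2 + sb ^+ 2 / (sb / sa) = 2 * (sa * sb) by [].
    by field; rewrite !gt_eqF.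
  have -> : b = 0 by lra.
  rewrite mulr0 sqrtr0 mulr0; apply/ler_addgt0Pr => e e0.
  have := H (e / a) (divr_gt0 e0 a1).
  by rewrite divfK ?gt_eqF// (_ : b = 0) ?mul0r ?addr0 ?add0r//; lra.
have -> : a = 0 by lra.
rewrite mul0r sqrtr0 mulr0; apply/ler_addgt0Pr => e e0.
have d0 : 0 < (b + 1) / e by rewrite divr_gt0//; lra.
have := H _ d0; rewrite (_ : a = 0) ?mulr0 ?add0r; last lra.
move=> h; apply: (le_trans h).
rewrite ler_pdivrMr// mulrC mulfVK ?gt_eqF//; lra.
Qed.

Definition measurable_plane v :=
  measurable_fun setT (v : measurableTypeR R * measurableTypeR R -> R).

Definition sqint (W : set (plane R)) w : R := \int[mu2]_(z in W) (w z ^+ 2).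

Definition measurable_region (W : set (plane R)) :=
  measurable (W : set (measurableTypeR R * measurableTypeR R)).

(** The bound of [p] and the area of its support enter as r C: over a box of
    half-width [r] the L2 norm of [p] is at most 2 r C. *)
Lemma cauchy_schwarz_box (W : set (plane R)) w p (x : plane R) (r C : R) :
  measurable_region W -> measurable_plane w -> measurable_plane p ->
  mu2.-integrable setT (EFin \o (fun z => w z ^+ 2)) ->
  0 <= r -> 0 <= C -> (forall z, `|p z| <= C) ->
  (forall z, p z != 0 -> box x r z) -> box x r `<=` W ->
  `|\int[mu2]_z (w z * p z)| <= 2 * r * C * Num.sqrt (sqint W w).
Proof.
move=> mW mw mp iw r0 C0 pC ps bW.
have iW : mu2.-integrable setT (EFin \o (fun z => \1_W z * w z ^+ 2)).
  have -> : EFin \o (fun z => \1_W z * w z ^+ 2) = (EFin \o (fun z => w z ^+ 2)) \_ W.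
    apply/funext => z; rewrite patchE /= indicE; case: (z \in W) => /=;
      by rewrite ?mul1r ?mul0r.
  rewrite -integrable_mkcond//.
  exact: (integrableS measurableT mW (@subsetT _ _) iw).
have EW : \int[mu2]_z (\1_W z * w z ^+ 2) = sqint W w.
  rewrite /sqint [RHS]Rintegral_mkcond; apply: eq_Rintegral => z _.
  by rewrite patchE indicE; case: (z \in W); rewrite ?mul1r ?mul0r.
have ib : mu2.-integrable setT (EFin \o (fun z : plane R => \1_(box x r) z : R)).
  apply: (@integrable_box _ _ x r 1).
  - by apply: measurable_indic; exact: measurable_box.
  - by move=> z; rewrite indicE; case: (_ \in _); rewrite ?normr1 ?normr0.
  - by move=> z; rewrite indicE; have [|_] := boolP (z \in _); rewrite ?inE ?eqxx.
have Eb : \int[mu2]_z \1_(box x r) z = 4 * r ^+ 2.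
  rewrite /Rintegral integral_indic// ?setIT ?mu2_box//.
  exact: measurable_box.
have Iw0 : 0 <= sqint W w by apply: Rintegral_ge0 => z _; exact: sqr_ge0.
have ptw (l : R) z : 0 < l -> `|w z * p z| <= l * (\1_W z * w z ^+ 2) + (C ^+ 2 / 4 / l) * \1_(box x r) z.
  move=> l0.
  have [p0|p0] := eqVneq (p z) 0.
    rewrite p0 mulr0 normr0; apply: addr_ge0; apply: mulr_ge0 => //.
    + exact: ltW.
    + by apply: mulr_ge0 => //; exact: sqr_ge0.
    + by rewrite divr_ge0 ?(ltW l0)// divr_ge0// sqr_ge0.
  have bz := ps z p0; have Wz := bW _ bz.
  rewrite !indicE !mem_set// mul1r mulr1 normrM.
  have h : `|p z| <= C := pC z.
  have h2 : `|w z| * `|p z| <= `|w z| * C by rewrite ler_wpM2l.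
  apply: (le_trans h2); rewrite -(real_normK (num_real (w z))).
  move: (`|w z|) => a; rewrite -subr_ge0.
  have -> : l * a ^+ 2 + C ^+ 2 / 4 / l - a * C = l * (a - C / (2 * l)) ^+ 2.
    by field; rewrite gt_eqF.
  by rewrite mulr_ge0 ?sqr_ge0 ?ltW.
have iwp : mu2.-integrable setT (EFin \o (fun z => w z * p z)).
  have i1 := integrable_lin2 1 (C ^+ 2 / 4 / 1) iW ib.
  apply: (le_integrable measurableT _ _ i1).
    by apply/measurable_EFinP; apply: measurable_funM.
  move=> z _; rewrite /= lee_fin; apply: le_trans (ptw 1 z ltr01) _.
  exact: ler_norm.
apply: (@le_trans _ _ (2 * Num.sqrt (sqint W w * (r * C) ^+ 2))).
  apply: le_mean_sqrt => //; first exact: sqr_ge0.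
  move=> l l0.
  have i1 := integrable_lin2 l (C ^+ 2 / 4 / l) iW ib.
  apply: (le_trans (le_normr_Rintegral measurableT iwp)).
  have -> : l * sqint W w + (r * C) ^+ 2 / l =
     \int[mu2]_z (l * (\1_W z * w z ^+ 2) + (C ^+ 2 / 4 / l) * \1_(box x r) z).
    rewrite (Rintegral_lin2 l (C ^+ 2 / 4 / l) iW ib) EW Eb; congr (_ + _).
    by field; rewrite gt_eqF.
  apply: le_Rintegral => //.
  - exact: integrable_norm iwp.
  - by move=> z _; exact: ptw.
rewrite sqrtrM// sqrtr_sqr ger0_norm ?mulr_ge0//.
by rewrite [leRHS](_ : _ = 2 * (Num.sqrt (sqint W w) * (r * C)))//; ring.
Qed.

(** Support in an interval of centre [y]; [supp] is the case of centre 0. *)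
Definition suppc y r F := forall s, F s != 0 -> `|s - y| <= r.

Lemma suppc_derive1 y r F : smooth F -> suppc y r F -> suppc y r (derive1 F).
Proof.
move=> sF sf.
pose f s := F (1 * s + y).
have pf : supp r f by move=> s /sf; rewrite mul1r addrK.
have df : derive1 f = fun s => derive1 F (1 * s + y).
  apply: derive1_funE => s; rewrite -[derive1 F _]mul1r.
  by apply: is_derive_affine_arg; exact: smooth_is_derive.
move=> s nz; apply: (supp_derive1 pf); rewrite df mul1r subrK//.
Qed.

(** The identity defining weak derivatives, tested on products.  The functions [v]
    and [g] live on the whole plane (they are extensions by zero), which keeps
    the domain out of the integrals; there is no sign because i + j is even. *)
Definition weak_tens (Omega : set (plane R)) v i j g :=
  forall F G (y : plane R) r, smooth F -> smooth G ->
    suppc y.1 r F -> suppc y.2 r G -> box y r `<=` Omega ->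
    \int[mu2]_z (v z * tens (derive1n i F) (derive1n j G) z) =
    \int[mu2]_z (g z * tens F G z).

Lemma weak_partial_tens Omega i j u g : ~~ odd (i + j) ->
  weak_partial Omega i j u g -> weak_tens Omega (u \_ Omega) i j (g \_ Omega).
Proof.
move=> ev wp F G y r sF sG pF pG bO.
have T : test_function Omega (tens F G).
  apply: (test_function_tens (x := y) (r := r)) => // z.
  rewrite mulf_eq0 negb_or => /andP[/pF h1 /pG h2]; exact/boxP.
have := wp _ T; rewrite partial_tens// -signr_odd (negbTE ev) expr0 mul1r.
rewrite Rintegral_mkcond [in RHS]Rintegral_mkcond.
have E (h p : plane R -> R) : (fun x => h x * p x) \_ Omega = fun z => (h \_ Omega) z * p z.
  by apply/funext => z; rewrite !patchE; case: ifP => //; rewrite mul0r.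
by rewrite !E.
Qed.

Lemma int_id_derive2 D F : smooth F -> 0 < D -> supp D F -> F D = 0 -> F (- D) = 0 ->
  derive1 F D = 0 -> derive1 F (- D) = 0 ->
  \int[@lebesgue_measure R]_s (s * derive1 (derive1 F) s) = 0.
Proof.
move=> sF D0 pF F1 F2 F3 F4.
have sF' := smooth_derive1 sF.
pose H s := s * derive1 F s + (-1) * F s.
have sH : smooth H.
  apply: smoothD; first by apply: smoothM => //; exact: smooth_id.
  by apply: smoothM => //; exact: smooth_cst.
have dH : derive1 H = fun s => s * derive1 (derive1 F) s.
  apply: derive1_funE => s.
  have h1 := is_deriveM (is_derive_id s (1 : R)) (smooth_is_derive s sF').
  have h2 := is_deriveZ (-1) (smooth_is_derive s sF).
  have := is_deriveD h1 h2.
  move=> h; refine (is_derive_eq h _); rewrite /GRing.scale/=; ring.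
rewrite -dH (@int_derive1 _ D)// ?dH.
  by rewrite /H F1 F2 F3 F4 !mulr0 !addr0 subrr.
move=> s; rewrite mulf_eq0 negb_or => /andP[_].
exact: (supp_derive1 (supp_derive1 pF)).
Qed.

Lemma suppc_supp y r F : suppc y r F -> supp (`|y| + r) F.
Proof.
move=> pF s /pF h; rewrite -[s](subrK y) addrC.
by apply: le_trans (ler_normD _ _) _; rewrite lerD2l.
Qed.

Lemma supp_vanish (d D : R) F : d < D -> supp d F -> F D = 0 /\ F (- D) = 0.
Proof.
move=> dD pF; have h s : d < `|s| -> F s = 0.
  by move=> ds; apply/eqP; apply: contraTT ds => /pF; rewrite leNgt.
have D' := lt_le_trans dD (ler_norm D).
by split; apply: h; rewrite ?normrN.
Qed.

Lemma int_derive1_supp (d : R) F : smooth F -> supp d F ->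
  \int[@lebesgue_measure R]_s derive1 F s = 0.
Proof.
move=> sF pF.
have d1 : d < `|d| + 1 by have := ler_norm d; lra.
have d0 : 0 < `|d| + 1 by have := normr_ge0 d; lra.
have [h1 h2] := supp_vanish d1 pF.
rewrite (@int_derive1 _ (`|d| + 1))// ?h1 ?h2 ?subrr//.
by move=> s /(supp_derive1 pF) h; apply: le_trans h (ltW d1).
Qed.

Lemma int_id_derive2_supp (d : R) F : smooth F -> supp d F ->
  \int[@lebesgue_measure R]_s (s * derive1 (derive1 F) s) = 0.
Proof.
move=> sF pF.
have d1 : d < `|d| + 1 by have := ler_norm d; lra.
have d0 : 0 < `|d| + 1 by have := normr_ge0 d; lra.
have [h1 h2] := supp_vanish d1 pF.
have [h3 h4] := supp_vanish d1 (supp_derive1 pF).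
apply: (@int_id_derive2 (`|d| + 1)) => //.
by move=> s /pF h; apply: le_trans h (ltW d1).
Qed.

Lemma int_affine_tens (a b c d : R) F G : smooth F -> smooth G -> supp d F -> supp d G ->
  \int[mu2]_z ((a * z.1 + b * z.2 + c) * tens F G z) =
  a * ((\int[@lebesgue_measure R]_s (s * F s)) * (\int[@lebesgue_measure R]_s G s)) +
  b * ((\int[@lebesgue_measure R]_s F s) * (\int[@lebesgue_measure R]_s (s * G s))) +
  c * ((\int[@lebesgue_measure R]_s F s) * (\int[@lebesgue_measure R]_s G s)).
Proof.
move=> sF sG pF pG.
have cF := smooth_continuous sF; have cG := smooth_continuous sG.
have cX H : smooth H -> continuous (fun s => s * H s).
  by move=> sH; apply/smooth_continuous/smoothM => //; exact: smooth_id.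
have pX H : supp d H -> supp d (fun s => s * H s).
  by move=> pH s; rewrite mulf_eq0 negb_or => /andP[_ /pH].
have i1 := integrable_tens (cX _ sF) cG (pX _ pF) pG.
have i2 := integrable_tens cF (cX _ sG) pF (pX _ pG).
have i3 := integrable_tens cF cG pF pG.
have E1 := Rintegral_lin2 a b i1 i2.
have E2 := Rintegral_lin2 1 c (integrable_lin2 a b i1 i2) i3.
rewrite E1 mul1r (int_tens (cX _ sF) cG (pX _ pF) pG) in E2.
rewrite (int_tens cF (cX _ sG) pF (pX _ pG)) (int_tens cF cG pF pG) in E2.
rewrite -E2; apply: eq_Rintegral => z _; rewrite /tens; ring.
Qed.

Lemma suppc_derive1n y r F n : smooth F -> suppc y r F -> suppc y r (derive1n n F).
Proof.
move=> sF pF; elim: n => [//|n IH]; rewrite derive1nS.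
by apply: suppc_derive1 => //; exact: smooth_derive1n.
Qed.

(** Integrating by parts, all moments of degree at most one of a second
    derivative vanish. *)
Lemma weak_tens_affine Omega (a b c : R) i j : (i + j = 2)%N ->
  weak_tens Omega ((fun z => a * z.1 + b * z.2 + c) \_ Omega) i j (cst 0).
Proof.
move=> ij F G y r sF sG pF pG bO.
have -> : \int[mu2]_z (cst 0 z * tens F G z) = 0.
  rewrite (@eq_Rintegral _ _ _ _ _ (cst 0)); first by rewrite Rintegral_cst// mul0r.
  by move=> z _; rewrite /cst mul0r.
have sF' k := smooth_derive1n k sF; have sG' k := smooth_derive1n k sG.
have pF' k := suppc_derive1n (n := k) sF pF; have pG' k := suppc_derive1n (n := k) sG pG.
transitivity (\int[mu2]_z ((a * z.1 + b * z.2 + c) * tens (derive1n i F) (derive1n j G) z)).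
  apply: eq_Rintegral => z _; rewrite patchE; case: ifPn => // nO.
  rewrite mul0r; have [->|nz] := eqVneq (tens (derive1n i F) (derive1n j G) z) 0.
    by rewrite mulr0.
  exfalso; move/negP: nO; apply; rewrite inE; apply: bO.
  by move: nz; rewrite mulf_eq0 negb_or => /andP[/pF' h1 /pG' h2]; exact/boxP.
pose D := `|y.1| + `|y.2| + r.
have qF k : supp D (derive1n k F).
  by move=> s /(suppc_supp (pF' k)) h; apply: le_trans h _; rewrite lerD2r lerDl.
have qG k : supp D (derive1n k G).
  by move=> s /(suppc_supp (pG' k)) h; apply: le_trans h _; rewrite lerD2r lerDr.
rewrite (int_affine_tens a b c (sF' i) (sG' j) (qF i) (qG j)).
have zF k : \int[@lebesgue_measure R]_s derive1n k.+1 F s = 0.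
  by rewrite derive1nS; exact: int_derive1_supp (sF' k) (qF k).
have zG k : \int[@lebesgue_measure R]_s derive1n k.+1 G s = 0.
  by rewrite derive1nS; exact: int_derive1_supp (sG' k) (qG k).
have zzF : \int[@lebesgue_measure R]_s (s * derive1n 2 F s) = 0.
  exact: int_id_derive2_supp sF (qF 0).
have zzG : \int[@lebesgue_measure R]_s (s * derive1n 2 G s) = 0.
  exact: int_id_derive2_supp sG (qG 0).
have [[-> ->]|[[-> ->]|[-> ->]]] : (i = 2 /\ j = 0) \/ (i = 1 /\ j = 1) \/ (i = 0 /\ j = 2).
  by clear -ij; case: i j ij => [|[|[|i]]] [|[|[|j]]]//= _; tauto.
- by rewrite (zF 1) zzF !(mul0r, mulr0, addr0).
- by rewrite (zF 0) (zG 0) !(mul0r, mulr0, addr0).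
- by rewrite (zG 1) zzG !(mul0r, mulr0, addr0).
Qed.

Lemma derive1n_affine_arg F n (l y : R) : smooth F ->
  derive1n n (fun s => F (l * (s - y))) = fun s => l ^+ n * derive1n n F (l * (s - y)).
Proof.
move=> sF; elim: n => [|n IH].
  by apply/funext => s; rewrite expr0 mul1r.
rewrite !derive1nS IH; apply: derive1_funE => s.
have h := is_derive_affine_arg (b := - (l * y)) (smooth_is_derive (l * s + - (l * y)) (smooth_derive1n n sF)).
have := is_deriveZ (l ^+ n) h.
rewrite /GRing.scale /= mulrA -exprSr -mulrBr.
have -> // : (fun s => l ^+ n * derive1n n F (l * (s - y))) =
  (l ^+ n *: (fun s => derive1n n F (l * s - l * y))).
by apply/funext => u; rewrite mulrBr.
Qed.

Section Hessian.
Variables (Omega W : set (plane R)) (v : plane R -> R) (M : R) (x e : plane R) (d r : R).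
Hypothesis mv : measurable_plane v.
Hypothesis vM : forall z, `|v z| <= M.
Hypothesis r0 : 0 < r.
Hypothesis mW : measurable_region W.
Hypothesis seg : forall t, 0 < t -> t <= 1 ->
  box (x.1 + t * e.1, x.2 + t * e.2) (t * r) `<=` Omega `&` W.

(** The dilate at time t of a function supported near [e] is supported in the
    box around x + t e; scaling turns t^-4 into t^-2 when two derivatives are
    moved, and the Cauchy-Schwarz inequality gains one more t. *)
Lemma flow_weak i j g (f1 g1 : R -> R) (C : R) t : (i + j = 2)%N ->
  weak_tens Omega v i j g -> measurable_plane g ->
  mu2.-integrable setT (EFin \o (fun z => g z ^+ 2)) ->
  smooth f1 -> smooth g1 -> suppc e.1 r f1 -> suppc e.2 r g1 ->
  supp d f1 -> supp d g1 ->
  0 <= C -> (forall z, `|tens f1 g1 z| <= C) -> 0 < t -> t <= 1 ->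
  `|flow v x 4 (derive1n i f1) (derive1n j g1) t| <=
  2 * r * C * Num.sqrt (sqint W g) / t.
Proof.
move=> ij wg mg ig sf sg pf pg df dg C0 hC t0 t1.
have sf' := smooth_derive1n i sf; have sg' := smooth_derive1n j sg.
have dsupp n h : smooth h -> supp d h -> supp d (derive1n n h).
  move=> sh dh; elim: n => [//|n IH]; rewrite derive1nS.
  by apply: supp_derive1.
have i1 := integrable_flow x mv vM 2 (smooth_continuous sf') (smooth_continuous sg')
  (dsupp i _ sf df) (dsupp j _ sg dg) t0.
have -> : flow v x 4 (derive1n i f1) (derive1n j g1) t =
    t^-1 ^+ 2 * flow v x 2 (derive1n i f1) (derive1n j g1) t.
  rewrite /flow -RintegralZl//; apply: eq_Rintegral => z _; ring.
have saff h (y : R) : smooth h -> smooth (fun s => h (t^-1 * (s - y))).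
  move=> sh; have := @smooth_affine_arg _ h t^-1 (- (t^-1 * y)) sh.
  by under eq_fun do rewrite -mulrBr.
have paff h (y e1 : R) : suppc e1 r h -> suppc (y + t * e1) (t * r) (fun s => h (t^-1 * (s - y))).
  move=> ph s /ph h1.
  have -> : s - (y + t * e1) = t * (t^-1 * (s - y) - e1).
    by rewrite mulrBr mulVKf ?gt_eqF// opprD addrA.
  by rewrite normrM gtr0_norm// ler_wpM2l// ltW.
have bO : box (x.1 + t * e.1, x.2 + t * e.2) (t * r) `<=` Omega.
  by move=> z /(seg t0 t1)[].
have bW : box (x.1 + t * e.1, x.2 + t * e.2) (t * r) `<=` W.
  by move=> z /(seg t0 t1)[].
have E := wg _ _ (x.1 + t * e.1, x.2 + t * e.2) _ (saff _ x.1 sf) (saff _ x.2 sg)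
  (paff _ _ _ pf) (paff _ _ _ pg) bO.
have -> : flow v x 2 (derive1n i f1) (derive1n j g1) t =
   \int[mu2]_z (g z * tens f1 g1 (dil x t z)).
  rewrite /flow; transitivity (\int[mu2]_z (g z *
      tens (fun s => f1 (t^-1 * (s - x.1))) (fun s => g1 (t^-1 * (s - x.2))) z)); last by [].
  rewrite -E; apply: eq_Rintegral => z _.
  rewrite /tens !derive1n_affine_arg// /dil /=.
  by rewrite -ij exprD; ring.
have mt := measurable_dil_tens x t (smooth_continuous sf) (smooth_continuous sg).
have := @cauchy_schwarz_box W g (tens f1 g1 \o dil x t) (x.1 + t * e.1, x.2 + t * e.2) (t * r) C
  mW mg mt ig _ C0 _ _ bW.
rewrite /= => H.
have {}H : `|\int[mu2]_z (g z * tens f1 g1 (dil x t z))| <= 2 * (t * r) * C * Num.sqrt (sqint W g).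
  apply: H => //; first by rewrite mulr_ge0// ltW.
  move=> z; rewrite mulf_eq0 negb_or => /andP[h1 h2].
  by apply/boxP; split; [exact: (paff _ x.1 _ pf)|exact: (paff _ x.2 _ pg)].
rewrite normrM ger0_norm ?exprn_ge0 ?invr_ge0 ?(ltW t0)//.
apply: (@le_trans _ _ (t^-1 ^+ 2 * (2 * (t * r) * C * Num.sqrt (sqint W g)))).
  by rewrite ler_wpM2l// exprn_ge0// invr_ge0 ltW.
rewrite le_eqVlt; apply/orP; left; apply/eqP.
by field; rewrite gt_eqF.
Qed.

End Hessian.
End WeakEstimate.

(** * The averaged Taylor polynomial *)

Section Kernel.
Context {R : realType}.
Implicit Types (F G : R -> R) (s t y r d M : R) (v g w q : plane R -> R) (x c : plane R).

(** One constant for the bump and its derivative; the final constant is a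
    polynomial in it. *)
Definition step_bound (K : R) := (forall s, `|derive1 step s| <= K) /\
  (forall s, `|derive1 (derive1 step) s| <= K).

Lemma step_bound_ex : exists K : R, step_bound K.
Proof.
have s1 := smooth_derive1 (@smooth_step R).
have p1 : supp 1 (derive1 (@step R)) by move=> s; exact: step_derive1_supp.
have [K K0 hK] := supp_bounded (smooth_continuous s1) p1.
have [L L0 hL] := supp_bounded (smooth_continuous (smooth_derive1 s1)) (supp_derive1 p1).
exists (K + L); split => s; first by apply: le_trans (hK s) _; rewrite lerDl.
by apply: le_trans (hL s) _; rewrite lerDr.
Qed.

Definition bstep r y s : R := step (r^-1 * s + - (r^-1 * y)).
(** The one-variable bump of mass one around [y] with half-width [r]; [dhat] is
    its derivative. *)
Definition hat r y s : R := r^-1 * derive1 step (r^-1 * (s - y)).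
Definition dhat r y s : R := r^-1 ^+ 2 * derive1 (derive1 step) (r^-1 * (s - y)).

Lemma smooth_bstep r y : smooth (bstep r y).
Proof. by apply: smooth_affine_arg; exact: smooth_step. Qed.

Lemma derive1_bstep r y : derive1 (bstep r y) = hat r y.
Proof.
apply: derive1_funE => s; rewrite /hat mulrBr.
by apply: is_derive_affine_arg; apply: smooth_is_derive; exact: smooth_step.
Qed.

Lemma smooth_hat r y : smooth (hat r y).
Proof. by rewrite -derive1_bstep; apply: smooth_derive1; exact: smooth_bstep. Qed.

Lemma derive1_hat r y : derive1 (hat r y) = dhat r y.
Proof.
have := @derive1n_affine_arg R (derive1 step) 1 r^-1 y (smooth_derive1 (@smooth_step R)).
rewrite derive1n1 => E.
apply: derive1_funE => s.
have := is_deriveZ r^-1 (smooth_is_derive s (smooth_affine_arg r^-1 (- (r^-1 * y)) (smooth_derive1 (@smooth_step R)))).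
under eq_fun do rewrite -mulrBr.
rewrite E /GRing.scale /= expr1 mulrA -expr2.
by [].
Qed.

Lemma smooth_dhat r y : smooth (dhat r y).
Proof. by rewrite -derive1_hat; apply: smooth_derive1; exact: smooth_hat. Qed.

Lemma suppc_hat r y : 0 < r -> suppc y r (hat r y).
Proof.
move=> r0 s; rewrite mulf_eq0 negb_or => /andP[_ /step_derive1_supp].
by rewrite normrM gtr0_norm ?invr_gt0// mulrC ler_pdivrMr// mul1r.
Qed.

Lemma suppc_dhat r y : 0 < r -> suppc y r (dhat r y).
Proof.
by move=> r0; rewrite -derive1_hat; apply: suppc_derive1; [exact: smooth_hat|exact: suppc_hat].
Qed.

Lemma suppc_le d r y F : `|y| + r <= d -> suppc y r F -> supp d F.
Proof. by move=> yr pF s /(suppc_supp pF) h; exact: le_trans yr. Qed.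

Lemma hat_ge0 r y s : 0 < r -> 0 <= hat r y s.
Proof. by move=> r0; rewrite mulr_ge0 ?step_derive1_ge0// invr_ge0 ltW. Qed.

Lemma hat_le K r y s : step_bound K -> 0 < r -> `|hat r y s| <= K / r.
Proof.
move=> [K1 _] r0; rewrite normrM gtr0_norm ?invr_gt0// mulrC.
by rewrite ler_wpM2r// invr_ge0 ltW.
Qed.

Lemma dhat_le K r y s : step_bound K -> 0 < r -> `|dhat r y s| <= K / r ^+ 2.
Proof.
move=> [_ K1] r0; rewrite normrM ger0_norm; last by rewrite exprn_ge0// invr_ge0 ltW.
by rewrite mulrC exprVn ler_wpM2r// invr_ge0 exprn_ge0// ltW.
Qed.

Lemma stepfun_bstep d r y : 0 < r -> `|y| + r <= d -> stepfun d (bstep r y).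
Proof.
move=> r0 yd; split.
- exact: smooth_bstep.
- by rewrite derive1_bstep; apply: suppc_le yd _; exact: suppc_hat.
- by move=> s; rewrite derive1_bstep; exact: hat_ge0.
- move=> s ds; rewrite /bstep -mulrBr step_ge// mulrC ler_pdivlMr//.
  by have := ler_norm y; lra.
- move=> s ds; rewrite /bstep -mulrBr step_le// mulrC ler_pdivrMr//.
  by have := ler_norm (- y); rewrite normrN; lra.
Qed.

(** For a smooth [v], integrating by parts in the average over the bump phi of
    the Taylor polynomials v(z) + grad v(z) (x - z) yields the kernel
    3 phi + (z - x) grad phi.  This form is defined for every bounded
    measurable [v]. *)
Definition tker x c r (z : plane R) : R :=
  3 * tens (hat r c.1) (hat r c.2) z +
  (z.1 - x.1) * tens (dhat r c.1) (hat r c.2) z +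
  (z.2 - x.2) * tens (hat r c.1) (dhat r c.2) z.

Lemma tkerE x c r z :
  kappa (bstep r (c.1 - x.1)) (bstep r (c.2 - x.2)) (dil x 1 z) = tker x c r z.
Proof.
have h (y b s : R) : hat r (y - b) (1^-1 * (s - b)) = hat r y s.
  by rewrite /hat invr1 mul1r opprB addrA subrK.
have h' (y b s : R) : dhat r (y - b) (1^-1 * (s - b)) = dhat r y s.
  by rewrite /dhat invr1 mul1r opprB addrA subrK.
rewrite /kappa /tens /euler !derive1_bstep !derive1_hat /dil.
rewrite [(_, _).1]/= [(_, _).2]/= !h !h' invr1 !mul1r.
rewrite /tker /tens.
move: (hat r c.1 z.1) (hat r c.2 z.2) (dhat r c.1 z.1) (dhat r c.2 z.2) => a b a' b'.
by ring.
Qed.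

Lemma tker_supp x c r z : 0 < r -> tker x c r z != 0 -> box c r z.
Proof.
move=> r0; apply: contra_neqP => /boxP nb.
have z0 F G : suppc c.1 r F -> suppc c.2 r G -> tens F G z = 0.
  move=> pF pG; apply/eqP; apply: contrapT => /negP.
  by rewrite mulf_eq0 negb_or => /andP[/pF h1 /pG h2]; apply: nb.
rewrite /tker !z0 ?mulr0 ?addr0//; solve [exact: suppc_hat|exact: suppc_dhat].
Qed.

Lemma tker_num (K r d a b a' b' p q : R) : 0 <= K -> 0 < r -> r <= d ->
  `|a| <= K / r -> `|b| <= K / r -> `|a'| <= K / r ^+ 2 -> `|b'| <= K / r ^+ 2 ->
  `|p| <= d -> `|q| <= d ->
  `|3 * (a * b) + p * (a' * b) + q * (a * b')| <= 5 * K ^+ 2 * d / r ^+ 3.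
Proof.
move=> K0 r0 rd h1 h2 h3 h4 z1 z2.
have Kr : 0 <= K / r by rewrite divr_ge0// ltW.
have Kr2 : 0 <= K / r ^+ 2 by rewrite divr_ge0// exprn_ge0// ltW.
have e1 : `|3 * (a * b)| <= 3 * (K / r * (K / r)).
  by rewrite 2!normrM ger0_norm// ler_wpM2l// ler_pM.
have e2 : `|p * (a' * b)| <= d * (K / r ^+ 2 * (K / r)).
  by rewrite 2!normrM ler_pM ?mulr_ge0// ler_pM.
have e3 : `|q * (a * b')| <= d * (K / r * (K / r ^+ 2)).
  by rewrite 2!normrM ler_pM ?mulr_ge0// ler_pM.
apply: le_trans (ler_normD _ _) _.
apply: le_trans (lerD (ler_normD _ _) (lexx _)) _.
apply: (@le_trans _ _ (3 * (K / r * (K / r)) + d * (K / r ^+ 2 * (K / r)) + d * (K / r * (K / r ^+ 2)))).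
  by rewrite !lerD.
rewrite -subr_ge0.
have -> : 5 * K ^+ 2 * d / r ^+ 3 - (3 * (K / r * (K / r)) + d * (K / r ^+ 2 * (K / r)) + d * (K / r * (K / r ^+ 2))) =
   3 * (K ^+ 2) / r ^+ 3 * (d - r) by field; rewrite gt_eqF.
rewrite mulr_ge0 ?subr_ge0// divr_ge0 ?exprn_ge0 ?(ltW r0)//.
by rewrite mulr_ge0// exprn_ge0.
Qed.

Lemma tker_le K x c r d z : step_bound K -> 0 < r ->
  `|c.1 - x.1| + r <= d -> `|c.2 - x.2| + r <= d ->
  `|tker x c r z| <= 5 * K ^+ 2 * d / r ^+ 3.
Proof.
move=> hK r0 d1 d2.
have K0 : 0 <= K by case: hK => /(_ 0) h _; apply: le_trans h.
have d0 : 0 <= d by apply: le_trans d1; rewrite addr_ge0// ltW.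
have rd : r <= d by apply: le_trans d1; rewrite lerDr.
have [/eqP ->|nz] := boolP (tker x c r z == 0).
  rewrite normr0 divr_ge0 ?exprn_ge0 ?(ltW r0)//.
  by rewrite mulr_ge0// mulr_ge0// exprn_ge0.
have /boxP[b1 b2] := tker_supp r0 nz.
have z1 : `|z.1 - x.1| <= d.
  have -> : z.1 - x.1 = (z.1 - c.1) + (c.1 - x.1) by ring.
  by apply: le_trans (ler_normD _ _) _; lra.
have z2 : `|z.2 - x.2| <= d.
  have -> : z.2 - x.2 = (z.2 - c.2) + (c.2 - x.2) by ring.
  by apply: le_trans (ler_normD _ _) _; lra.
have h1 := hat_le c.1 z.1 hK r0; have h2 := hat_le c.2 z.2 hK r0.
have h3 := dhat_le c.1 z.1 hK r0; have h4 := dhat_le c.2 z.2 hK r0.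
exact: tker_num.
Qed.

Lemma measurable_fst_plane : measurable_plane (fun z : plane R => z.1).
Proof. exact: measurable_fst. Qed.

Lemma measurable_snd_plane : measurable_plane (fun z : plane R => z.2).
Proof. exact: measurable_snd. Qed.

Lemma measurable_tker x c r : measurable_plane (tker x c r).
Proof.
have ch y := smooth_continuous (smooth_hat r y).
have cd y := smooth_continuous (smooth_dhat r y).
apply: measurable_funD; first apply: measurable_funD.
- by apply: measurable_funM => //; exact: measurable_tens.
- apply: measurable_funM; last exact: measurable_tens.
  by apply: measurable_funB => //; exact: measurable_fst_plane.
- apply: measurable_funM; last exact: measurable_tens.
  by apply: measurable_funB => //; exact: measurable_snd_plane.
Qed.

(** The kernel is of size d / r^3 on a square of half-width r. *)
Lemma tker_pairing K (W : set (plane R)) w x c r d : step_bound K -> 0 < r ->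
  `|c.1 - x.1| + r <= d -> `|c.2 - x.2| + r <= d ->
  measurable_region W -> measurable_plane w ->
  mu2.-integrable setT (EFin \o (fun z => w z ^+ 2)) -> box c r `<=` W ->
  `|\int[mu2]_z (w z * tker x c r z)| <= 10 * K ^+ 2 * d / r ^+ 2 * Num.sqrt (sqint W w).
Proof.
move=> hK r0 d1 d2 mW mw iw bW.
have C0 : 0 <= 5 * K ^+ 2 * d / r ^+ 3.
  by apply: le_trans (tker_le c hK r0 d1 d2).
have := cauchy_schwarz_box mW mw (measurable_tker x c r) iw (ltW r0) C0
  (fun z => tker_le z hK r0 d1 d2) (fun z => @tker_supp x c r z r0) bW.
move=> h; apply: le_trans h _; rewrite le_eqVlt; apply/orP; left; apply/eqP.
by field; rewrite gt_eqF.
Qed.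

Definition avg_taylor v c r x : R := \int[mu2]_z (v z * tker x c r z).

(** The kernel is affine in [x], for fixed z. *)
Lemma avg_taylor_affine v M c r : measurable_plane v -> (forall z, `|v z| <= M) -> 0 < r ->
  affine (avg_taylor v c r).
Proof.
move=> mv vM r0.
have sh1 := smooth_hat r c.1; have sh2 := smooth_hat r c.2.
have sd1 := smooth_dhat r c.1; have sd2 := smooth_dhat r c.2.
have ph1 := suppc_hat (y := c.1) r0; have ph2 := suppc_hat (y := c.2) r0.
have pd1 := suppc_dhat (y := c.1) r0; have pd2 := suppc_dhat (y := c.2) r0.
have M0 : 0 <= M by apply: le_trans (vM 0).
have it F G : smooth F -> smooth G -> suppc c.1 r F -> suppc c.2 r G ->
    mu2.-integrable setT (EFin \o (fun z => v z * tens F G z)).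
  move=> sF sG pF pG.
  have l1 : `|c.1| + r <= `|c.1| + `|c.2| + r by rewrite lerD2r lerDl.
  have l2 : `|c.2| + r <= `|c.1| + `|c.2| + r by rewrite lerD2r lerDr.
  have [N N0 hN] := tens_bounded (smooth_continuous sF) (smooth_continuous sG)
    (suppc_le l1 pF) (suppc_le l2 pG).
  apply: (@integrable_box _ _ c r (M * N)).
  - by apply: measurable_funM => //; apply: measurable_tens; exact: smooth_continuous.
  - by move=> z; rewrite normrM ler_pM.
  - move=> z; rewrite mulf_eq0 negb_or => /andP[_].
    by rewrite mulf_eq0 negb_or => /andP[/pF h1 /pG h2]; exact/boxP.
have sX F : smooth F -> smooth (fun s => s * F s).
  by move=> sF; apply: smoothM => //; exact: smooth_id.
have pX y F : suppc y r F -> suppc y r (fun s => s * F s).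
  by move=> pF s; rewrite mulf_eq0 negb_or => /andP[_ /pF].
have i0 := it _ _ sh1 sh2 ph1 ph2.
have i1 := it _ _ sd1 sh2 pd1 ph2.
have i2 := it _ _ sh1 sd2 ph1 pd2.
have i3 := it _ _ (sX _ sd1) sh2 (pX _ _ pd1) ph2.
have i4 := it _ _ sh1 (sX _ sd2) ph1 (pX _ _ pd2).
have j1 := integrable_lin2 1 1 i3 i4.
have j2 := integrable_lin2 3 1 i0 j1.
pose a1 := \int[mu2]_z (v z * tens (dhat r c.1) (hat r c.2) z).
pose a2 := \int[mu2]_z (v z * tens (hat r c.1) (dhat r c.2) z).
exists (- a1), (- a2), (\int[mu2]_z (3 * (v z * tens (hat r c.1) (hat r c.2) z) +
    1 * (1 * (v z * tens (fun s => s * dhat r c.1 s) (hat r c.2) z) +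
    1 * (v z * tens (hat r c.1) (fun s => s * dhat r c.2 s) z)))) => x.
have j3 := integrable_lin2 (- x.1) (- x.2) i1 i2.
have E1 := Rintegral_lin2 (- x.1) (- x.2) i1 i2.
have E2 := Rintegral_lin2 1 1 j2 j3.
rewrite E1 !mul1r -/a1 -/a2 in E2.
rewrite [RHS](_ : _ = \int[mu2]_z (3 * (v z * tens (hat r c.1) (hat r c.2) z) +
    1 * (1 * (v z * tens (fun s => s * dhat r c.1 s) (hat r c.2) z) +
    1 * (v z * tens (hat r c.1) (fun s => s * dhat r c.2 s) z))) + (- x.1 * a1 + - x.2 * a2));
      last first.
  by ring.
rewrite -E2; apply: eq_Rintegral => z _; rewrite /tker /tens.
move: (hat r c.1 z.1) (hat r c.2 z.2) (dhat r c.1 z.1) (dhat r c.2 z.2) => a b a' b'.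
by ring.
Qed.

(** The right-hand side of the Taylor estimate: constants times d^2 / r times
    the L2 norms of the second derivatives. *)
Definition taylor_bound K r d (W : set (plane R)) g20 g11 g02 : R :=
  2 * K ^+ 2 * d ^+ 2 / r *
  (Num.sqrt (sqint W g20) + 2 * Num.sqrt (sqint W g11) + Num.sqrt (sqint W g02)).

(** The second-order estimate.  All squares swept by contracting the bump
    towards [x] lie in [Omega], where weak derivatives may be used, and in [W],
    over which the norms are taken.  The value [v0] of the limit is a
    parameter, because [x] may lie on the boundary. *)
Lemma local_estimate K Omega W v M x c r d g20 g11 g02 (v0 : R) :
  step_bound K -> measurable_plane v -> (forall z, `|v z| <= M) ->
  measurable_region W -> 0 < r -> `|c.1 - x.1| + r <= d -> `|c.2 - x.2| + r <= d ->
  (forall t, 0 < t -> t <= 1 ->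
    box (x.1 + t * (c.1 - x.1), x.2 + t * (c.2 - x.2)) (t * r) `<=` Omega `&` W) ->
  (forall g, [\/ g = g20, g = g11 | g = g02] -> measurable_plane g /\
    mu2.-integrable setT (EFin \o (fun z => g z ^+ 2))) ->
  weak_tens Omega v 2 0 g20 -> weak_tens Omega v 1 1 g11 -> weak_tens Omega v 0 2 g02 ->
  (forall e, 0 < e -> exists2 dl, 0 < dl &
    forall z, Omega z -> box x dl z -> `|v z - v0| <= e) ->
  `|v0 - avg_taylor v c r x| <= taylor_bound K r d W g20 g11 g02.
Proof.
move=> hK mv vM mW r0 d1 d2 seg hg w20 w11 w02 v0c.
have K0 : 0 <= K by case: hK => /(_ 0) h _; apply: le_trans h.
have rd : r <= d by apply: le_trans d1; rewrite lerDr.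
have d0 : 0 < d by exact: lt_le_trans rd.
pose e := (c.1 - x.1, c.2 - x.2) : plane R.
pose S1 := bstep r e.1; pose S2 := bstep r e.2.
have S1s : stepfun d S1 by exact: stepfun_bstep.
have S2s : stepfun d S2 by exact: stepfun_bstep.
have -> : avg_taylor v c r x = \int[mu2]_z (v z * kappa S1 S2 (dil x 1 z)).
  by apply: eq_Rintegral => z _; rewrite tkerE.
have Kr : 0 <= K / r by rewrite divr_ge0// ltW.
have [A A_def] : {A : R -> R | A = derive1 S1} by exists (derive1 S1).
have [B B_def] : {B : R -> R | B = derive1 S2} by exists (derive1 S2).
have EA : A = hat r e.1 by rewrite A_def; exact: derive1_bstep.
have EB : B = hat r e.2 by rewrite B_def; exact: derive1_bstep.
have sA : smooth A by rewrite EA; exact: smooth_hat.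
have sB : smooth B by rewrite EB; exact: smooth_hat.
have pA : suppc e.1 r A by rewrite EA; exact: suppc_hat.
have pB : suppc e.2 r B by rewrite EB; exact: suppc_hat.
have qA : supp d A by exact: suppc_le pA.
have qB : supp d B by exact: suppc_le pB.
have hA s : `|A s| <= K / r by rewrite EA; exact: hat_le.
have hB s : `|B s| <= K / r by rewrite EB; exact: hat_le.
have sX F : smooth F -> smooth (fun s => s * F s).
  by move=> sF; apply: smoothM => //; exact: smooth_id.
have pX y F : suppc y r F -> suppc y r (fun s => s * F s).
  by move=> pF s; rewrite mulf_eq0 negb_or => /andP[_ /pF].
have qX F : supp d F -> supp d (fun s => s * F s).
  by move=> pF s; rewrite mulf_eq0 negb_or => /andP[_ /pF].
have hX F b : supp d F -> 0 <= b -> (forall s, `|F s| <= b) -> forall s, `|s * F s| <= d * b.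
  move=> pF b0 Fb s; have [->|nz] := eqVneq (F s) 0.
    by rewrite mulr0 normr0 mulr_ge0// ltW.
  by rewrite normrM ler_pM//; exact: pF.
pose C := d ^+ 2 * (K / r) ^+ 2.
have C0 : 0 <= C by rewrite mulr_ge0 ?sqr_ge0.
have dKr : 0 <= d * (K / r) by rewrite mulr_ge0// ltW.
have ddKr : 0 <= d * (d * (K / r)) by rewrite mulr_ge0// ltW.
have hXA := hX _ _ qA Kr hA; have hXB := hX _ _ qB Kr hB.
have hXXA := hX _ _ (qX _ qA) dKr hXA; have hXXB := hX _ _ (qX _ qB) dKr hXB.
have C20 z : `|tens (fun s => s * (s * A s)) B z| <= C.
  rewrite normrM [leRHS](_ : _ = d * (d * (K / r)) * (K / r)); last by rewrite /C; ring.
  by rewrite ler_pM.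
have C02 z : `|tens A (fun s => s * (s * B s)) z| <= C.
  rewrite normrM [leRHS](_ : _ = (K / r) * (d * (d * (K / r)))); last by rewrite /C; ring.
  by rewrite ler_pM.
have C11 z : `|tens (fun s => s * A s) (fun s => s * B s) z| <= C.
  rewrite normrM [leRHS](_ : _ = (d * (K / r)) * (d * (K / r))); last by rewrite /C; ring.
  by rewrite ler_pM.
have [m20 i20] : measurable_plane g20 /\ mu2.-integrable setT (EFin \o (fun z => g20 z ^+ 2)).
  by apply: hg; constructor.
have [m11 i11] : measurable_plane g11 /\ mu2.-integrable setT (EFin \o (fun z => g11 z ^+ 2)).
  by apply: hg; constructor.
have [m02 i02] : measurable_plane g02 /\ mu2.-integrable setT (EFin \o (fun z => g02 z ^+ 2)).
  by apply: hg; constructor.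
apply: (taylor_estimate d0 mv vM S1s S2s).
- move=> t t0 t1.
  have f20 := flow_weak (e := e) mv vM r0 mW seg (i := 2) (j := 0) erefl w20 m20 i20
    (sX _ (sX _ sA)) sB (pX _ _ (pX _ _ pA)) pB (qX _ (qX _ qA)) qB C0 C20 t0 t1.
  have f02 := flow_weak (e := e) mv vM r0 mW seg (i := 0) (j := 2) erefl w02 m02 i02
    sA (sX _ (sX _ sB)) pA (pX _ _ (pX _ _ pB)) qA (qX _ (qX _ qB)) C0 C02 t0 t1.
  have f11 := flow_weak (e := e) mv vM r0 mW seg (i := 1) (j := 1) erefl w11 m11 i11
    (sX _ sA) (sX _ sB) (pX _ _ pA) (pX _ _ pB) (qX _ qA) (qX _ qB) C0 C11 t0 t1.
  have eA : derive1n 2 (fun s => s * (s * A s)) = deriv2_moment2 A by rewrite deriv2_moment2E.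
  have eB : derive1n 2 (fun s => s * (s * B s)) = deriv2_moment2 B by rewrite deriv2_moment2E.
  have eA1 : derive1n 1 (fun s => s * A s) = deriv1_moment1 A by rewrite deriv1_moment1E.
  have eB1 : derive1n 1 (fun s => s * B s) = deriv1_moment1 B by rewrite deriv1_moment1E.
  rewrite eA derive1n0 in f20; rewrite eB derive1n0 in f02; rewrite eA1 eB1 in f11.
  rewrite /hess -A_def -B_def.
  move: f20 f02 f11.
  move: (flow _ _ _ _ _ _) (flow _ _ _ _ _ _) (flow _ _ _ _ _ _) => h20 h02 h11 f20 f02 f11.
  apply: le_trans (ler_normD _ _) _.
  apply: le_trans (lerD (ler_normD _ _) (lexx _)) _.
  rewrite (normrM 2) (ger0_norm (ler0n _ 2)).
  apply: (le_trans (lerD (lerD f20 (ler_wpM2l (ler0n _ 2) f11)) f02)).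
  rewrite le_eqVlt; apply/orP; left; apply/eqP.
  by rewrite /taylor_bound /C; field; rewrite !gt_eqF.
- move=> eps eps0; have [dl dl0 hdl] := v0c _ eps0.
  exists (Num.min 1 (dl / d)); first by rewrite lt_min ltr01 divr_gt0.
  move=> t z t0; rewrite lt_min => /andP[t1 td]; rewrite -A_def -B_def mulf_eq0 negb_or => /andP[h1 h2].
  have z1 := pA _ h1; have z2 := pB _ h2.
  have bz : box (x.1 + t * (c.1 - x.1), x.2 + t * (c.2 - x.2)) (t * r) z.
    apply/boxP => /=; split.
      rewrite [X in `|X|](_ : _ = t * ((dil x t z).1 - e.1)); last first.
        by rewrite /dil /e /=; field; rewrite gt_eqF.
      by rewrite normrM gtr0_norm// ler_wpM2l// ltW.
    rewrite [X in `|X|](_ : _ = t * ((dil x t z).2 - e.2)); last first.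
      by rewrite /dil /e /=; field; rewrite gt_eqF.
    by rewrite normrM gtr0_norm// ler_wpM2l// ltW.
  have [Oz _] := seg _ t0 (ltW t1) _ bz.
  apply: hdl => //.
  have td' : t * d <= dl by rewrite -ler_pdivlMr// ltW.
  apply/boxP; split.
    have := qA _ h1; rewrite /= normrM gtr0_norm ?invr_gt0// mulrC ler_pdivrMr// => h.
    by apply: le_trans h _; rewrite mulrC.
  have := qB _ h2; rewrite /= normrM gtr0_norm ?invr_gt0// mulrC ler_pdivrMr// => h.
  by apply: le_trans h _; rewrite mulrC.
Qed.

End Kernel.

(** * Reproduction of affine functions *)

Section Reproduction.
Context {R : realType}.
Implicit Types (r d : R) (q : plane R -> R) (x c : plane R).

Lemma affine_measurable q : affine q -> measurable_plane q.
Proof.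
move=> [a [b [c qE]]].
rewrite (_ : q = (fun z => a * z.1 + b * z.2 + c)); last exact/funext.
apply: measurable_funD => //; apply: measurable_funD.
  by apply: measurable_funM => //; exact: measurable_fst_plane.
by apply: measurable_funM => //; exact: measurable_snd_plane.
Qed.

(** An affine function has zero weak second derivatives, so the Taylor estimate
    with zero right-hand side is an identity. *)
Lemma avg_taylor_id q c r x : affine q -> 0 < r -> avg_taylor q c r x = q x.
Proof.
move=> aq r0; have [a [b [e qE]]] := aq.
have [K hK] := @step_bound_ex R.
pose d := `|c.1 - x.1| + `|c.2 - x.2| + r.
have d1 : `|c.1 - x.1| + r <= d by rewrite lerD2r lerDl.
have d2 : `|c.2 - x.2| + r <= d by rewrite lerD2r lerDr.
(* all contracted squares lie in this box *)
pose Q := box x d.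
have mQ : measurable_region Q by exact: measurable_box.
have bQ (t : R) : 0 < t -> t <= 1 ->
    box (x.1 + t * (c.1 - x.1), x.2 + t * (c.2 - x.2)) (t * r) `<=` Q.
  move=> t0 t1 z /boxP[/= h1 h2]; apply/boxP; split.
    have -> : z.1 - x.1 = (z.1 - (x.1 + t * (c.1 - x.1))) + t * (c.1 - x.1) by ring.
    apply: le_trans (ler_normD _ _) _; rewrite (normrM t) (gtr0_norm t0).
    apply: (@le_trans _ _ (t * (`|c.1 - x.1| + r))); first by lra.
    by apply: le_trans d1; rewrite ler_piMl// addr_ge0// ltW.
  have -> : z.2 - x.2 = (z.2 - (x.2 + t * (c.2 - x.2))) + t * (c.2 - x.2) by ring.
  apply: le_trans (ler_normD _ _) _; rewrite (normrM t) (gtr0_norm t0).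
  apply: (@le_trans _ _ (t * (`|c.2 - x.2| + r))); first by lra.
  by apply: le_trans d2; rewrite ler_piMl// addr_ge0// ltW.
have cQ : box c r `<=` Q.
  move=> z bz; apply: (bQ 1 ltr01 (lexx _)); move: bz => /boxP[h1 h2]; apply/boxP => /=.
  by rewrite !mul1r !(addrC x.1) !(addrC x.2) !subrK.
pose v := q \_ Q.
have -> : avg_taylor q c r x = avg_taylor v c r x.
  apply: eq_Rintegral => z _; rewrite /v patchE; case: ifPn => //.
  have [->|/(tker_supp r0)/cQ Qz] := eqVneq (tker x c r z) 0; first by rewrite !mulr0.
  by rewrite mem_set.
have mv : measurable_plane v.
  apply: (iffLR (measurable_restrictT q mQ)).
  exact: measurable_funS (@subsetT _ Q) (affine_measurable aq).
have dif z y : q z - q y = a * (z.1 - y.1) + b * (z.2 - y.2) by rewrite !qE; ring.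
have lip z y (l : R) : `|z.1 - y.1| <= l -> `|z.2 - y.2| <= l -> `|q z - q y| <= (`|a| + `|b|) * l.
  move=> h1 h2; rewrite dif; apply: le_trans (ler_normD _ _) _.
  by rewrite !normrM mulrDl lerD// ler_wpM2l.
have vM z : `|v z| <= `|q x| + (`|a| + `|b|) * d.
  rewrite /v patchE; case: ifPn => [|_]; last first.
    by rewrite normr0 addr_ge0// mulr_ge0 ?addr_ge0// ltW.
  rewrite inE => /boxP[h1 h2]; rewrite -[q z](subrK (q x)) addrC.
  by apply: le_trans (ler_normD _ _) _; rewrite lerD2l; exact: lip.
have w (i j : nat) : (i + j = 2)%N -> weak_tens Q v i j (cst 0).
  move=> ij; have := @weak_tens_affine R Q a b e i j ij.
  have -> // : (fun z : plane R => a * z.1 + b * z.2 + e) = q.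
  by apply/funext => z; rewrite qE.
have i0 : mu2.-integrable setT (EFin \o (fun z : plane R => (cst 0 z : R) ^+ 2)).
  have -> : (EFin \o (fun z : plane R => (cst 0 z : R) ^+ 2)) = cst 0%E.
    by apply/funext => z /=; rewrite expr0n.
  exact: integrable0.
have := @local_estimate R K Q Q v _ x c r d (cst 0) (cst 0) (cst 0) (q x) hK mv vM mQ r0 d1 d2.
have -> : taylor_bound K r d Q (cst 0) (cst 0) (cst 0) = 0.
  rewrite /taylor_bound (_ : sqint Q (cst 0) = 0) ?sqrtr0 ?mulr0 ?addr0 ?mulr0//.
  rewrite /sqint (@eq_Rintegral _ _ _ _ _ (cst 0)); first by rewrite Rintegral_cst// mul0r.
  by move=> z _; rewrite /cst expr0n.
move=> H; apply/eqP; rewrite eq_sym -subr_eq0 -normr_le0; apply: H => //.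
- by move=> t t0 t1 z /(bQ _ t0 t1) Qz; split.
- by move=> g [] ->; split => //; exact: measurable_cst.
- exact: w.
- exact: w.
- exact: w.
- move=> eps eps0; have D0 : 0 < `|a| + `|b| + 1 by have := normr_ge0 a; have := normr_ge0 b; lra.
  exists (eps / (`|a| + `|b| + 1)); first by rewrite divr_gt0.
  move=> z Qz /boxP[h1 h2]; rewrite /v patchE mem_set//.
  apply: le_trans (lip _ _ _ h1 h2) _.
  rewrite mulrA ler_pdivrMr// mulrC ler_wpM2l ?(ltW eps0)//; lra.
Qed.

End Reproduction.

(** * Barycentric coordinates *)

Section Barycentric.
Context {R : realType}.
Implicit Types (x y z p q v a b c : plane R) (T U : {fset plane R}).

Lemma perm_fset3 x y z : x != y -> x != z -> y != z ->
  perm_eq [fset x; y; z]%fset [:: x; y; z].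
Proof.
move=> xy xz yz; apply: uniq_perm; first exact: fset_uniq.
  by rewrite /= !inE negb_or xy xz yz.
by move=> u; rewrite !inE orbA.
Qed.

Lemma big_fset3 (V : zmodType) (f : plane R -> V) x y z : x != y -> x != z -> y != z ->
  \sum_(v <- [fset x; y; z]%fset) f v = f x + f y + f z.
Proof.
move=> xy xz yz; rewrite (perm_big _ (perm_fset3 xy xz yz)).
by rewrite /= 3!big_cons big_nil addr0 addrA.
Qed.

Lemma signed_area_neq x y z : signed_area x y z != 0 -> [/\ x != y, x != z & y != z].
Proof.
move=> h; split; apply: contraNN h => /eqP ->; apply/eqP; rewrite /signed_area; lra.
Qed.

(** [L v] is the barycentric coordinate at [v].  The last clause, uniqueness, makes
    [lam] independent of an ordering of the vertices. *)
Definition coords T (L : plane R -> plane R -> R) :=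
  [/\ forall v, affine (L v),
      forall v p, v \notin T -> L v p = 0,
      forall p, \sum_(v <- T) L v p = 1,
      forall p, \sum_(v <- T) L v p *: v = p
    & forall (w : plane R -> R) p, \sum_(v <- T) w v = 1 -> \sum_(v <- T) w v *: v = p ->
        forall v, v \in T -> w v = L v p].

Lemma affine_area x y (k : R) : affine (fun p => k * signed_area p x y).
Proof.
exists (k * (x.2 - y.2) / 2), (k * (y.1 - x.1) / 2), (k * (x.1 * y.2 - y.1 * x.2) / 2) => p.
by rewrite /signed_area; field.
Qed.

Lemma pairE (p q : plane R) : p.1 = q.1 -> p.2 = q.2 -> p = q.
Proof. by case: p q => [? ?] [? ?] /= -> ->. Qed.

Lemma coords_triangle x y z : signed_area x y z != 0 ->
  coords [fset x; y; z]%fset (fun v p =>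
    if v == x then (signed_area x y z)^-1 * signed_area p y z
    else if v == y then (signed_area x y z)^-1 * signed_area p z x
    else if v == z then (signed_area x y z)^-1 * signed_area p x y else 0).
Proof.
move=> S0; have [xy xz yz] := signed_area_neq S0.
have S0' : (y.1 - x.1) * (z.2 - x.2) - (z.1 - x.1) * (y.2 - x.2) != 0.
  by apply: contraNN S0 => /eqP; rewrite /signed_area => ->; rewrite mul0r.
split.
- move=> v; case: (v == x); first exact: affine_area.
  case: (v == y); first exact: affine_area.
  case: (v == z); first exact: affine_area.
  by exists 0, 0, 0 => p; rewrite !mul0r !addr0.
- by move=> v p; rewrite !inE => /norP[/norP[/negbTE -> /negbTE ->] /negbTE ->].
- move=> p; rewrite big_fset3// eqxx (eq_sym y) (negbTE xy) eqxx (eq_sym z) (negbTE xz) (eq_sym z) (negbTE yz) eqxx.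
  rewrite /signed_area; field; exact: S0'.
- move=> p; rewrite big_fset3// eqxx (eq_sym y) (negbTE xy) eqxx (eq_sym z) (negbTE xz) (eq_sym z) (negbTE yz) eqxx.
  apply: pairE; rewrite /= /GRing.scale /= /signed_area; field; exact: S0'.
- move=> w p; rewrite !big_fset3// => w1 <-.
  have wx : w x = 1 - w y - w z by rewrite -w1; ring.
  have yx : (y == x) = false by rewrite eq_sym (negbTE xy).
  have zx : (z == x) = false by rewrite eq_sym (negbTE xz).
  have zy : (z == y) = false by rewrite eq_sym (negbTE yz).
  clear w1; move=> v; rewrite !inE => /orP[/orP[/eqP ->|/eqP ->]|/eqP ->].
  + by rewrite eqxx /signed_area /= /GRing.scale /= wx; field; exact: S0'.
  + by rewrite yx eqxx /signed_area /= /GRing.scale /= wx; field; exact: S0'.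
  + by rewrite zx zy eqxx /signed_area /= /GRing.scale /= wx; field; exact: S0'.
Qed.

(** Chosen through its characterization; it vanishes identically at points that
    are not vertices of [T], so that sums over the vertices of different
    triangles can be compared. *)
Definition lam T : plane R -> plane R -> R := xget (fun _ _ => 0) [set L | coords T L].

Lemma lamP T : is_triangle T -> coords T (lam T).
Proof.
move=> [x [y [z [-> S0]]]]; apply: (xgetPex (fun _ _ => 0)).
exact: (ex_intro _ _ (coords_triangle S0)).
Qed.

Lemma lam_sum T p : is_triangle T -> \sum_(v <- T) lam T v p = 1.
Proof. by move=> /lamP[]. Qed.

Lemma lam_notin T v p : is_triangle T -> v \notin T -> lam T v p = 0.
Proof. by move=> /lamP[_ + _ _ _]; exact. Qed.

Lemma lam_affine T v : is_triangle T -> affine (lam T v).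
Proof. by move=> /lamP[]. Qed.

Lemma lam_bary T p : is_triangle T -> \sum_(v <- T) lam T v p *: v = p.
Proof. by move=> /lamP[]. Qed.

Lemma lam_uniq T (w : plane R -> R) p : is_triangle T ->
  \sum_(v <- T) w v = 1 -> \sum_(v <- T) w v *: v = p ->
  forall v, v \in T -> w v = lam T v p.
Proof. by move=> /lamP[_ _ _ _]; exact. Qed.

Lemma hullP T p : is_triangle T -> (hull T p <-> forall v, v \in T -> 0 <= lam T v p).
Proof.
move=> tT; split => [[w [w0 w1 wp]] v vT|h].
  by rewrite -(lam_uniq tT w1 (esym wp) vT); exact: w0.
by exists (lam T ^~ p); split => //; [exact: lam_sum|rewrite lam_bary].
Qed.

Lemma lam_ge0 T v p : is_triangle T -> hull T p -> 0 <= lam T v p.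
Proof.
move=> tT; have [vT|vT] := boolP (v \in T); first by move/(hullP _ tT); exact.
by rewrite lam_notin.
Qed.

Lemma lam_le1 T v p : is_triangle T -> hull T p -> lam T v p <= 1.
Proof.
move=> tT hp; have [vT|vT] := boolP (v \in T); last by rewrite lam_notin.
rewrite -(lam_sum p tT) (big_fsetD1 v)//= lerDl sumr_ge0// => u _.
exact: lam_ge0.
Qed.

Lemma sum_delta (V : lmodType R) T (f : plane R -> V) u : u \in T ->
  \sum_(v <- T) ((v == u)%:R : R) *: f v = f u.
Proof.
move=> uT; rewrite (big_fsetD1 u)//= eqxx scale1r big1_seq ?addr0// => v /=.
by rewrite !inE => /andP[/negbTE ->]; rewrite scale0r.
Qed.

Lemma lam_vertex T v u : is_triangle T -> u \in T -> lam T v u = (v == u)%:R.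
Proof.
move=> tT uT; have [vT|vT] := boolP (v \in T); last first.
  by rewrite lam_notin//; case: eqP vT => // ->; rewrite uT.
symmetry; apply: (lam_uniq (w := fun v => (v == u)%:R)) => //.
- have := sum_delta (fun=> 1 : R^o) uT.
  by under eq_bigr do rewrite /GRing.scale/= mulr1.
- exact: (sum_delta id uT).
Qed.

Lemma hull_vertex T u : is_triangle T -> u \in T -> hull T u.
Proof.
by move=> tT uT; apply/hullP => // v vT; rewrite lam_vertex.
Qed.

Lemma affineD (f : plane R -> R) (s t : R) p q : affine f -> s + t = 1 ->
  f (s *: p + t *: q) = s * f p + t * f q.
Proof.
move=> [a [b [c fE]]] st; rewrite !fE /= /GRing.scale /=.
have -> : t = 1 - s by lra.
by ring.
Qed.

Lemma affine_sum (f : plane R -> R) (r : seq (plane R)) (w : plane R -> R) : affine f ->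
  \sum_(v <- r) w v = 1 -> f (\sum_(v <- r) w v *: v) = \sum_(v <- r) w v * f v.
Proof.
move=> [a [b [c fE]]] w1; rewrite fE.
have -> : (\sum_(v <- r) w v *: v).1 = \sum_(v <- r) w v * v.1.
  by elim/big_rec2: _ => //= i y1 y2 _ <-.
have -> : (\sum_(v <- r) w v *: v).2 = \sum_(v <- r) w v * v.2.
  by elim/big_rec2: _ => //= i y1 y2 _ <-.
under [RHS]eq_bigr do rewrite fE !mulrDr (mulrCA _ a) (mulrCA _ b).
by rewrite !big_split/= -!mulr_sumr -mulr_suml w1 mul1r.
Qed.

Lemma hull_convex T p q (t : R) : is_triangle T -> 0 <= t -> t <= 1 -> hull T p -> hull T q ->
  hull T ((1 - t) *: p + t *: q).
Proof.
move=> tT t0 t1 hp hq; apply/hullP => // v vT.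
rewrite (affineD _ _ (lam_affine v tT)); last by lra.
by rewrite addr_ge0// mulr_ge0 ?subr_ge0 ?lam_ge0.
Qed.

(** Barycentric coordinates in a face extend by zero to any triangle having that
    face. *)
Lemma lam_shared T T' U p : is_triangle T -> is_triangle T' -> (U `<=` T)%fset ->
  (U `<=` T')%fset -> hull U p -> forall v, lam T v p = lam T' v p.
Proof.
move=> tT tT' UT UT' [w [w0 w1 wp]] v.
pose w' v := if v \in U then w v else 0.
have ext T0 (V : lmodType R) (f : plane R -> V) : (U `<=` T0)%fset ->
    \sum_(v <- T0) w' v *: f v = \sum_(v <- U) w v *: f v.
  move=> U0; rewrite -(big_fset_incl _ U0)/=.
    by apply: eq_big_seq => u uU; rewrite /w' uU.
  by move=> u _ uU; rewrite /w' (negbTE uU) scale0r.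
have E T0 : is_triangle T0 -> (U `<=` T0)%fset -> lam T0 v p = w' v.
  move=> t0 U0; have [vT|vT] := boolP (v \in T0); last first.
    rewrite lam_notin// /w'; case: ifP => // /(fsubsetP U0).
    by rewrite (negbTE vT).
  symmetry; apply: lam_uniq => //; last by rewrite (ext _ _ id U0) wp.
  rewrite -w1; have := ext _ _ (fun=> 1 : R^o) U0.
  under eq_bigr do rewrite /GRing.scale/= mulr1.
  by under [RHS]eq_bigr do rewrite /GRing.scale/= mulr1.
by rewrite !E.
Qed.

Lemma midpointE x y : midpoint x y = ((x.1 + y.1) / 2, (x.2 + y.2) / 2).
Proof. by apply: pairE; rewrite /midpoint/= /GRing.scale/= mulrC. Qed.

Lemma affine_mid (f : plane R -> R) x y : affine f -> f (midpoint x y) = (f x + f y) / 2.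
Proof.
by move=> [a [b [c fE]]]; rewrite !fE midpointE /=; field.
Qed.

Lemma midpointC x y : midpoint x y = midpoint y x.
Proof. by rewrite /midpoint addrC. Qed.

Lemma midpointxx x : midpoint x x = x.
Proof. by rewrite midpointE; apply: pairE => /=; lra. Qed.

Lemma midpoint_inj x : injective (midpoint x).
Proof.
move=> y z; rewrite !midpointE => -[h1 h2].
by apply: pairE; [move: h1|move: h2]; lra.
Qed.

Lemma hull_mid T x y : is_triangle T -> x \in T -> y \in T -> hull T (midpoint x y).
Proof.
move=> tT xT yT; apply/hullP => // v vT.
rewrite affine_mid; last exact: lam_affine.
by rewrite !lam_vertex// divr_ge0// addr_ge0.
Qed.

End Barycentric.

(** * Euclidean distances and inscribed discs *)

Section Distance.
Context {R : realType}.
Implicit Types (x y z p q v a b c : plane R) (T U : {fset plane R}).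

Lemma dist_ge0 x y : 0 <= edist x y. Proof. exact: sqrtr_ge0. Qed.

Lemma dist_sym x y : edist x y = edist y x.
Proof. by rewrite /edist -sqrrN opprB -[X in _ + X]sqrrN opprB. Qed.

Lemma sqr_edist x y : edist x y ^+ 2 = (x.1 - y.1) ^+ 2 + (x.2 - y.2) ^+ 2.
Proof. by rewrite sqr_sqrtr// addr_ge0// sqr_ge0. Qed.

Lemma dist_eq0 x y : edist x y = 0 -> x = y.
Proof.
move=> /(congr1 (fun t => t ^+ 2)); rewrite sqr_edist expr0n /= => /eqP.
rewrite paddr_eq0 ?sqr_ge0// !sqrf_eq0 !subr_eq0 => /andP[/eqP h1 /eqP h2].
exact: pairE.
Qed.

Lemma edist1 x y : `|x.1 - y.1| <= edist x y.
Proof. by rewrite -sqrtr_sqr ler_wsqrtr// lerDl sqr_ge0. Qed.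

Lemma edist2 x y : `|x.2 - y.2| <= edist x y.
Proof. by rewrite -sqrtr_sqr ler_wsqrtr// lerDr sqr_ge0. Qed.

Lemma edist_le x y (r : R) : 0 <= r -> (x.1 - y.1) ^+ 2 + (x.2 - y.2) ^+ 2 <= r ^+ 2 -> edist x y <= r.
Proof.
by move=> r0 h; rewrite -(ger0_norm r0) -sqrtr_sqr ler_wsqrtr.
Qed.

Lemma edist_box c z (r : R) : box c r z -> edist c z <= 2 * r.
Proof.
move=> /boxP[h1 h2].
have r0 : 0 <= r by apply: le_trans h1.
have sq (s : R) : `|s| <= r -> s ^+ 2 <= r ^+ 2.
  by move=> h; rewrite -(real_normK (num_real s)) ler_sqr ?nnegrE.
apply: edist_le; first by rewrite mulr_ge0.
rewrite -sqrrN opprB -[X in _ + X]sqrrN opprB.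
by have := sq _ h1; have := sq _ h2; have := sqr_ge0 r; lra.
Qed.

Lemma cauchy2 (a b s t : R) :
  `|a * s + b * t| <= Num.sqrt (a ^+ 2 + b ^+ 2) * Num.sqrt (s ^+ 2 + t ^+ 2).
Proof.
rewrite -sqrtrM ?addr_ge0 ?sqr_ge0// -sqrtr_sqr ler_wsqrtr// -subr_ge0.
have -> : (a ^+ 2 + b ^+ 2) * (s ^+ 2 + t ^+ 2) - (a * s + b * t) ^+ 2 = (a * t - b * s) ^+ 2.
  by ring.
exact: sqr_ge0.
Qed.

Lemma dist_triangle x y z : edist x z <= edist x y + edist y z.
Proof.
apply: edist_le; first by rewrite addr_ge0// dist_ge0.
rewrite [leRHS]sqrrD !sqr_edist.
have := le_trans (ler_norm _) (cauchy2 (x.1 - y.1) (x.2 - y.2) (y.1 - z.1) (y.2 - z.2)).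
rewrite -/(edist x y) -/(edist y z).
move: (edist x y * edist y z) => e he.
rewrite -subr_ge0 [X in 0 <= X](_ : _ = 2 * (e - ((x.1 - y.1) * (y.1 - z.1) + (x.2 - y.2) * (y.2 - z.2)))).
  by rewrite mulr_ge0// subr_ge0.
by rewrite -mulr_natl; ring.
Qed.

Lemma jensen_sqr (r : seq (plane R)) (w f : plane R -> R) :
  (forall v, v \in r -> 0 <= w v) -> \sum_(v <- r) w v = 1 ->
  (\sum_(v <- r) w v * f v) ^+ 2 <= \sum_(v <- r) w v * f v ^+ 2.
Proof.
move=> w0 w1; set m := \sum_(v <- r) w v * f v.
rewrite -subr_ge0.
have -> : \sum_(v <- r) w v * f v ^+ 2 - m ^+ 2 = \sum_(v <- r) w v * (f v - m) ^+ 2.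
  rewrite [RHS](eq_bigr (fun v => w v * f v ^+ 2 + (- (2 * m) * (w v * f v) + m ^+ 2 * w v)));
    last first.
    by move=> v _; ring.
  by rewrite !big_split/= -!mulr_sumr w1 -/m; ring.
rewrite big_seq_cond sumr_ge0// => v; rewrite andbT => vr.
by rewrite mulr_ge0 ?sqr_ge0 ?w0.
Qed.

(** Discs are convex; the squared distance is controlled by Jensen. *)
Lemma edist_hull T c p (r : R) : 0 <= r -> (forall v, v \in T -> edist c v <= r) ->
  hull T p -> edist c p <= r.
Proof.
move=> r0 hr [w [w0 w1 ->]].
apply: edist_le => //.
have -> : (\sum_(v <- T) w v *: v).1 = \sum_(v <- T) w v * v.1.
  by elim/big_rec2: _ => //= i y1 y2 _ <-.
have -> : (\sum_(v <- T) w v *: v).2 = \sum_(v <- T) w v * v.2.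
  by elim/big_rec2: _ => //= i y1 y2 _ <-.
have e (s : R) f : s - \sum_(v <- T) w v * f v = \sum_(v <- T) w v * (s - f v).
  by under [RHS]eq_bigr do rewrite mulrBr; rewrite sumrB -mulr_suml w1 mul1r.
rewrite !e.
apply: le_trans (lerD (jensen_sqr _ w0 w1) (jensen_sqr _ w0 w1)) _.
rewrite -big_split/=.
apply: (@le_trans _ _ (\sum_(v <- T) w v * r ^+ 2)); last by rewrite -mulr_suml w1 mul1r.
rewrite big_seq [leRHS]big_seq; apply: ler_sum => v vT.
rewrite -mulrDr ler_wpM2l ?w0// -sqr_edist ler_sqr ?nnegrE ?dist_ge0//.
exact: hr.
Qed.

Lemma circum_ex T : is_triangle T -> exists d : R, circum_diameter T d.
Proof.
move=> [x [y [z [-> S0]]]].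
have S0' : (y.1 - x.1) * (z.2 - x.2) - (z.1 - x.1) * (y.2 - x.2) != 0.
  by apply: contraNN S0 => /eqP; rewrite /signed_area => ->; rewrite mul0r.
pose cr := (y.1 - x.1) * (z.2 - x.2) - (z.1 - x.1) * (y.2 - x.2).
pose nd := (y.1 - x.1) ^+ 2 + (y.2 - x.2) ^+ 2.
pose ne := (z.1 - x.1) ^+ 2 + (z.2 - x.2) ^+ 2.
pose c : plane R := (x.1 + ((z.2 - x.2) * nd - (y.2 - x.2) * ne) / (2 * cr),
  x.2 + ((y.1 - x.1) * ne - (z.1 - x.1) * nd) / (2 * cr)).
exists (edist c x *+ 2), c => v.
suff [ey ez] : edist c y = edist c x /\ edist c z = edist c x.
  by rewrite !inE => /orP[/orP[/eqP ->|/eqP ->]|/eqP ->]; rewrite ?ey ?ez.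
by split; congr Num.sqrt; rewrite /c /cr /nd /ne /=; field; exact: S0'.
Qed.

Lemma interior_box (S : set (plane R)) p : S° p -> exists2 e : R, 0 < e & box p e `<=` S.
Proof.
move=> /nbhs_ballP[e /= e0 he]; exists (e / 2); first by rewrite divr_gt0.
move=> z /boxP[h1 h2]; apply: he; split => /=; rewrite /ball/= distrC.
  by apply: le_lt_trans h1 _; rewrite ltr_pdivrMr// ltr_pMr// ltr1n.
by apply: le_lt_trans h2 _; rewrite ltr_pdivrMr// ltr_pMr// ltr1n.
Qed.

Lemma box_interior (S : set (plane R)) p (e : R) : 0 < e -> box p e `<=` S -> S° p.
Proof.
move=> e0 he; apply/nbhs_ballP; exists e => //= z [/= h1 h2].
by apply: he; apply/boxP; split; rewrite distrC ltW.
Qed.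

Lemma lam_interior T v p : is_triangle T -> v \in T -> (hull T)° p -> 0 < lam T v p.
Proof.
move=> tT vT /interior_box[e e0 he].
pose m : R := `|p.1 - v.1| + `|p.2 - v.2| + 1.
have m0 : 0 < m by rewrite ltr_wpDl// addr_ge0.
pose t := e / m.
have t0 : 0 < t by rewrite divr_gt0.
have hq : hull T ((1 + t) *: p + (- t) *: v).
  have tm : t * m = e by rewrite divfK// gt_eqF.
  apply: he; apply/boxP; rewrite /= /GRing.scale /=; split.
    rewrite [X in `|X|](_ : _ = t * (p.1 - v.1)); last by ring.
    rewrite normrM gtr0_norm// -tm ler_wpM2l ?(ltW t0)//.
    by rewrite /m -addrA lerDl addr_ge0.
  rewrite [X in `|X|](_ : _ = t * (p.2 - v.2)); last by ring.
  rewrite normrM gtr0_norm// -tm ler_wpM2l ?(ltW t0)//.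
  by rewrite /m addrAC lerDr addr_ge0.
have := lam_ge0 v tT hq.
rewrite (affineD _ _ (lam_affine v tT)); last by ring.
rewrite (@lam_vertex _ T v v tT vT) eqxx mulr1 => h.
have h2 : 0 < (1 + t) * lam T v p by lra.
by move: h2; rewrite pmulr_rgt0//; lra.
Qed.

(** Discs are Euclidean and boxes are max-norm balls: the regularity hypothesis
    speaks of the former, tensor products of the latter. *)
Definition disc c (r : R) : set (plane R) := [set x | edist c x <= r].

(** Along the diameter of the disc in the direction of its gradient, a barycentric
    coordinate varies by at most one. *)
Lemma lam_lip T v p q c (r : R) : is_triangle T -> 0 < r -> disc c r `<=` hull T ->
  `|lam T v p - lam T v q| <= edist p q / (2 * r).
Proof.
move=> tT r0 hd; have [a [b [k E]]] := lam_affine v tT.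
pose n := Num.sqrt (a ^+ 2 + b ^+ 2).
have nn : n ^+ 2 = a ^+ 2 + b ^+ 2 by rewrite sqr_sqrtr// addr_ge0// sqr_ge0.
have n0 : 0 <= n by exact: sqrtr_ge0.
suff hn : n <= (2 * r)^-1.
  rewrite !E [X in `|X|](_ : _ = a * (p.1 - q.1) + b * (p.2 - q.2)); last by ring.
  apply: le_trans (cauchy2 _ _ _ _) _.
  by rewrite mulrC ler_wpM2l// sqrtr_ge0.
have [->|nz] := eqVneq n 0; first by rewrite invr_ge0 mulr_ge0// ltW.
have np : 0 < n by rewrite lt_neqAle eq_sym nz.
have mem (s : R) : s ^+ 2 = 1 -> hull T (c.1 + s * r / n * a, c.2 + s * r / n * b).
  move=> s1; apply: hd; rewrite /disc/=; apply: edist_le; first exact: ltW.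
  rewrite le_eqVlt; apply/orP; left; apply/eqP.
  rewrite /= [LHS](_ : _ = s ^+ 2 * r ^+ 2 * (a ^+ 2 + b ^+ 2) / n ^+ 2); last first.
    by field; rewrite gt_eqF.
  by rewrite s1 mul1r -nn mulfK// expf_neq0.
have h1 := lam_le1 v tT (mem 1 (expr1n _ _)).
have h2 : 0 <= lam T v (c.1 + -1 * r / n * a, c.2 + -1 * r / n * b).
  by apply: lam_ge0 => //; apply: mem; rewrite sqrrN expr1n.
rewrite -[_^-1]mul1r ler_pdivlMr ?mulr_gt0//.
apply: le_trans (_ : lam T v (c.1 + 1 * r / n * a, c.2 + 1 * r / n * b) -
   lam T v (c.1 + -1 * r / n * a, c.2 + -1 * r / n * b) <= 1); last by lra.
rewrite !E /= le_eqVlt; apply/orP; left; apply/eqP.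
rewrite [RHS](_ : _ = 2 * r * (a ^+ 2 + b ^+ 2) / n); last by field; rewrite gt_eqF.
by rewrite -nn; field; rewrite gt_eqF.
Qed.

Lemma disc_box c (r : R) : box c (r / 2) `<=` disc c r.
Proof. by move=> z /edist_box; rewrite /disc/= mulrC divfK. Qed.

End Distance.

(** * Geometry of a shape-regular triangulation *)

Section MeshGeometry.
Context {R : realType}.
Implicit Types (x y z p q v a b c : plane R) (T U : {fset plane R}) (K : mesh R)
  (Omega : set (plane R)) (r h : R).

Definition diam T : R := euclid_diam (hull T).

Lemma card_triangle T : is_triangle T -> #|` T| = 3%N.
Proof.
move=> [x [y [z [-> S0]]]]; have [xy xz yz] := signed_area_neq S0.
by rewrite (perm_size (perm_fset3 xy xz yz)).
Qed.

Lemma triangle_sub_eq T T' : is_triangle T -> is_triangle T' -> (T `<=` T')%fset -> T = T'.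
Proof.
move=> tT tT' TT'; apply/eqP; rewrite eqEfcard TT' !card_triangle//.
Qed.

Lemma edist_diam T h p q : (forall x y, hull T x -> hull T y -> edist x y <= h) ->
  hull T p -> hull T q -> edist p q <= diam T.
Proof.
move=> hh hp hq; apply: ub_le_sup; last by exists p, q; split.
by exists h => _ [x [y [hx hy ->]]]; exact: hh.
Qed.

Section OneMesh.
Variables (Omega : set (plane R)) (K : mesh R) (h sigma : R).
Hypothesis tK : triangulation Omega K.
Hypothesis hK : mesh_size K h.
Hypothesis sK : forall T, T \in K -> diam T <= sigma * inscribed_diam (hull T).

Lemma mesh_triangle T : T \in K -> is_triangle T.
Proof. by case: tK => + _ _ => /(_ T). Qed.

Lemma mesh_cover p : closure Omega p -> exists2 T, T \in K & hull T p.
Proof. by case: tK => _ -> _ [T /= TK hp]; exists T. Qed.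

Lemma hull_closure T : T \in K -> hull T `<=` closure Omega.
Proof. by case: tK => _ -> _ TK p hp; exists T. Qed.

(** Two triangles meet in the hull of their common vertices, so barycentric
    coordinates agree on the intersection. *)
Lemma lam_eq T T' p : T \in K -> T' \in K -> hull T p -> hull T' p ->
  forall v, lam T v p = lam T' v p.
Proof.
move=> TK T'K hp hp'.
have : (hull T `&` hull T') p by split.
case: tK => _ _ -> // hI.
apply: lam_shared hI; [exact: mesh_triangle|exact: mesh_triangle| |].
  exact: fsubsetIl.
exact: fsubsetIr.
Qed.

Lemma vertex_of_hull T T' y : T \in K -> T' \in K -> y \in T -> hull T' y -> y \in T'.
Proof.
move=> TK T'K yT hy; apply: contraT => yT'.
have tT := mesh_triangle TK; have tT' := mesh_triangle T'K.
have := lam_eq TK T'K (hull_vertex tT yT) hy y.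
rewrite (lam_vertex _ tT yT) eqxx (lam_notin _ tT' yT') => /eqP.
by rewrite oner_eq0.
Qed.

Lemma midpoint_not_vertex T T' a b : T \in K -> T' \in K -> a \in T -> b \in T -> a != b ->
  midpoint a b \notin T'.
Proof.
move=> TK T'K aT bT ab; apply/negP => mT'.
have tT := mesh_triangle TK.
have mT : midpoint a b \in T by apply: (vertex_of_hull T'K TK mT'); exact: hull_mid.
have := lam_vertex (midpoint a b) tT mT.
rewrite eqxx affine_mid; last exact: lam_affine.
rewrite !lam_vertex//.
have [e1|_] := eqVneq (midpoint a b) a.
  move=> _; move: ab; rewrite -subr_eq0.
  have e' : midpoint a b = midpoint a a by rewrite midpointxx.
  by rewrite (midpoint_inj e') subrr eqxx.
have [e2|_] := eqVneq (midpoint a b) b.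
  move=> _; move: ab; rewrite -subr_eq0.
  have e' : midpoint b a = midpoint b b by rewrite midpointxx midpointC.
  by rewrite (midpoint_inj e') subrr eqxx.
by rewrite addr0 mul0r => /eqP; rewrite eq_sym oner_eq0.
Qed.

Lemma open_disjoint T T' p : T \in K -> T' \in K -> (hull T)° p -> hull T' p -> T = T'.
Proof.
move=> TK T'K ip hp'.
have tT := mesh_triangle TK; have tT' := mesh_triangle T'K.
apply: triangle_sub_eq => //; apply/fsubsetP => v vT.
have l0 := lam_interior tT vT ip.
have hp : hull T p by exact: interior_subset.
apply: contraT => vT'.
by move: l0; rewrite (lam_eq TK T'K hp hp') lam_notin// ltxx.
Qed.

(** A triangle lies in its circumscribed disc, whose diameter is at most [h]. *)
Lemma edist_le_h T x y : T \in K -> hull T x -> hull T y -> edist x y <= h.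
Proof.
move=> TK hx hy; have tT := mesh_triangle TK.
have [d [c cd]] := circum_ex tT.
have dh : d <= h by case: hK => _; apply; [exact: TK|exists c].
have cv v : v \in T -> edist c v <= d / 2.
  by move=> /cd; rewrite mulr2n; lra.
have d0 : 0 <= d / 2.
  have [v vT] : exists v, v \in T.
    by apply/fset0Pn; rewrite -cardfs_gt0 card_triangle.
  by apply: le_trans (cv v vT); exact: dist_ge0.
apply: le_trans (dist_triangle _ c _) _; rewrite (dist_sym x c).
have := edist_hull d0 cv hx; have := edist_hull d0 cv hy; lra.
Qed.

Lemma le_diam T x y : T \in K -> hull T x -> hull T y -> edist x y <= diam T.
Proof. by move=> TK; apply: (@edist_diam _ h) => ? ?; exact: (edist_le_h TK). Qed.

Lemma diam_le_h T : T \in K -> diam T <= h.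
Proof.
move=> TK; apply: ge_sup => [|_ [x [y [hx hy ->]]]]; last exact: (edist_le_h TK hx hy).
have tT := mesh_triangle TK.
have [v vT] : exists v, v \in T by apply/fset0Pn; rewrite -cardfs_gt0 card_triangle.
by exists (edist v v), v, v; split => //; exact: hull_vertex.
Qed.

Lemma diam_gt0 T : T \in K -> 0 < diam T.
Proof.
move=> TK; have tT := mesh_triangle TK.
have := tT => -[x [y [z [E S0]]]]; have [xy _ _] := signed_area_neq S0.
have hx : hull T x by apply: hull_vertex => //; rewrite E !inE eqxx.
have hy : hull T y by apply: hull_vertex => //; rewrite E !inE eqxx orbT.
apply: lt_le_trans (le_diam TK hx hy).
rewrite lt_neqAle dist_ge0 andbT eq_sym; apply: contraNN xy => /eqP h0.
by rewrite (dist_eq0 h0).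
Qed.

(** Barycentric coordinates at [u] change by one along the edge, while they are
    Lipschitz with constant one over the diameter of an inscribed disc. *)
Lemma inscribed_le_edge T u v : T \in K -> u \in T -> v \in T -> u != v ->
  inscribed_diam (hull T) <= edist u v.
Proof.
move=> TK uT vT uv; have tT := mesh_triangle TK; rewrite /inscribed_diam.
set S := [set d | _].
have [[d Sd]|Sn] := pselect (S !=set0); last first.
  by rewrite sup_out ?dist_ge0// => -[].
apply: ge_sup; first by exists d.
move=> _ [c [r [r0 -> hd]]].
have [->|rn] := eqVneq r 0; first by rewrite mul0rn dist_ge0.
have rp : 0 < r by rewrite lt_neqAle eq_sym rn.
have := lam_lip u u v tT rp hd.
rewrite !lam_vertex// eqxx (negbTE uv) subr0 normr1.
by rewrite ler_pdivlMr ?mulr_gt0// mul1r mulr_natl.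
Qed.

Lemma inscribed_ge0 T : 0 <= inscribed_diam (hull T).
Proof.
rewrite /inscribed_diam; set S := [set d | _].
have [hs|hs] := pselect (has_sup S); last by rewrite sup_out.
have [[d Sd] ub] := hs; apply: le_trans (ub_le_sup ub Sd).
by case: Sd => [c [r [r0 -> _]]]; rewrite mulrn_wge0.
Qed.

Let s1 : R := `|sigma| + 1.

Lemma diam_inscribed T : T \in K -> diam T <= s1 * inscribed_diam (hull T).
Proof.
move=> TK; apply: le_trans (sK TK) _.
rewrite ler_wpM2r ?inscribed_ge0//; apply: le_trans (ler_norm _) _.
by rewrite lerDl.
Qed.

Let s1_gt0 : 0 < s1. Proof. by rewrite ltr_wpDl. Qed.

Lemma diam_edge T u v : T \in K -> u \in T -> v \in T -> u != v ->
  diam T <= s1 * edist u v.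
Proof.
move=> TK uT vT uv; apply: le_trans (diam_inscribed TK) _.
by rewrite ler_wpM2l ?(ltW s1_gt0)// inscribed_le_edge.
Qed.

(** A disc with more than half of the supremal diameter. *)
Lemma inscribed_disc T : T \in K ->
  exists c r, [/\ 0 < r, disc c r `<=` hull T & diam T <= 4 * s1 * r].
Proof.
move=> TK.
have i0 : 0 < inscribed_diam (hull T).
  by have := lt_le_trans (diam_gt0 TK) (diam_inscribed TK); rewrite pmulr_rgt0.
move: (diam_inscribed TK) i0; rewrite /inscribed_diam; set S := [set d | _] => dS i0.
have hs : has_sup S.
  by apply: contrapT => hs; move: i0; rewrite sup_out// ltxx.
have [_ [c [r [r0 -> hd]]] hr] := sup_adherent (divr_gt0 i0 (ltr0n R 2)) hs.
have hr' : sup S < 4 * r by move: hr; rewrite -mulr_natl; lra.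
exists c, r; split => //; first by lra.
apply: le_trans dS _; rewrite mulrAC [leRHS]mulrC ler_wpM2l ?(ltW s1_gt0)//.
by rewrite mulrC ltW// mulrC.
Qed.

(** Closed triangles overlap along edges.  Removing from each triangle those that
    come earlier in the enumeration of the mesh gives an exact partition that
    still contains the open triangles. *)
Definition cell T : set (plane R) :=
  hull T `\` \bigcup_(T' in [set T' | T' \in K /\ (index T' K < index T K)%N]) hull T'.

Lemma cell_hull T : cell T `<=` hull T. Proof. by move=> p []. Qed.

Lemma cell_cover p : closure Omega p -> exists2 T, T \in K & cell T p.
Proof.
move=> /mesh_cover[T0 T0K hp0].
have ex : exists n, has (fun T => (index T K == n) && `[< hull T p >]) K.
  by exists (index T0 K); apply/hasP; exists T0 => //; rewrite eqxx; apply/asboolP.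
have := ex_minnP ex => -[n /hasP[T TK /andP[/eqP iT /asboolP hp]] minn].
exists T => //; split => // -[T' /= [T'K ilt] hp'].
have : (n <= index T' K)%N.
  by apply: minn; apply/hasP; exists T' => //; rewrite eqxx; apply/asboolP.
by rewrite leqNgt -iT ilt.
Qed.

Lemma cell_disjoint T T' p : T \in K -> T' \in K -> cell T p -> cell T' p -> T = T'.
Proof.
move=> TK T'K [hp np] [hp' np'].
have [lt|lt|e] := ltngtP (index T K) (index T' K).
- by exfalso; apply: np'; exists T.
- by exfalso; apply: np; exists T'.
- by rewrite -(nth_index fset0 TK) -(nth_index fset0 T'K) e.
Qed.

Lemma interior_cell T : T \in K -> (hull T)° `<=` cell T.
Proof.
move=> TK p ip; split; first exact: interior_subset.
move=> [T' /= [T'K lt] hp']; move: lt.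
by rewrite (open_disjoint TK T'K ip hp') ltnn.
Qed.

Lemma measurable_hull T : is_triangle T -> measurable_region (hull T).
Proof.
move=> tT.
have -> : hull T = \bigcap_(v in [set` T]) [set p | 0 <= lam T v p].
  by apply/seteqP; split => p /=; [move/(hullP _ tT)|move=> H; exact/hullP].
have [x [y [z [E _]]]] := tT.
have m v : measurable_region [set p | 0 <= lam T v p].
  have := affine_measurable (lam_affine v tT) => H.
  have := H measurableT `[0, +oo[%classic (measurable_itv _).
  rewrite setTI (_ : _ @^-1` _ = [set p | 0 <= lam T v p])//.
  by apply/seteqP; split => p /=; rewrite in_itv/= andbT.
apply: fin_bigcap_measurable => [|v _]; last exact: m.
exact: finite_fset.
Qed.

Lemma measurable_cell T : T \in K -> measurable_region (cell T).
Proof.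
move=> TK; apply: measurableD; first exact: (measurable_hull (mesh_triangle TK)).
apply: fin_bigcup_measurable => [|T' [T'K _]]; last first.
  exact: (measurable_hull (mesh_triangle T'K)).
by apply: (sub_finite_set _ (finite_fset K)) => T' [].
Qed.

End OneMesh.
End MeshGeometry.

(** * Existence of the reconstruction and its nodal error bound *)

Section Recon.
Context {R : realType}.
Implicit Types (x y z p q v a b c u : plane R) (T U S : {fset plane R}) (K : mesh R)
  (Omega : set (plane R)).

Lemma vertex_first T x : is_triangle T -> x \in T ->
  exists y z, T = [fset x; y; z]%fset /\ signed_area x y z != 0.
Proof.
move=> [a [b [c [-> S0]]]]; rewrite !inE => /orP[/orP[/eqP ->|/eqP ->]|/eqP ->].
- by exists b, c.
- exists c, a; split; last by move: S0; apply: contraNN => /eqP h; apply/eqP; move: h;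
  rewrite /signed_area; lra.
  by apply/fsetP => v; rewrite !inE; case: (v == a); case: (v == b); case: (v == c).
- exists a, b; split; last by move: S0; apply: contraNN => /eqP h; apply/eqP; move: h;
  rewrite /signed_area; lra.
  by apply/fsetP => v; rewrite !inE; case: (v == a); case: (v == b); case: (v == c).
Qed.

Lemma hull3 y1 y2 y3 (c1 c2 c3 : R) : y1 != y2 -> y1 != y3 -> y2 != y3 ->
  0 <= c1 -> 0 <= c2 -> 0 <= c3 -> c1 + c2 + c3 = 1 ->
  hull [fset y1; y2; y3]%fset (c1 *: y1 + c2 *: y2 + c3 *: y3).
Proof.
move=> n12 n13 n23 p1 p2 p3 s1.
exists (fun v => if v == y1 then c1 else if v == y2 then c2 else if v == y3 then c3 else 0).
have n21 : (y2 == y1) = false by rewrite eq_sym (negbTE n12).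
have n31 : (y3 == y1) = false by rewrite eq_sym (negbTE n13).
have n32 : (y3 == y2) = false by rewrite eq_sym (negbTE n23).
split.
- by move=> v _; case: (v == y1) => //; case: (v == y2) => //; case: (v == y3).
- by rewrite big_fset3// !eqxx n21 n31 n32.
- by rewrite big_fset3// !eqxx n21 n31 n32.
Qed.

Lemma corner_triangleE a b c :
  corner_triangle [fset a; b; c]%fset a = [fset a; midpoint a b; midpoint a c]%fset.
Proof.
apply/fsetP => v; apply/imfsetP/idP => [[y /= + ->]|].
  rewrite !inE => /orP[/orP[/eqP ->|/eqP ->]|/eqP ->]; rewrite ?midpointxx ?eqxx ?orbT//.
rewrite !inE => /orP[/orP[/eqP ->|/eqP ->]|/eqP ->].
- by exists a; rewrite /= ?inE ?eqxx ?midpointxx.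
- by exists b; rewrite /= ?inE ?eqxx ?orbT.
- by exists c; rewrite /= ?inE ?eqxx ?orbT.
Qed.

Lemma medial_triangleE a b c : a != b -> a != c -> b != c ->
  medial_triangle [fset a; b; c]%fset = [fset midpoint a b; midpoint a c; midpoint b c]%fset.
Proof.
move=> ab ac bc.
apply/fsetP => v; apply/imfset2P/idP => [[x /= + [y /= + ->]]|].
  rewrite !inE => /orP[/orP[/eqP ->|/eqP ->]|/eqP ->] /andP[ne /orP[/orP[/eqP e|/eqP e]|/eqP e]];
    move: ne; rewrite e ?eqxx// ?(midpointC b a) ?(midpointC c a) ?(midpointC c b) ?eqxx ?orbT//.
rewrite !inE => /orP[/orP[/eqP ->|/eqP ->]|/eqP ->].
- by exists a; rewrite /= ?inE ?eqxx//; exists b; rewrite /= ?inE ?eqxx ?orbT ?(eq_sym b) ?ab.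
- by exists a; rewrite /= ?inE ?eqxx//; exists c; rewrite /= ?inE ?eqxx ?orbT ?(eq_sym c) ?ac.
- by exists b; rewrite /= ?inE ?eqxx ?orbT//; exists c; rewrite /= ?inE ?eqxx ?orbT ?(eq_sym c) ?bc.
Qed.

Lemma half_meshP K S : S \in half_mesh K <->
  (exists T x, [/\ T \in K, x \in T & S = corner_triangle T x]) \/
  (exists2 T, T \in K & S = medial_triangle T).
Proof.
rewrite /half_mesh in_fsetU; split.
  move=> /orP[/imfset2P[T /= TK [x /= xT ->]]|/imfsetP[T /= TK ->]].
    by left; exists T, x.
  by right; exists T.
move=> [[T [x [TK xT ->]]]|[T TK ->]]; apply/orP; [left|right].
  by apply/imfset2P; exists T => //; exists x.
by apply/imfsetP; exists T.
Qed.

Lemma half_mesh_node K S y : S \in half_mesh K -> y \in S ->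
  exists T u v, [/\ T \in K, u \in T, v \in T & y = midpoint u v].
Proof.
move=> /half_meshP[[T [x [TK xT ->]]]|[T TK ->]].
  by move=> /imfsetP[v /= vT ->]; exists T, x, v.
move=> /imfset2P[u /= uT [v /=]]; rewrite !inE => /andP[_ vT] ->.
by exists T, u, v.
Qed.

Lemma lam_sum3 T a b c p : T = [fset a; b; c]%fset -> signed_area a b c != 0 ->
  lam T a p + lam T b p + lam T c p = 1.
Proof.
move=> E S0; have [ab ac bc] := signed_area_neq S0.
have tT : is_triangle T by exists a, b, c.
by have := lam_sum p tT; rewrite {1}E big_fset3.
Qed.

Lemma lam_bary3 T a b c p : T = [fset a; b; c]%fset -> signed_area a b c != 0 ->
  lam T a p *: a + lam T b p *: b + lam T c p *: c = p.
Proof.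
move=> E S0; have [ab ac bc] := signed_area_neq S0.
have tT : is_triangle T by exists a, b, c.
by have := lam_bary p tT; rewrite {1}E big_fset3.
Qed.

(** A point is in a corner triangle if one coordinate is at least one half, and
    in the medial triangle otherwise. *)
Lemma half_mesh_cover K T p : T \in K -> is_triangle T -> hull T p ->
  exists2 S, S \in half_mesh K & hull S p /\
    (forall y, y \in S -> exists u v, [/\ u \in T, v \in T & y = midpoint u v]).
Proof.
move=> TK tT hp.
have [|nc] := pselect (exists2 x, x \in T & 2^-1 <= lam T x p).
  move=> [a aT la].
  have [b [c [E S0]]] := vertex_first tT aT.
  have [ab ac bc] := signed_area_neq S0.
  exists (corner_triangle T a).
    by apply/half_meshP; left; exists T, a.
  split; last by move=> y /imfsetP[v /= vT ->]; exists a, v.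
  have bT : b \in T by rewrite E !inE eqxx orbT.
  have cT : c \in T by rewrite E !inE eqxx orbT.
  have := lam_bary3 p E S0; have := lam_sum3 p E S0.
  have := lam_ge0 b tT hp; have := lam_ge0 c tT hp.
  move: la; move: (lam T a p) (lam T b p) (lam T c p) => l m n la n0 m0 s1 ep.
  rewrite E corner_triangleE.
  have -> : p = (2 * l - 1) *: a + (2 * m) *: midpoint a b + (2 * n) *: midpoint a c.
    rewrite -ep !midpointE; apply: pairE; rewrite /= /GRing.scale /=;
      have -> : l = 1 - m - n by (clear -s1; lra).
      by field.
    by field.
  apply: hull3; try (clear E ep; lra).
  - by apply: contraNN ab => /eqP h; rewrite -(midpoint_inj (etrans (midpointxx a) h)).
  - by apply: contraNN ac => /eqP h; rewrite -(midpoint_inj (etrans (midpointxx a) h)).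
  - by apply: contraNN bc => /eqP h; rewrite (midpoint_inj h).
have le v : v \in T -> lam T v p <= 2^-1.
  by move=> vT; rewrite leNgt; apply/negP => /ltW h; apply: nc; exists v.
exists (medial_triangle T).
  by apply/half_meshP; right; exists T.
split; last first.
  by move=> y /imfset2P[u /= uT [v /=]]; rewrite !inE => /andP[_ vT] ->; exists u, v.
have [a [b [c [E S0]]]] := tT.
have [ab ac bc] := signed_area_neq S0.
have aT : a \in T by rewrite E !inE eqxx ?orbT.
have bT : b \in T by rewrite E !inE eqxx ?orbT.
have cT : c \in T by rewrite E !inE eqxx ?orbT.
have := lam_bary3 p E S0; have := lam_sum3 p E S0.
have := le _ aT; have := le _ bT; have := le _ cT.
move: (lam T a p) (lam T b p) (lam T c p) => l m n n0 m0 l0 s1 ep.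
rewrite E medial_triangleE//.
have -> : p = (1 - 2 * n) *: midpoint a b + (1 - 2 * m) *: midpoint a c + (1 - 2 * l) *: midpoint b c.
  rewrite -ep !midpointE; apply: pairE; rewrite /= /GRing.scale /=;
    have -> : l = 1 - m - n by (clear -s1; lra).
    by field.
  by field.
apply: hull3; try (clear E ep; lra).
- by apply: contraNN bc => /eqP h; rewrite (midpoint_inj h).
- by apply: contraNN ac => /eqP; rewrite (midpointC a) => h; rewrite (midpoint_inj h).
- by apply: contraNN ab => /eqP; rewrite (midpointC a) (midpointC b) => h; rewrite (midpoint_inj h).
Qed.

(** The nodal functions of the half mesh: [hat1] at a vertex with coordinate [l],
    [hat2] at the midpoint of an edge whose ends have coordinates [l] and [m].
    They are continuous everywhere, and zero when a coordinate is zero, so that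
    they match across edges. *)
Definition hat1 (l : R) : R := Num.max 0 (2 * l - 1).
Definition hat2 (l m : R) : R := Num.max 0 (Num.min (Num.min (2 * l) (2 * m)) (2 * l + 2 * m - 1)).

Lemma hat10 : hat1 0 = 0.
Proof. by rewrite /hat1 mulr0 sub0r max_l// lerN10. Qed.

Lemma hat20l m : hat2 0 m = 0.
Proof. by rewrite /hat2 mulr0 max_l// !ge_min lexx. Qed.

Lemma hat2C l m : hat2 l m = hat2 m l.
Proof. by rewrite /hat2 (minC (2 * l)) (addrC (2 * l)). Qed.

Lemma hat20r l : hat2 l 0 = 0. Proof. by rewrite hat2C hat20l. Qed.

Lemma hat1_small l : l <= 2^-1 -> hat1 l = 0.
Proof. by move=> h; rewrite /hat1 max_l//; lra. Qed.

Lemma hat1_large l : 2^-1 <= l -> hat1 l = 2 * l - 1.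
Proof. by move=> h; rewrite /hat1 max_r//; lra. Qed.

Lemma hat2_corner l m : 2^-1 <= l -> 0 <= m -> l + m <= 1 -> hat2 l m = 2 * m.
Proof.
move=> h m0 lm; rewrite /hat2 (min_r (_ : 2 * m <= 2 * l)); last by lra.
by rewrite min_l ?max_r//; lra.
Qed.

Lemma hat2_far l m : l + m <= 2^-1 -> hat2 l m = 0.
Proof.
by move=> h; rewrite /hat2 max_l// ge_min; apply/orP; right; lra.
Qed.

Lemma hat2_medial l m : l <= 2^-1 -> m <= 2^-1 -> 2^-1 <= l + m -> hat2 l m = 2 * l + 2 * m - 1.
Proof.
move=> l2 m2 lm; rewrite /hat2 min_r; last by rewrite le_min; apply/andP; split; lra.
by rewrite max_r//; lra.
Qed.

Variable n : plane R -> R.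

Definition recon_pair T p v u : R :=
  if v == u then 0 else hat2 (lam T v p) (lam T u p) * n (midpoint v u).

(** The factor one half compensates for counting each edge twice. *)
Definition recon T p : R :=
  \sum_(v <- T) hat1 (lam T v p) * n v + 2^-1 * \sum_(v <- T) \sum_(u <- T) recon_pair T p v u.

Lemma recon3 T a b c p : T = [fset a; b; c]%fset -> signed_area a b c != 0 ->
  recon T p = hat1 (lam T a p) * n a + hat1 (lam T b p) * n b + hat1 (lam T c p) * n c +
   hat2 (lam T a p) (lam T b p) * n (midpoint a b) +
   hat2 (lam T a p) (lam T c p) * n (midpoint a c) +
   hat2 (lam T b p) (lam T c p) * n (midpoint b c).
Proof.
move=> E S0; have [ab ac bc] := signed_area_neq S0.
have ba : (b == a) = false by rewrite eq_sym (negbTE ab).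
have ca : (c == a) = false by rewrite eq_sym (negbTE ac).
have cb : (c == b) = false by rewrite eq_sym (negbTE bc).
have bT (f : plane R -> R) : \sum_(v <- T) f v = f a + f b + f c by rewrite E big_fset3.
rewrite /recon !bT /recon_pair !eqxx ba ca cb (negbTE ab) (negbTE ac) (negbTE bc).
rewrite (hat2C (lam T b p) (lam T a p)) (hat2C (lam T c p) (lam T a p)) (hat2C (lam T c p) (lam T b p)).
rewrite (midpointC b a) (midpointC c a) (midpointC c b).
by field.
Qed.

(** Vertices with zero coordinate contribute nothing, so both sums may be
    extended to the union of the vertex sets. *)
Lemma recon_shared T T' p : is_triangle T -> is_triangle T' ->
  (forall v, lam T v p = lam T' v p) -> recon T p = recon T' p.
Proof.
move=> tT tT' e.
have ext T0 (f : plane R -> R) : is_triangle T0 -> (T0 `<=` T `|` T')%fset ->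
    (forall v, lam T0 v p = 0 -> f v = 0) ->
    \sum_(v <- T0) f v = \sum_(v <- (T `|` T')%fset) f v.
  move=> t0 sub f0; apply: big_fset_incl => // v _ vT0.
  by rewrite f0// lam_notin.
have z T0 v u : lam T0 v p = 0 -> recon_pair T0 p v u = 0.
  by rewrite /recon_pair; case: eqP => // _ ->; rewrite hat20l mul0r.
have z' T0 v u : lam T0 u p = 0 -> recon_pair T0 p v u = 0.
  by rewrite /recon_pair; case: eqP => // _ ->; rewrite hat20r mul0r.
have sT := fsubsetUl T T'; have sT' := fsubsetUr T T'.
rewrite /recon; congr (_ + _ * _).
  rewrite (ext T)//; last by move=> v ->; rewrite hat10 mul0r.
  rewrite (ext T')//; last by move=> v ->; rewrite hat10 mul0r.
  by apply: eq_bigr => v _; rewrite e.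
rewrite (ext T)//; last by move=> v v0; apply: big1 => u _; exact: z.
rewrite (ext T')//; last by move=> v v0; apply: big1 => u _; exact: z.
apply: eq_bigr => v _.
rewrite (ext T)//; last by move=> u; exact: z'.
rewrite (ext T')//; last by move=> u; exact: z'.
by apply: eq_bigr => u _; rewrite /recon_pair !e.
Qed.

Lemma recon_node T u v : is_triangle T -> u \in T -> v \in T ->
  recon T (midpoint u v) = n (midpoint u v).
Proof.
move=> tT uT vT.
have lm w : lam T w (midpoint u v) = ((w == u)%:R + (w == v)%:R) / 2.
  by rewrite affine_mid ?lam_vertex//; exact: lam_affine.
have [b [c [E S0]]] := vertex_first tT uT.
have [ab ac bc] := signed_area_neq S0.
have ba : (b == u) = false by rewrite eq_sym (negbTE ab).
have ca : (c == u) = false by rewrite eq_sym (negbTE ac).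
have cb : (c == b) = false by rewrite eq_sym (negbTE bc).
have h1 : hat1 (1 / 2) = 0 by apply: hat1_small; lra.
have h2 : hat2 (1 / 2) (1 / 2) = 1 by rewrite hat2_medial; lra.
rewrite (recon3 _ E S0) !lm !eqxx ba ca.
move: vT; rewrite E !inE => /orP[/orP[/eqP ->|/eqP ->]|/eqP ->].
- rewrite eqxx ba ca !add0r !mul0r hat10 !hat20r ?hat20l !mul0r !addr0.
  by rewrite midpointxx (_ : (1 + 1) / 2 = 1 :> R) ?hat1_large; [ring|lra..].
- rewrite (negbTE ab) eqxx cb !(add0r, addr0, mul0r) h1 hat10 h2 !hat20r.
  by rewrite !(add0r, addr0, mul0r, mul1r).
- rewrite (negbTE ac) eqxx (negbTE bc) !(add0r, addr0, mul0r) h1 hat10 h2 !hat20r hat20l.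
  by rewrite !(add0r, addr0, mul0r, mul1r).
Qed.

Lemma affine_lin3 (f g k : plane R -> R) (s1 s2 s3 s0 : R) : affine f -> affine g -> affine k ->
  affine (fun p => s1 * f p + s2 * g p + s3 * k p + s0).
Proof.
move=> [a1 [b1 [c1 E1]]] [a2 [b2 [c2 E2]]] [a3 [b3 [c3 E3]]].
exists (s1 * a1 + s2 * a2 + s3 * a3), (s1 * b1 + s2 * b2 + s3 * b3),
  (s1 * c1 + s2 * c2 + s3 * c3 + s0) => p.
by rewrite E1 E2 E3; ring.
Qed.

Lemma recon_corner T a : is_triangle T -> a \in T ->
  exists2 q, affine q & forall p, hull T p -> 2^-1 <= lam T a p -> recon T p = q p.
Proof.
move=> tT aT; have [b [c [E S0]]] := vertex_first tT aT.
have [ab ac bc] := signed_area_neq S0.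
exists (fun p => (2 * n a) * lam T a p + (2 * n (midpoint a b)) * lam T b p +
   (2 * n (midpoint a c)) * lam T c p + - n a).
  by apply: affine_lin3; exact: lam_affine.
move=> p hp.
have := lam_ge0 b tT hp; have := lam_ge0 c tT hp; have := lam_sum3 p E S0.
rewrite (recon3 _ E S0).
move: (lam T a p) (lam T b p) (lam T c p) => l m k s1 k0 m0 l2.
rewrite hat1_large// (@hat1_small m) ?(@hat1_small k) ?(@hat2_corner l m) ?(@hat2_corner l k) ?(@hat2_far m k); try (clear E; lra).
Qed.

Lemma recon_medial T : is_triangle T ->
  exists2 q, affine q & forall p, hull T p -> (forall v, v \in T -> lam T v p <= 2^-1) ->
    recon T p = q p.
Proof.
move=> tT; have := tT => -[a [b [c [E S0]]]].
have [ab ac bc] := signed_area_neq S0.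
have aT : a \in T by rewrite E !inE eqxx ?orbT.
have bT : b \in T by rewrite E !inE eqxx ?orbT.
have cT : c \in T by rewrite E !inE eqxx ?orbT.
exists (fun p => (- 2 * n (midpoint b c)) * lam T a p + (- 2 * n (midpoint a c)) * lam T b p +
   (- 2 * n (midpoint a b)) * lam T c p + (n (midpoint a b) + n (midpoint a c) + n (midpoint b c))).
  by apply: affine_lin3; exact: lam_affine.
move=> p hp le.
have := le _ aT; have := le _ bT; have := le _ cT; have := lam_sum3 p E S0.
rewrite (recon3 _ E S0).
move: (lam T a p) (lam T b p) (lam T c p) => l m k s1 k0 m0 l2.
rewrite !hat1_small// !hat2_medial; try (clear E; lra).
have -> : l = 1 - m - k by (clear -s1; lra).
by ring.
Qed.

Lemma affine_continuous (q : plane R -> R) : affine q -> continuous q.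
Proof.
move=> [a [b [c E]]]; rewrite (_ : q = fun p => a * p.1 + b * p.2 + c); last exact/funext.
move=> p; apply: cvgD; last exact: cvg_cst.
by apply: cvgD; apply: cvgM; [exact: cvg_cst|exact: cvg_fst|exact: cvg_cst|exact: cvg_snd].
Qed.

Lemma continuous_max0 (f : plane R -> R) : continuous f -> continuous (fun p => Num.max 0 (f p)).
Proof. by move=> cf p; apply: (@continuous_max _ _ (cst 0) f); [exact: cvg_cst|exact: cf]. Qed.

Lemma continuous_min2 (f g : plane R -> R) : continuous f -> continuous g ->
  continuous (fun p => Num.min (f p) (g p)).
Proof. by move=> cf cg p; apply: (@continuous_min _ _ f g); [exact: cf|exact: cg]. Qed.

Lemma continuous_recon T : is_triangle T -> continuous (recon T).
Proof.
move=> tT.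
have cl v : continuous (lam T v) by exact/affine_continuous/lam_affine.
have c2 v : continuous (fun p => 2 * lam T v p).
  by move=> p; apply: cvgM; [exact: cvg_cst|exact: cl].
have c1 (f : plane R -> R) : continuous f -> continuous (fun p => f p - 1).
  by move=> cf p; apply: cvgB; [exact: cf|exact: cvg_cst].
have cD (f g : plane R -> R) : continuous f -> continuous g -> continuous (fun p => f p + g p).
  by move=> cf cg p; apply: cvgD; [exact: cf|exact: cg].
have cM (f : plane R -> R) s : continuous f -> continuous (fun p => f p * s).
  by move=> cf p; apply: cvgM; [exact: cf|exact: cvg_cst].
have cS (r : seq (plane R)) (f : plane R -> plane R -> R) : (forall v, continuous (f v)) ->
    continuous (fun p => \sum_(v <- r) f v p).
  move=> cf p; elim: r => [|v r IH].
    by under eq_fun do rewrite big_nil; exact: cvg_cst.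
  under eq_fun do rewrite big_cons.
  by apply: cvgD; [exact: cf|exact: IH].
have cH : continuous (fun p => \sum_(v <- T) \sum_(u <- T) recon_pair T p v u).
  apply: (@cS) => v; apply: (@cS) => u; rewrite /recon_pair; case: (v == u) => [p|].
    exact: cvg_cst.
  apply: (@cM); apply: continuous_max0; apply: continuous_min2.
    exact: continuous_min2.
  by apply: (@c1); apply: (@cD).
apply: (@cD).
  by apply: (@cS) => v; apply: (@cM); apply: continuous_max0; apply: (@c1).
by move=> p; apply: cvgM; [exact: cvg_cst|exact: cH].
Qed.

Lemma closed_hull T : is_triangle T -> closed (hull T).
Proof.
move=> tT.
have -> : hull T = \bigcap_(v in [set` T]) (lam T v @^-1` [set t | 0 <= t]).
  by apply/seteqP; split => p /=; [move/(hullP _ tT)|move=> H; exact/hullP].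
apply: closed_bigI => v _; apply: preimage_closed; last exact: closed_ge.
by move=> p _; exact: (affine_continuous (lam_affine v tT)).
Qed.

End Recon.

Section Glue.
Context {R : realType}.
Implicit Types (x y z p q v a b c u : plane R) (T U S : {fset plane R}).
Variables (Omega : set (plane R)) (K : mesh R).
Hypothesis tK : triangulation Omega K.

(** Any triangle containing the point gives the same value. *)
Definition glue (n : plane R -> R) p : R :=
  recon n (xget fset0 [set T | T \in K /\ hull T p]) p.

Lemma glueE n T p : T \in K -> hull T p -> glue n p = recon n T p.
Proof.
move=> TK hp; rewrite /glue.
have := @xgetPex _ fset0 [set T | T \in K /\ hull T p] (ex_intro _ T (conj TK hp)).
set T' := xget _ _ => -[T'K hp'].
apply: recon_shared; [exact: mesh_triangle tK _ T'K|exact: mesh_triangle tK _ TK|].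
exact: (lam_eq tK T'K TK hp' hp).
Qed.

Lemma hull_affine_ge S (f : plane R -> R) (k : R) p : affine f ->
  (forall y, y \in S -> k <= f y) -> hull S p -> k <= f p.
Proof.
move=> af h [w [w0 w1 ->]]; rewrite affine_sum//.
rewrite -[k]mul1r -w1 mulr_suml big_seq [leRHS]big_seq; apply: ler_sum => y yS.
by rewrite ler_wpM2l ?w0 ?h.
Qed.

Lemma hull_affine_le S (f : plane R -> R) (k : R) p : affine f ->
  (forall y, y \in S -> f y <= k) -> hull S p -> f p <= k.
Proof.
move=> af h [w [w0 w1 ->]]; rewrite affine_sum//.
rewrite -[k]mul1r -w1 mulr_suml big_seq [leRHS]big_seq; apply: ler_sum => y yS.
by rewrite ler_wpM2l ?w0 ?h.
Qed.

Lemma lam_mid T v x y : is_triangle T -> x \in T -> y \in T ->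
  lam T v (midpoint x y) = ((v == x)%:R + (v == y)%:R) / 2.
Proof. by move=> tT xT yT; rewrite affine_mid ?lam_vertex//; exact: lam_affine. Qed.

Lemma half_mesh_affine n S : S \in half_mesh K ->
  exists2 q, affine q & forall p, hull S p -> glue n p = q p.
Proof.
move=> /half_meshP[[T [a [TK aT ->]]]|[T TK ->]].
- have tT := mesh_triangle tK TK.
  have [q aq hq] := recon_corner n tT aT; exists q => // p hp.
  have hT : hull T p.
    apply/hullP => // v vT; apply: hull_affine_ge hp; first exact: lam_affine.
    by move=> y /imfsetP[b /= bT ->]; apply: lam_ge0 => //; exact: hull_mid.
  rewrite (glueE n TK hT); apply: hq => //.
  apply: hull_affine_ge hp; first exact: lam_affine.
  move=> y /imfsetP[b /= bT ->]; rewrite lam_mid// eqxx.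
  by case: (a == b) => /=; lra.
- have tT := mesh_triangle tK TK.
  have [q aq hq] := recon_medial n tT; exists q => // p hp.
  have hT : hull T p.
    apply/hullP => // v vT; apply: hull_affine_ge hp; first exact: lam_affine.
    move=> y /imfset2P[a /= aT [b /=]]; rewrite !inE => /andP[_ bT] ->.
    by apply: lam_ge0 => //; exact: hull_mid.
  rewrite (glueE n TK hT); apply: hq => // v vT.
  apply: hull_affine_le hp; first exact: lam_affine.
  move=> y /imfset2P[a /= aT [b /=]]; rewrite !inE => /andP[ab bT] ->.
  rewrite lam_mid//; have [->|_] := eqVneq v a.
    by rewrite eq_sym (negbTE ab) /=; lra.
  by case: (v == b) => /=; lra.
Qed.

(** A function continuous on finitely many closed sets is continuous on their
    union. *)
Lemma glue_continuous n : {within closure Omega, continuous (glue n)}.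
Proof.
have H (s : seq {fset plane R}) : {subset s <= K} ->
   closed (\bigcup_(T in [set` s]) hull T) /\
   {within \bigcup_(T in [set` s]) hull T, continuous (glue n)}.
  elim: s => [|T s IH] sK.
    rewrite (_ : [set` [::]] = set0) ?bigcup_set0; last by apply/seteqP; split.
    by split; [exact: closed0|exact: continuous_subspace0].
  have TK : T \in K by apply: sK; rewrite inE eqxx.
  have [cs ws] : closed (\bigcup_(T in [set` s]) hull T) /\
   {within \bigcup_(T in [set` s]) hull T, continuous (glue n)}.
    by apply: IH => T' T's; apply: sK; rewrite inE T's orbT.
  rewrite (_ : \bigcup_(T0 in [set` T :: s]) hull T0 = hull T `|` \bigcup_(T0 in [set` s]) hull T0);
    last first.
    apply/seteqP; split => p.
      by move=> [T0 /=]; rewrite inE => /orP[/eqP ->|T0s] hp; [left|right; exists T0].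
    move=> [hp|[T0 /= T0s hp]]; first by exists T => //=; rewrite inE eqxx.
    by exists T0 => //=; rewrite inE T0s orbT.
  have tT := mesh_triangle tK TK; have ch := closed_hull tT.
  split; first exact: closedU.
  apply: withinU_continuous => //.
  apply: (@subspace_eq_continuous _ _ _ (recon n T)).
    by move=> p; rewrite inE => hp; exact: (esym (glueE n TK hp)).
  by apply: continuous_subspaceT => p; exact: continuous_recon.
have [_] := H K (fun _ => id).
by case: (tK) => _ -> _.
Qed.

Lemma half_space_glue n : half_space Omega K (glue n).
Proof. by split; [exact: glue_continuous|move=> S; exact: half_mesh_affine]. Qed.

Lemma glue_node n S y : S \in half_mesh K -> y \in S -> glue n y = n y.
Proof.
move=> SK yS; have [T [u [v [TK uT vT ->]]]] := half_mesh_node SK yS.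
have tT := mesh_triangle tK TK.
by rewrite (glueE n TK) ?recon_node//; exact: hull_mid.
Qed.

(** The set from which [IW] is chosen is nonempty. *)
Lemma IW_spec (u v : plane R -> R) : half_space Omega K (IW Omega K u v) /\
  forall S y, S \in half_mesh K -> y \in S -> IW Omega K u v y = nodal_value Omega K u v y.
Proof.
have ex : exists w, half_space Omega K w /\
    forall S y, S \in half_mesh K -> y \in S -> w y = nodal_value Omega K u v y.
  exists (glue (nodal_value Omega K u v)); split; first exact: half_space_glue.
  by move=> S y; exact: glue_node.
exact: (@xgetPex _ (cst 0) [set w | half_space Omega K w /\
  forall S y, S \in half_mesh K -> y \in S -> w y = nodal_value Omega K u v y] ex).
Qed.

(** On a triangle of the half mesh both functions are affine, so their difference
    is largest at a vertex. *)
Lemma IW_error (u v q : plane R -> R) (B : R) T p : T \in K -> hull T p -> affine q ->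
  (forall a b, a \in T -> b \in T ->
    `|q (midpoint a b) - nodal_value Omega K u v (midpoint a b)| <= B) ->
  `|q p - IW Omega K u v p| <= B.
Proof.
move=> TK hp aq hB; have tT := mesh_triangle tK TK.
have [[_ hS] hn] := IW_spec u v.
have [S SK [hSp nS]] := half_mesh_cover TK tT hp.
have [q' aq' hq'] := hS S SK.
have vS y : y \in S -> hull S y.
  move=> yS; exists (fun z => (z == y)%:R); split => //.
  - have := sum_delta (fun=> 1 : R^o) yS.
    by under eq_bigr do rewrite /GRing.scale/= mulr1.
  - by rewrite (sum_delta id yS).
rewrite (hq' _ hSp); have [w [w0 w1 ->]] := hSp.
rewrite !affine_sum// -sumrB; apply: le_trans (ler_norm_sum _ _ _) _.
rewrite -[B]mul1r -w1 mulr_suml big_seq [leRHS]big_seq; apply: ler_sum => y yS.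
rewrite -mulrBr normrM ger0_norm ?w0// ler_wpM2l ?w0//.
have [a [b [aT bT E]]] := nS y yS.
by rewrite -(hq' _ (vS y yS)) (hn S y SK yS) E; exact: hB.
Qed.

End Glue.

(** * Wachspress coordinates at an interior point *)

Section Wachspress.
Context {R : realType}.
Implicit Types (x y z p q : plane R).
Variables (y0 : plane R) (ys : seq (plane R)).
Hypothesis us : uniq ys.
Hypothesis ccw : forall y, y \in ys -> 0 < signed_area y0 y (next ys y).

Let c y := signed_area y0 y (next ys y).

Lemma perm_next : perm_eq (map (next ys) ys) ys.
Proof.
apply: uniq_perm => //.
  by rewrite map_inj_uniq//; exact: can_inj (prev_next us).
move=> y; apply/mapP/idP => [[z zs ->]|yy]; first by rewrite mem_next.
by exists (prev ys y); rewrite ?mem_prev// next_prev.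
Qed.

Lemma sum_next (V : zmodType) (f : plane R -> V) : \sum_(y <- ys) f (next ys y) = \sum_(y <- ys) f y.
Proof. by rewrite -[RHS](perm_big _ perm_next) /= big_map. Qed.

(** The successor in a duplicate-free cycle reaches every element. *)
Lemma iter_next y z : y \in ys -> z \in ys -> exists2 k, (k < size ys)%N & z = iter k (next ys) y.
Proof.
move=> yy zz; have [i s' E] := rot_to yy.
have u' : uniq (y :: s') by rewrite -E rot_uniq.
have := cycle_next u'; rewrite /= => /fpathP[n En].
have sz : n = (size s').+1 by rewrite -(size_rcons s' y) En size_traject.
have zs : z \in y :: s' by rewrite -E mem_rot.
have : z \in traject (next (y :: s')) y (size ys).
  rewrite (_ : size ys = (size s').+1); last by rewrite -(size_rot i) E.
  rewrite trajectS -/(traject _ _ _).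
  have := En; rewrite sz -[in RHS]addn1 => {}En.
  move: zs; rewrite !inE => /orP[-> //|zs].
  apply/orP; right.
  have : z \in rcons s' y by rewrite mem_rcons inE zs orbT.
  rewrite En addn1 trajectSr mem_rcons inE => /orP[/eqP e|//].
  exfalso.
  have : last y (rcons s' y) = y by rewrite last_rcons.
  rewrite En addn1 trajectSr last_rcons -e => zy.
  by move: u'; rewrite /= -zy zs.
move=> /trajectP[k kn ->]; exists k => //.
elim: k {kn} => // k IH; by rewrite [LHS]iterS [RHS]iterS IH -E (next_rot i us)//.
Qed.

Lemma c_prev y : c (prev ys y) = signed_area y0 (prev ys y) y.
Proof. by rewrite /c next_prev. Qed.

(** The geometric identity behind Wachspress coordinates: each weighted vector is
    the sum of two edge vectors, each belonging to one side of the polygon. *)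
Lemma wachspress_weight_bary y : y \in ys ->
  wachspress_weight ys y0 y *: (y - y0) =
  (c y)^-1 *: (y - next ys y) + (c (prev ys y))^-1 *: (y - prev ys y).
Proof.
move=> yy; have := ccw yy; have : 0 < c (prev ys y) by apply: ccw; rewrite mem_prev.
rewrite c_prev /wachspress_weight /c.
move: (next ys y) (prev ys y) => w z c1 c2.
have h1 : (z.1 - y0.1) * (y.2 - y0.2) - (y.1 - y0.1) * (z.2 - y0.2) != 0.
  by apply: lt0r_neq0; move: c1; rewrite /signed_area; lra.
have h2 : (y.1 - y0.1) * (w.2 - y0.2) - (w.1 - y0.1) * (y.2 - y0.2) != 0.
  by apply: lt0r_neq0; move: c2; rewrite /signed_area; lra.
by apply: pairE; rewrite /= /GRing.scale /= /signed_area; field; rewrite h1 h2.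
Qed.

(** Each side of the polygon occurs twice in the sum, with opposite signs. *)
Lemma wachspress_weight_sum0 : \sum_(y <- ys) wachspress_weight ys y0 y *: (y - y0) = 0.
Proof.
rewrite (eq_big_seq (fun y => (c y)^-1 *: (y - next ys y) + (c (prev ys y))^-1 *: (y - prev ys y)));
  last first.
  by move=> y; exact: wachspress_weight_bary.
rewrite big_split/= -(sum_next (fun y => (c (prev ys y))^-1 *: (y - prev ys y))).
rewrite -big_split/= big1// => y _; rewrite prev_next//.
by rewrite -scalerDr addrA subrK subrr scaler0.
Qed.

Hypothesis turn : forall y, y \in ys -> 0 <= signed_area (prev ys y) y (next ys y).

Lemma wachspress_weight_ge0 y : y \in ys -> 0 <= wachspress_weight ys y0 y.
Proof.
move=> yy; rewrite divr_ge0 ?turn// mulr_ge0//; last exact/ltW/ccw.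
by rewrite -c_prev; apply/ltW/ccw; rewrite mem_prev.
Qed.

(** If all weights vanished, the side vectors divided by [c] would be equal by the
    identity above; weighted by [c] they sum to zero, so all sides would be trivial. *)
Lemma wachspress_weight_gt0 x : x \in ys -> 0 < \sum_(y <- ys) wachspress_weight ys y0 y.
Proof.
move=> xs; rewrite lt_neqAle; apply/andP; split; last first.
  by rewrite big_seq sumr_ge0// => y; exact: wachspress_weight_ge0.
rewrite eq_sym; apply/eqP => s0.
have w0 y : y \in ys -> wachspress_weight ys y0 y = 0.
  move=> yy; apply/eqP; rewrite eq_le wachspress_weight_ge0// andbT -s0.
  rewrite (big_rem y)//= lerDl big_seq sumr_ge0// => z /mem_rem.
  exact: wachspress_weight_ge0.
pose e y := (c y)^-1 *: (next ys y - y).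
have en y : y \in ys -> e (next ys y) = e y.
  move=> yy; have ny : next ys y \in ys by rewrite mem_next.
  have := wachspress_weight_bary ny; rewrite (w0 _ ny) scale0r prev_next//.
  move=> /esym/eqP; rewrite addr_eq0 => /eqP h.
  by rewrite /e -[next ys (next ys y) - _]opprB scalerN h opprK.
have ex y : y \in ys -> e y = e x.
  move=> yy; have [k _ ->] := iter_next xs yy.
  by elim: k => //= k <-; apply: en; elim: k => //= k; rewrite mem_next.
have : \sum_(y <- ys) c y *: e x = 0.
  rewrite (eq_big_seq (fun y => next ys y - y)); last first.
    by move=> y yy; rewrite -(ex y yy) /e scalerA divff ?scale1r// gt_eqF// ccw.
  by rewrite sumrB (sum_next id) subrr.
rewrite -scaler_suml => /eqP; rewrite scaler_eq0 => /orP[|].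
  rewrite gt_eqF//; rewrite (big_rem x)//= ltr_pwDl ?ccw//.
  by rewrite big_seq sumr_ge0// => z /mem_rem zs; exact/ltW/ccw.
rewrite /e scaler_eq0 invr_eq0 gt_eqF ?ccw//= subr_eq0 => /eqP nx.
have := ccw xs; rewrite nx /signed_area.
by rewrite [X in 0 < X](_ : _ = 0) ?ltxx//; field.
Qed.

Lemma wachspress_props x : x \in ys ->
  [/\ forall y, y \in ys -> 0 <= wachspress ys y0 y,
      \sum_(y <- ys) wachspress ys y0 y = 1
    & \sum_(y <- ys) wachspress ys y0 y *: y = y0].
Proof.
move=> xs; have W0 := wachspress_weight_gt0 xs.
set W := \sum_(y <- ys) _ in W0.
have w1 : \sum_(y <- ys) wachspress ys y0 y = 1.
  by rewrite /wachspress -mulr_suml -/W divff// gt_eqF.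
split => //.
  by move=> y yy; rewrite divr_ge0 ?wachspress_weight_ge0// ltW.
have : \sum_(y <- ys) wachspress ys y0 y *: (y - y0) = 0.
  have := congr1 (fun v => W^-1 *: v) wachspress_weight_sum0.
  rewrite scaler0 scaler_sumr => h; rewrite -[RHS]h.
  by apply: eq_bigr => y _; rewrite scalerA mulrC.
under eq_bigr do rewrite scalerBr.
by rewrite sumrB -scaler_suml w1 scale1r => /eqP; rewrite subr_eq0 => /eqP.
Qed.

End Wachspress.

(** * The fan of triangles around an interior vertex *)

Section FanGeometry.
Context {R : realType}.
Implicit Types (x y z p q v a b c u w : plane R) (T U S : {fset plane R}).

Lemma coords_lam T L v p : is_triangle T -> coords T L -> v \in T -> L v p = lam T v p.
Proof. by move=> tT [_ _ h1 h2 _] vT; exact: (lam_uniq (w := L ^~ p)). Qed.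

Lemma lam_area T x y z p : T = [fset x; y; z]%fset -> signed_area x y z != 0 ->
  lam T z p = (signed_area x y z)^-1 * signed_area p x y.
Proof.
move=> E S0; have tT : is_triangle T by exists x, y, z.
have zT : z \in T by rewrite E !inE eqxx !orbT.
have [xy xz yz] := signed_area_neq S0.
have cT := coords_triangle S0; rewrite -E in cT.
rewrite -(coords_lam p tT cT zT) eqxx.
by rewrite (eq_sym z x) (negbTE xz) (eq_sym z y) (negbTE yz).
Qed.

Lemma convex_set_seg (A : set (plane R)) x y (t : R) : convex_set A -> A x -> A y ->
  0 <= t -> t <= 1 -> A (t *: x + (1 - t) *: y).
Proof.
move=> cA Ax Ay t0 t1.
have h : Itv.spec (@Itv.num_sem R) (Itv.Real `[0%Z, 1%Z]) t.
  by rewrite /= /Itv.num_sem/= num_real/= in_itv/= t0 t1.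
by have := cA x y (Itv.Def h) (mem_set Ax) (mem_set Ay); rewrite inE.
Qed.

Variables (Omega : set (plane R)) (K : mesh R) (h sigma : R).
Hypothesis oO : open Omega.
Hypothesis tK : triangulation Omega K.
Hypothesis hK : mesh_size K h.
Hypothesis sK : forall T, T \in K -> diam T <= sigma * inscribed_diam (hull T).

Variables (y0 : plane R) (ys : seq (plane R)).
Hypothesis iv : interior_vertex Omega K y0.
Hypothesis cm : cyclic_midpoints K y0 ys.
Hypothesis cv : convex_set (polygon_region y0 ys).

Let us : uniq ys. Proof. by case: cm. Qed.

Lemma fan_triangle y : y \in ys -> exists a b,
  [/\ [fset y0; a; b]%fset \in K, y = midpoint y0 a, next ys y = midpoint y0 b
    & 0 < signed_area y0 a b].
Proof.
case: cm => _ _ H /H[a [b [[T TK E] h1 h2 h3]]].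
by exists a, b; rewrite -E.
Qed.

Lemma fan_ccw y : y \in ys -> 0 < signed_area y0 y (next ys y).
Proof.
move=> /fan_triangle[a [b [_ -> -> A0]]].
rewrite [X in 0 < X](_ : _ = signed_area y0 a b / 4); first by rewrite divr_gt0.
by rewrite !midpointE /signed_area /=; field.
Qed.

Lemma fan_edge T a : T \in K -> y0 \in T -> a \in T -> a != y0 -> midpoint y0 a \in ys.
Proof.
move=> TK yT aT ay; case: cm => _ H _; apply/H; exists a => //; split.
  by rewrite eq_sym.
by exists T => //; rewrite yT aT.
Qed.

(** Around [y0], a triangle and its counterpart in the cyclic list share an edge
    and lie on the same side of it, hence overlap, hence coincide. *)
Lemma fan_member T : T \in K -> y0 \in T -> exists a b,
  [/\ T = [fset y0; a; b]%fset, midpoint y0 a \in ys,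
    next ys (midpoint y0 a) = midpoint y0 b & 0 < signed_area y0 a b].
Proof.
move=> TK yT; have tT := mesh_triangle tK TK.
have [a [b [E A0]]] : exists a b, T = [fset y0; a; b]%fset /\ 0 < signed_area y0 a b.
  have [a [b [E S0]]] := vertex_first tT yT.
  have [lt|gt] := ltP 0 (signed_area y0 a b); first by exists a, b.
  exists b, a; split.
    by rewrite E; apply/fsetP => v; rewrite !inE; case: (v == y0); case: (v == a); case: (v == b).
  have : signed_area y0 a b < 0 by rewrite lt_neqAle S0.
  rewrite /signed_area; lra.
have [ya yb ab] := signed_area_neq (lt0r_neq0 A0).
have aT : a \in T by rewrite E !inE eqxx !orbT.
have bT : b \in T by rewrite E !inE eqxx !orbT.
have ms : midpoint y0 a \in ys by apply: (fan_edge TK) => //; rewrite eq_sym.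
have [a' [b' [T'K e1 e2 A0']]] := fan_triangle ms.
have e1' := midpoint_inj e1; subst a'.
set T' := [fset y0; a; b']%fset in T'K.
have tT' := mesh_triangle tK T'K.
suff bb : b = b' by exists a, b; rewrite {2}bb.
apply/eqP; apply: contraT => nbb.
(* a point of both triangles, off their common edge *)
pose s := signed_area y0 a b; pose s' := signed_area y0 a b'.
have hp (t : R) : 0 <= t -> t <= 1 -> hull T ((1 - t) *: midpoint y0 a + t *: b).
  by move=> t0 t1; apply: hull_convex => //; [exact: hull_mid|exact: hull_vertex].
have y0T' : y0 \in T' by rewrite !inE eqxx.
have aT' : a \in T' by rewrite !inE eqxx orbT.
(* small enough for the two coordinates on the common edge to stay nonnegative *)
pose m : R := `|lam T' y0 b| + `|lam T' a b| + 1.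
have m0 : 1 <= m by rewrite lerDr addr_ge0.
pose t := (4 * m)^-1.
have t0 : 0 < t by rewrite invr_gt0; lra.
have t1 : t <= 4^-1 by rewrite /t lef_pV2 ?posrE; lra.
have tm : t * m = 4^-1 by rewrite /t invfM mulfVK// gt_eqF//; lra.
pose p := (1 - t) *: midpoint y0 a + t *: b.
have hTp : hull T p by apply: hp; lra.
have hT'p : hull T' p.
  have aff v : lam T' v p = (1 - t) * lam T' v (midpoint y0 a) + t * lam T' v b.
    by rewrite (affineD _ _ (lam_affine v tT'))//; lra.
  have h1 (l : R) : `|l| <= m -> - 4^-1 <= t * l.
    move=> lm; rewrite -lerN2 opprK -mulrN -tm ler_wpM2l ?(ltW t0)//.
    by apply: le_trans lm; rewrite -normrN ler_norm.
  have n1 : `|lam T' y0 b| <= m by rewrite /m -addrA lerDl addr_ge0.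
  have n2 : `|lam T' a b| <= m by rewrite /m addrAC lerDr addr_ge0.
  have [ya' yb' ab'] := signed_area_neq (lt0r_neq0 A0').
  apply/hullP => // v; rewrite !inE => /orP[/orP[/eqP ->|/eqP ->]|/eqP ->]; rewrite aff lam_mid// ?eqxx.
  - by rewrite (negbTE ya) /= addr0; have := h1 _ n1; lra.
  - by rewrite eq_sym (negbTE ya) /= add0r; have := h1 _ n2; lra.
  - rewrite (eq_sym b' y0) (negbTE yb') (eq_sym b' a) (negbTE ab') /= addr0 mul0r mulr0 add0r.
    rewrite (lam_area b (erefl T') (lt0r_neq0 A0')) mulr_ge0 ?(ltW t0)// mulr_ge0//.
      by rewrite invr_ge0 ltW.
    apply/ltW; move: A0; rewrite [X in 0 < X -> _](_ : _ = signed_area b y0 a)//.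
    by rewrite /signed_area; field.
have := lam_eq tK TK T'K hTp hT'p b.
rewrite (lam_notin _ tT'); last first.
  by rewrite !inE !negb_or (eq_sym b y0) yb (eq_sym b a) ab nbb.
rewrite (affineD _ _ (lam_affine b tT)); last by lra.
rewrite lam_mid// (lam_vertex _ tT bT) eqxx (eq_sym b y0) (negbTE yb) (eq_sym b a) (negbTE ab).
by rewrite /= addr0 mul0r mulr0 add0r mulr1 => /eqP; rewrite gt_eqF.
Qed.

Lemma fan_nonempty : exists y, y \in ys.
Proof.
case: iv => _ [T TK yT]; have [a [b [_ hm _ _]]] := fan_member TK yT.
by exists (midpoint y0 a).
Qed.

(** The second conclusion says that the point is near [y0] in the triangle; it
    forces [y0] to be a vertex of every triangle that contains the point. *)
Lemma sector_triangle y p : y \in ys -> hull [fset y0; y; next ys y]%fset p ->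
  exists2 T, T \in K & [/\ y0 \in T, hull T p & 2^-1 <= lam T y0 p].
Proof.
move=> /fan_triangle[a [b [TK -> -> A0]]] hp.
have tT := mesh_triangle tK TK.
have [ya yb ab] := signed_area_neq (lt0r_neq0 A0).
exists [fset y0; a; b]%fset => //.
have yT : y0 \in [fset y0; a; b]%fset by rewrite !inE eqxx.
have aT : a \in [fset y0; a; b]%fset by rewrite !inE eqxx orbT.
have bT : b \in [fset y0; a; b]%fset by rewrite !inE eqxx orbT.
split => //.
- apply/hullP => // v vT; apply: hull_affine_ge hp; first exact: lam_affine.
  move=> q; rewrite !inE => /orP[/orP[/eqP ->|/eqP ->]|/eqP ->].
  + by apply: lam_ge0 => //; exact: hull_vertex.
  + by apply: lam_ge0 => //; exact: hull_mid.
  + by apply: lam_ge0 => //; exact: hull_mid.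
- apply: hull_affine_ge hp; first exact: lam_affine.
  move=> q; rewrite !inE => /orP[/orP[/eqP ->|/eqP ->]|/eqP ->].
  + by rewrite lam_vertex// eqxx /= mulr1n; lra.
  + by rewrite lam_mid// eqxx (negbTE ya) /=; lra.
  + by rewrite lam_mid// eqxx (negbTE yb) /=; lra.
Qed.

Let tsec y : y \in ys -> is_triangle [fset y0; y; next ys y]%fset.
Proof. by move=> yy; exists y0, y, (next ys y); rewrite (lt0r_neq0 (fan_ccw yy)). Qed.

Lemma region_node y : y \in ys -> polygon_region y0 ys y.
Proof.
by move=> yy; exists y => //=; apply: hull_vertex; rewrite ?inE ?eqxx ?orbT//; exact: tsec.
Qed.

Lemma region_center : polygon_region y0 ys y0.
Proof.
have [y yy] := fan_nonempty.
by exists y => //=; apply: hull_vertex; rewrite ?inE ?eqxx//; exact: tsec.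
Qed.

Lemma region_triangle p : polygon_region y0 ys p ->
  exists2 T, T \in K & [/\ y0 \in T, hull T p & 2^-1 <= lam T y0 p].
Proof. by move=> [y /= yy]; exact: sector_triangle. Qed.

Lemma region_closure : polygon_region y0 ys `<=` closure Omega.
Proof. by move=> p /region_triangle[T TK [_ hp _]]; exact: (hull_closure tK TK). Qed.

Lemma region_cell p : polygon_region y0 ys p -> exists2 T, T \in K & y0 \in T /\ cell K T p.
Proof.
move=> rp; have [T TK cp] := cell_cover tK (region_closure rp).
exists T => //; split => //.
have [T' T'K [yT' hp' l2]] := region_triangle rp.
have tT := mesh_triangle tK TK.
apply: contraT => yT; move: l2.
rewrite (lam_eq tK T'K TK hp' (cell_hull cp)) lam_notin//.
by move=> h2; exfalso; lra.
Qed.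

(** Convexity gives only weak turns.  Were the turn at [y] reflex, the segment
    between its neighbours would cross the ray from [y0] through [y] beyond [y],
    outside the region. *)
Lemma fan_turn y : y \in ys -> 0 <= signed_area (prev ys y) y (next ys y).
Proof.
move=> yy; rewrite leNgt; apply/negP => neg.
have py : prev ys y \in ys by rewrite mem_prev.
have ny : next ys y \in ys by rewrite mem_next.
have c1 : 0 < signed_area y0 (prev ys y) y by have := fan_ccw py; rewrite next_prev.
have c2 := fan_ccw yy.
have [a [b [TK ya nb A0]]] := fan_triangle yy.
have rz := region_node py; have rn := region_node ny.
move: neg c1 c2 rz rn; set z := prev ys y; set n := next ys y => neg c1 c2 rz rn.
pose s1 := signed_area y0 z y; pose s2 := signed_area y0 y n.
have S0 : 0 < s1 + s2 by rewrite addr_gt0.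
pose t := s2 / (s1 + s2).
have t0 : 0 <= t by rewrite divr_ge0// ltW.
have t1 : t <= 1 by rewrite ler_pdivrMr// mul1r lerDr ltW.
pose q := t *: z + (1 - t) *: n.
have rq : polygon_region y0 ys q by exact: convex_set_seg.
pose k := signed_area y0 z n / (s1 + s2).
have k1 : 1 < k.
  rewrite ltr_pdivlMr// mul1r -subr_gt0.
  rewrite [X in 0 < X](_ : _ = - signed_area z y n) ?oppr_gt0//.
  by rewrite /s1 /s2 /signed_area; field.
(* the segment meets the ray from [y0] through [y] at the ratio k > 1 *)
have qE : q = (1 - k) *: y0 + k *: y.
  have S0' : (z.1 - y0.1) * (y.2 - y0.2) - (y.1 - y0.1) * (z.2 - y0.2) +
      ((y.1 - y0.1) * (n.2 - y0.2) - (n.1 - y0.1) * (y.2 - y0.2)) != 0.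
    by apply: lt0r_neq0; move: S0; rewrite /s1 /s2 /signed_area; lra.
  apply: pairE; rewrite /q /t /k /s1 /s2 /signed_area /= /GRing.scale /=; field; exact: S0'.
have {}qE : q = (1 - k / 2) *: y0 + (k / 2) *: a.
  by rewrite qE ya midpointE; apply: pairE; rewrite /= /GRing.scale /=; field.
have [T' T'K [yT' hq' l2]] := region_triangle rq.
have tT' := mesh_triangle tK T'K; have tT := mesh_triangle tK TK.
pose e := k^-1.
have k0 : 0 < k by lra.
have e0 : 0 < e by rewrite invr_gt0.
have e1 : e <= 1 by rewrite invf_le1// ltW.
pose p := (1 - e) *: y0 + e *: q.
have hp' : hull T' p by apply: hull_convex => //; [exact: ltW|exact: hull_vertex].
have pE : p = midpoint y0 a.
  by rewrite /p qE midpointE /e; apply: pairE; rewrite /= /GRing.scale /=; field; rewrite gt_eqF.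
have [n1 n2 n3] := signed_area_neq (lt0r_neq0 A0).
set T := [fset y0; a; b]%fset in TK tT.
have yT : y0 \in T by rewrite !inE eqxx.
have aT : a \in T by rewrite !inE eqxx orbT.
have hp : hull T p by rewrite pE; exact: hull_mid.
have la : lam T' a p = 2^-1.
  rewrite -(lam_eq tK TK T'K hp hp') pE lam_mid// eqxx eq_sym (negbTE n1) /= add0r mul1r.
  by [].
have aT' : a \in T'.
  by apply: contraT => aT'; move: la; rewrite lam_notin// => /eqP; rewrite eq_sym invr_eq0 pnatr_eq0.
have : lam T' a q = k / 2.
  rewrite qE (affineD _ _ (lam_affine a tT')); last by lra.
  by rewrite !lam_vertex// eqxx (eq_sym a) (negbTE n1) /= mulr0 add0r mulr1.
move=> laq.
have : lam T' y0 q + lam T' a q <= 1.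
  rewrite -(lam_sum q tT') (big_fsetD1 y0)//= (big_fsetD1 a)/=; last first.
    by rewrite !inE eq_sym n1.
  by rewrite addrA lerDl sumr_ge0// => v _; exact: lam_ge0.
by rewrite laq; lra.
Qed.

Lemma fan_wachspress :
  [/\ forall y, y \in ys -> 0 <= wachspress ys y0 y,
      \sum_(y <- ys) wachspress ys y0 y = 1
    & \sum_(y <- ys) wachspress ys y0 y *: y = y0].
Proof.
have [y yy] := fan_nonempty.
exact: (wachspress_props us fan_ccw fan_turn yy).
Qed.

Let s1 : R := `|sigma| + 1.

(** Consecutive triangles share an edge, comparable to the diameters of both. *)
Lemma fan_diam_next y a b c : y \in ys -> [fset y0; a; b]%fset \in K -> y = midpoint y0 a ->
  next ys y = midpoint y0 b -> 0 < signed_area y0 a b ->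
  [fset y0; b; c]%fset \in K ->
  diam [fset y0; a; b]%fset <= s1 * diam [fset y0; b; c]%fset.
Proof.
move=> yy TK ya nb A0 T'K.
have [n1 n2 n3] := signed_area_neq (lt0r_neq0 A0).
have := diam_edge tK sK (u := y0) (v := b) TK.
rewrite !inE !eqxx !orbT /= => /(_ erefl erefl n2) h1.
apply: le_trans h1 _; rewrite ler_wpM2l ?addr_ge0//.
have tT' := mesh_triangle tK T'K.
by apply: (le_diam tK hK T'K); apply: hull_vertex => //; rewrite !inE eqxx ?orbT.
Qed.

Lemma fan_diam s T T' : (size ys <= s)%N -> T \in K -> T' \in K -> y0 \in T -> y0 \in T' ->
  diam T <= s1 ^+ s * diam T'.
Proof.
move=> sz TK T'K yT yT'.
have [a [b [E am nb A0]]] := fan_member TK yT.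
have [a' [b' [E' am' nb' A0']]] := fan_member T'K yT'.
have [k kn ek] := iter_next us am am'.
have H j a1 b1 : [fset y0; a1; b1]%fset \in K -> midpoint y0 a1 \in ys ->
    next ys (midpoint y0 a1) = midpoint y0 b1 -> 0 < signed_area y0 a1 b1 ->
    iter j (next ys) (midpoint y0 a1) = midpoint y0 a' ->
    diam [fset y0; a1; b1]%fset <= s1 ^+ j * diam T'.
  elim: j a1 b1 => [|j IH] a1 b1 T1K m1 nx A1 it.
    have ea := midpoint_inj it; subst a1.
    have eb : b1 = b' by apply: (@midpoint_inj _ y0); rewrite -nx -nb'.
    by rewrite expr0 mul1r E' eb.
  rewrite iterSr nx in it.
  have m2 : midpoint y0 b1 \in ys by rewrite -nx mem_next.
  have [a2 [c [T2K e2 n2 A2]]] := fan_triangle m2.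
  have e2' := midpoint_inj e2; subst a2.
  apply: le_trans (fan_diam_next m1 T1K erefl nx A1 T2K) _.
  by rewrite exprS -mulrA ler_wpM2l ?addr_ge0// IH.
have TK' := TK; rewrite E in TK' *.
apply: le_trans (H k a b TK' am nb A0 (esym ek)) _.
rewrite ler_wpM2r ?(ltW (diam_gt0 tK hK T'K))// ler_weXn2l//.
  by rewrite lerDr.
by apply: leq_trans (ltnW kn) sz.
Qed.

(** A triangle at [y0] is determined by one of its edge midpoints in the cyclic
    list. *)
Lemma fan_valence : (count (fun T => y0 \in T) K <= size ys)%N.
Proof.
pose F y := [fset y0; 2 *: y - y0; 2 *: next ys y - y0]%fset : {fset plane R}.
rewrite -size_filter -(size_map F ys); apply: uniq_leq_size.
  by rewrite filter_uniq// fset_uniq.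
move=> T; rewrite mem_filter => /andP[yT TK].
have [a [b [E am nb A0]]] := fan_member TK yT.
apply/mapP; exists (midpoint y0 a) => //.
have dbl x : 2 *: midpoint y0 x - y0 = x.
  by rewrite midpointE; apply: pairE; rewrite /= /GRing.scale /=; field.
by rewrite /F nb !dbl E.
Qed.

(** Near an interior vertex there are only the triangles of its fan. *)
Lemma near_center : exists2 e : R, 0 < e & forall p, box y0 e p ->
  Omega p /\ forall T, T \in K -> hull T p -> y0 \in T.
Proof.
suff : (Omega `&` [set p | forall T, T \in K -> hull T p -> y0 \in T])° y0.
  by move=> /interior_box[e e0 he]; exists e => // p /he.
have nO : nbhs y0 Omega by apply: open_nbhs_nbhs; split => //; case: iv.
apply: filterI => //.
have H (r : seq {fset plane R}) : {subset r <= K} ->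
   nbhs y0 [set p | forall T, T \in r -> hull T p -> y0 \in T].
  elim: r => [|T r IH] rK.
    by apply: filterS filterT => p _ T; rewrite in_nil.
  have TK : T \in K by apply: rK; rewrite inE eqxx.
  have n1 : nbhs y0 [set p | hull T p -> y0 \in T].
    have [yT|yT] := boolP (y0 \in T); first by apply: filterS filterT.
    have tT := mesh_triangle tK TK.
    have : nbhs y0 (~` hull T).
      apply: open_nbhs_nbhs; split; first by rewrite openC; exact: closed_hull.
      move=> hy; case: iv => _ [T' T'K yT'].
      by move: yT; rewrite (vertex_of_hull tK T'K TK yT' hy).
    by apply: filterS => p np hp; exfalso; exact: np.
  have n2 := IH (fun T' h' => rK T' (@mem_behead _ (T :: r) T' h')).
  apply: filterS2 n1 n2 => p h1 h2 T'; rewrite inE => /orP[/eqP -> //|]; exact: h2.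
by apply: (H K).
Qed.

(** The ray from [y0] starts in some triangle of the fan; within distance [rho]
    its coordinate at [y0] stays above one half, so it does not leave the
    corner that belongs to the region. *)
Lemma region_disc (rho : R) :
  (forall T, T \in K -> y0 \in T -> exists c r, [/\ 0 < r, disc c r `<=` hull T & rho <= r]) ->
  disc y0 rho `<=` polygon_region y0 ys.
Proof.
move=> hr x xd.
have [e e0 he] := near_center.
pose m : R := `|x.1 - y0.1| + `|x.2 - y0.2| + e.
have m0 : 0 < m by rewrite ltr_wpDl// addr_ge0.
pose t := e / m.
have t0 : 0 < t by rewrite divr_gt0.
have t1 : t <= 1 by rewrite ler_pdivrMr// mul1r lerDr addr_ge0.
have tm : t * m = e by rewrite divfK// gt_eqF.
pose p := (1 - t) *: y0 + t *: x.
have bp : box y0 e p.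
  apply/boxP; rewrite /p /= /GRing.scale /=; split.
    rewrite [X in `|X|](_ : _ = t * (x.1 - y0.1)); last by ring.
    by rewrite normrM gtr0_norm// -tm ler_wpM2l ?(ltW t0)// /m -addrA lerDl addr_ge0// ltW.
  rewrite [X in `|X|](_ : _ = t * (x.2 - y0.2)); last by ring.
  by rewrite normrM gtr0_norm// -tm ler_wpM2l ?(ltW t0)// /m addrAC lerDr addr_ge0// ltW.
have [Op hT] := he p bp.
have [T TK hp] := mesh_cover tK (subset_closure Op).
have yT := hT T TK hp; have tT := mesh_triangle tK TK.
have [c [r [r0 hd rr]]] := hr T TK yT.
have lp v : lam T v p = (1 - t) * lam T v y0 + t * lam T v x.
  by rewrite (affineD _ _ (lam_affine v tT))//; lra.
have ly : 2^-1 <= lam T y0 x.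
  have := lam_lip y0 y0 x tT r0 hd.
  rewrite lam_vertex// eqxx => h1.
  have h2 : edist y0 x / (2 * r) <= 2^-1.
    rewrite ler_pdivrMr ?mulr_gt0//; apply: le_trans xd _; lra.
  by have := ler_norm (1 - lam T y0 x); lra.
have lx v : v \in T -> v != y0 -> 0 <= lam T v x.
  move=> vT vy; have := lam_ge0 v tT hp; rewrite lp lam_vertex// (negbTE vy) mulr0 add0r.
  by rewrite pmulr_rge0.
have [a [b [E am nb A0]]] := fan_member TK yT.
have [n1 n2 n3] := signed_area_neq (lt0r_neq0 A0).
exists (midpoint y0 a) => //=; rewrite nb.
have aT : a \in T by rewrite E !inE eqxx !orbT.
have bT : b \in T by rewrite E !inE eqxx !orbT.
have := lam_bary3 x E (lt0r_neq0 A0); have := lam_sum3 x E (lt0r_neq0 A0).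
have := lx _ aT; have := lx _ bT; rewrite !(eq_sym _ y0) n1 n2 => /(_ erefl) + /(_ erefl).
move: ly; move: (lam T y0 x) (lam T a x) (lam T b x) => l k j l2 j0 k0 s0 ex.
have le : l = 1 - k - j by rewrite -s0; ring.
have -> : x = (2 * l - 1) *: y0 + (2 * k) *: midpoint y0 a + (2 * j) *: midpoint y0 b.
  by rewrite -ex !midpointE; apply: pairE; rewrite /= /GRing.scale /= le; field.
apply: hull3.
- by apply: contraNN n1 => /eqP e1; rewrite -(midpoint_inj (etrans (midpointxx y0) e1)).
- by apply: contraNN n2 => /eqP e1; rewrite -(midpoint_inj (etrans (midpointxx y0) e1)).
- by apply: contraNN n3 => /eqP e1; rewrite (midpoint_inj e1).
- by rewrite subr_ge0 mulrC -ler_pdivrMr// mul1r.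
- by rewrite mulr_ge0.
- by rewrite mulr_ge0.
- by rewrite le; ring.
Qed.

End FanGeometry.

(** * Square integrals over unions of cells *)

Section Norms.
Context {R : realType}.
Implicit Types (Omega : set (plane R)) (u w g : plane R -> R).

Lemma L2_measurable Omega u : L2 Omega u -> measurable_plane (u \_ Omega).
Proof. by rewrite /L2 => /sub_Lfun_mfun; rewrite inE. Qed.

Lemma L2_sqr_integrable Omega u : L2 Omega u ->
  mu2.-integrable setT (EFin \o (fun z => (u \_ Omega) z ^+ 2)).
Proof. exact: Lfun2_integrable_sqr. Qed.

Lemma sqint_ge0 (W : set (plane R)) w : 0 <= sqint W w.
Proof. by apply: Rintegral_ge0 => z _; exact: sqr_ge0. Qed.

(** Valid for arbitrary functions, hence for the error of the reconstruction. *)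
Lemma L2norm_pow2 Omega w :
  (L2norm Omega w `^ 2 = \int[mu2]_z (((w \_ Omega) z) ^+ 2)%:E)%E.
Proof.
rewrite /L2norm poweR_Lnorm//; apply: eq_integral => z _.
by rewrite /= powR_mulrn// real_normK// num_real.
Qed.

Lemma L2norm_ge0 Omega w : (0 <= L2norm Omega w)%E.
Proof. exact: Lnorm_ge0. Qed.

Lemma L2norm_sqint Omega u : L2 Omega u ->
  L2norm Omega u = (Num.sqrt (sqint setT (u \_ Omega)))%:E.
Proof.
move=> uL; have h := L2norm_pow2 Omega u.
have fin : (\int[mu2]_z (((u \_ Omega) z) ^+ 2)%:E)%E \is a fin_num.
  exact: (integrable_fin_num _ (L2_sqr_integrable uL)).
have -> : L2norm Omega u = ((L2norm Omega u `^ 2) `^ 2^-1)%E.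
  by rewrite -poweRrM mulfV// poweRe1// L2norm_ge0.
have e : (\int[mu2]_z (((u \_ Omega) z) ^+ 2)%:E = (sqint setT (u \_ Omega))%:E)%E.
  by rewrite /sqint /Rintegral fineK.
rewrite h e poweR_EFin.
by rewrite powR12_sqrt// sqint_ge0.
Qed.

Lemma L2norm_le Omega w (X : R) : 0 <= X ->
  (\int[mu2]_z (((w \_ Omega) z) ^+ 2)%:E <= X%:E)%E -> (L2norm Omega w <= (Num.sqrt X)%:E)%E.
Proof.
move=> X0; rewrite -L2norm_pow2 => h.
have -> : L2norm Omega w = ((L2norm Omega w `^ 2) `^ 2^-1)%E.
  by rewrite -poweRrM mulfV// poweRe1// L2norm_ge0.
rewrite -powR12_sqrt// -poweR_EFin gt0_ler_poweR// ?in_itv/= ?leey ?poweR_ge0//.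
by rewrite lee_fin X0.
Qed.

(** The integral of a nonnegative function is a supremum over the simple functions
    below it, hence monotone for arbitrary functions. *)
Lemma le_integral_nneg (f g : plane R -> R) : (forall z, 0 <= f z) -> (forall z, f z <= g z) ->
  (\int[mu2]_z (f z)%:E <= \int[mu2]_z (g z)%:E)%E.
Proof.
move=> f0 fg.
have g0 z : (0 <= (g z)%:E)%E by rewrite lee_fin (le_trans (f0 z)).
rewrite !ge0_integralTE//.
apply: le_ereal_sup => _ [p /= pf <-]; exists p => // z.
by apply: le_trans (pf z) _; rewrite lee_fin.
Qed.

Lemma sqint_bigcup (I : eqType) (r : seq I) (A : I -> set (plane R)) w : uniq r ->
  (forall i, i \in r -> measurable_region (A i)) ->
  (forall i j p, i \in r -> j \in r -> A i p -> A j p -> i = j) ->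
  mu2.-integrable setT (EFin \o (fun z => w z ^+ 2)) ->
  measurable_region [set p | exists2 i, i \in r & A i p] /\
  sqint [set p | exists2 i, i \in r & A i p] w = \sum_(i <- r) sqint (A i) w.
Proof.
elim: r => [|i r IH] /= ur mA dA iw.
  have -> : [set p | exists2 i, i \in [::] & A i p] = set0.
    by apply/seteqP; split => p // [].
  by split; [exact: measurable0|rewrite big_nil /sqint Rintegral_set0].
case/andP: ur => ir ur.
have [||mr sr] := IH ur _ _ iw.
- by move=> j jr; apply: mA; rewrite inE jr orbT.
- by move=> j k p jr kr; apply: dA; rewrite inE ?jr ?kr orbT.
have mi : measurable_region (A i) by apply: mA; rewrite inE eqxx.
have -> : [set p | exists2 j, j \in i :: r & A j p] =
    A i `|` [set p | exists2 i, i \in r & A i p].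
  apply/seteqP; split => p /=.
    by move=> [j]; rewrite inE => /orP[/eqP ->|jr] Aj; [left|right; exists j].
  move=> [Ai|[j jr Aj]]; first by exists i; rewrite ?inE ?eqxx.
  by exists j; rewrite // inE jr orbT.
split; first exact: measurableU.
rewrite big_cons -sr /sqint Rintegral_setU//.
- by apply: integrableS iw => //; exact: measurableU.
- apply/disj_setPS => p [Ai [j jr Aj]].
  have ij : i = j by apply: (dA i j p); rewrite ?inE ?eqxx ?jr ?orbT.
  by move: ir; rewrite ij jr.
Qed.

Lemma sqint_subset (W W' : set (plane R)) w : measurable_region W -> measurable_region W' ->
  mu2.-integrable setT (EFin \o (fun z => w z ^+ 2)) -> W `<=` W' -> sqint W w <= sqint W' w.
Proof.
move=> mW mW' iw WW'; rewrite /sqint [X in X <= _]Rintegral_mkcond [X in _ <= X]Rintegral_mkcond.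
apply: le_Rintegral => //.
- by rewrite -restrict_EFin -integrable_mkcond//; exact: integrableS iw.
- by rewrite -restrict_EFin -integrable_mkcond//; exact: integrableS iw.
move=> z _; rewrite !patchE; case: ifPn => [zW|_]; last by case: ifP => // _; exact: sqr_ge0.
by rewrite (mem_set (WW' _ (set_mem zW))).
Qed.

(** Comparison with a function that is constant on each set; the sets may
    overlap. *)
Lemma integral_sqr_le (I : eqType) (r : seq I) (A : I -> set (plane R)) (M m : I -> R) w :
  (forall i, i \in r -> measurable_region (A i)) -> (forall i, i \in r -> 0 <= M i) ->
  (forall i, i \in r -> (mu2 (A i) <= (m i)%:E)%E) ->
  (forall z, w z != 0 -> exists2 i, i \in r & A i z /\ `|w z| <= M i) ->
  (\int[mu2]_z (w z ^+ 2)%:E <= (\sum_(i <- r) M i ^+ 2 * m i)%:E)%E.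
Proof.
move=> mA M0 mm hw.
pose g z : R := \sum_(i <- r) M i ^+ 2 * \1_(A i) z.
have g0 z i : 0 <= M i ^+ 2 * \1_(A i) z :> R by rewrite mulr_ge0 ?sqr_ge0.
apply: (@le_trans _ _ (\int[mu2]_z (g z)%:E)%E).
  apply: le_integral_nneg => z; first exact: sqr_ge0.
  have [->|/hw[i ir [Ai wM]]] := eqVneq (w z) 0.
    by rewrite expr0n /=; apply: sumr_ge0 => i _.
  rewrite /g (big_rem i)//= indicE (mem_set Ai) mulr1.
  apply: ler_wpDr; first by apply: sumr_ge0 => j _.
  by rewrite -real_normK ?num_real// lerXn2r ?nnegrE// M0.
have -> : (\int[mu2]_z (g z)%:E = \sum_(i <- r) (M i ^+ 2)%:E * mu2 (A i))%E.
  rewrite /g; elim: r mA {M0 mm hw g} => [|i r IH] mA.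
    under eq_integral do rewrite big_nil.
    by rewrite integral0 big_nil.
  have mi : measurable_region (A i) by apply: mA; rewrite inE eqxx.
  have m1 j : j \in i :: r -> measurable_plane (fun z => M j ^+ 2 * \1_(A j) z).
    by move=> jr; apply: measurable_funM => //; exact: measurable_indic (mA j jr).
  rewrite big_cons -IH; last by move=> j jr; apply: mA; rewrite inE jr orbT.
  under eq_integral do rewrite big_cons EFinD.
  rewrite ge0_integralD//.
  - congr (_ + _)%E; under eq_integral do rewrite EFinM.
    rewrite ge0_integralZl_EFin ?sqr_ge0//; last first.
      by apply/measurable_EFinP; exact: measurable_indic mi.
    by rewrite integral_indic// setIT.
  - by move=> z _; rewrite lee_fin.
  - by apply/measurable_EFinP; apply: m1; rewrite inE eqxx.
  - by move=> z _; rewrite lee_fin sumr_ge0.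
  - apply/measurable_EFinP; elim: r {IH mA} m1 => [|j r IH] m1.
      rewrite [X in measurable_fun _ X](_ : _ = cst 0)//.
      by apply/funext => z; rewrite big_nil.
    rewrite [X in measurable_fun _ X](_ : _ = (fun z : plane R => M j ^+ 2 * \1_(A j) z) \+
      (fun z => \sum_(k <- r) M k ^+ 2 * \1_(A k) z)); last first.
      by apply/funext => z; rewrite big_cons.
    apply: measurable_funD; first by apply: m1; rewrite !inE eqxx orbT.
    by apply: IH => k; rewrite inE => /orP[/eqP ->|kr]; apply: m1; rewrite !inE ?eqxx ?kr ?orbT.
rewrite -sumEFin big_seq [leRHS]big_seq; apply: lee_sum => i ir.
by rewrite [X in (_ <= X)%E]EFinM; apply: lee_wpmul2l; rewrite ?lee_fin ?sqr_ge0// mm.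
Qed.

End Norms.

(** * Error estimates on triangles, patches and the whole domain *)

Section Segment.
Context {R : realType}.
Implicit Types (x c p q : plane R) (S : set (plane R)).

Definition segment_closed S := forall p q (s : R), 0 <= s -> s <= 1 -> S p -> S q ->
  S ((1 - s) *: p + s *: q).

(** Contracting a square contained in a convex set towards a point of the set
    stays inside; the factor two leaves room for the interior. *)
Lemma segment_box S c x (rho t : R) : segment_closed S -> 0 < rho -> box c (2 * rho) `<=` S ->
  S x -> 0 < t -> t <= 1 ->
  box (x.1 + t * (c.1 - x.1), x.2 + t * (c.2 - x.2)) (t * rho) `<=` S°.
Proof.
move=> cS r0 bS Sx t0 t1 z /boxP[/= z1 z2].
apply: (@box_interior _ _ _ (t * rho)); first by rewrite mulr_gt0.
move=> y /boxP[y1 y2].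
have tn0 : t != 0 by rewrite gt_eqF.
pose c' : plane R := (x.1 + (y.1 - x.1) / t, x.2 + (y.2 - x.2) / t).
have -> : y = (1 - t) *: x + t *: c'.
  by apply: pairE; rewrite /= /GRing.scale /=; field.
apply: cS => //; first exact: ltW.
apply: bS; apply/boxP; rewrite /c' /=; split.
  rewrite -(ler_pM2l t0) -{1}(gtr0_norm t0) -normrM.
  rewrite (_ : t * _ = (y.1 - z.1) + (z.1 - (x.1 + t * (c.1 - x.1)))); last by field.
  by apply: le_trans (ler_normD _ _) _; rewrite mulrCA mulr_natl mulr2n lerD.
rewrite -(ler_pM2l t0) -{1}(gtr0_norm t0) -normrM.
rewrite (_ : t * _ = (y.2 - z.2) + (z.2 - (x.2 + t * (c.2 - x.2)))); last by field.
by apply: le_trans (ler_normD _ _) _; rewrite mulrCA mulr_natl mulr2n lerD.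
Qed.

Lemma sqrt_sum3 (a b c : R) : 0 <= a -> 0 <= b -> 0 <= c ->
  Num.sqrt a + 2 * Num.sqrt b + Num.sqrt c <= 4 * Num.sqrt (a + b + c).
Proof.
move=> a0 b0 c0.
have h1 : Num.sqrt a <= Num.sqrt (a + b + c) by rewrite ler_wsqrtr// -addrA lerDl addr_ge0.
have h2 : Num.sqrt b <= Num.sqrt (a + b + c) by rewrite ler_wsqrtr// addrAC lerDr addr_ge0.
have h3 : Num.sqrt c <= Num.sqrt (a + b + c) by rewrite ler_wsqrtr// lerDr addr_ge0.
by move: h1 h2 h3; move: (Num.sqrt a) (Num.sqrt b) (Num.sqrt c) (Num.sqrt _) => *; lra.
Qed.

Lemma affine_bounded_box (f : plane R -> R) c (r : R) : affine f ->
  exists N : R, forall z, box c r z -> `|f z| <= N.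
Proof.
move=> [a [b [e fE]]].
exists (`|a| * (`|c.1| + r) + `|b| * (`|c.2| + r) + `|e|) => z /boxP[h1 h2]; rewrite fE.
have n1 : `|z.1| <= `|c.1| + r.
  by rewrite -[z.1](subrK c.1) addrC; apply: le_trans (ler_normD _ _) _; rewrite lerD2l.
have n2 : `|z.2| <= `|c.2| + r.
  by rewrite -[z.2](subrK c.2) addrC; apply: le_trans (ler_normD _ _) _; rewrite lerD2l.
apply: le_trans (ler_normD _ _) _; rewrite lerD2r.
by apply: le_trans (ler_normD _ _) _; rewrite !normrM lerD// ler_wpM2l.
Qed.

Lemma integrable_tker (k : R) (w : plane R -> R) x c (r d N : R) : step_bound k -> 0 < r ->
  `|c.1 - x.1| + r <= d -> `|c.2 - x.2| + r <= d -> measurable_plane w ->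
  (forall z, box c r z -> `|w z| <= N) ->
  mu2.-integrable setT (EFin \o (fun z => w z * tker x c r z)).
Proof.
move=> bk r0 d1 d2 mw wN.
apply: (@integrable_box _ _ c r (`|N| * (5 * k ^+ 2 * d / r ^+ 3))).
- by apply: measurable_funM => //; exact: measurable_tker.
- move=> z; have [->|/(tker_supp r0) zb] := eqVneq (tker x c r z) 0.
    rewrite mulr0 normr0 mulr_ge0//.
    by apply: le_trans (tker_le 0 bk r0 d1 d2); exact: normr_ge0.
  rewrite normrM ler_pM//; first exact: le_trans (wN z zb) (ler_norm _).
  exact: tker_le.
- move=> z nz; apply: (tker_supp (x := x)) => //.
  by apply: contraNneq nz => ->; rewrite mulr0.
Qed.

(** Exchanging the sums, every triangle is counted once for itself and at most
    [n] times for each of its three vertices. *)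
Lemma sum_spread (K : mesh R) (P : pred (plane R)) (n : nat) (f : {fset plane R} -> R) :
  (forall T, T \in K -> is_triangle T) -> (forall T, T \in K -> 0 <= f T) ->
  (forall y T, T \in K -> y \in T -> P y -> (count (fun T => y \in T) K <= n)%N) ->
  \sum_(T <- K) (f T + \sum_(y <- T | P y) \sum_(T' <- K | y \in T') f T') <=
  (1 + 3 * n%:R) * \sum_(T <- K) f T.
Proof.
move=> tri f0 cnt; rewrite big_split mulrDl mul1r lerD2l.
pose V := (\bigcup_(T <- K) T)%fset.
have sub T : T \in K -> (T `<=` V)%fset.
  by move=> TK; rewrite /V (big_rem T)//= fsubsetUl.
have spr (T : {fset plane R}) (g : plane R -> R) : T \in K ->
    \sum_(y <- T | P y) g y = \sum_(y <- V | P y && (y \in T)) g y.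
  move=> TK; rewrite -[RHS]big_filter -[LHS]big_filter; apply: perm_big.
  apply: uniq_perm; rewrite ?filter_uniq ?fset_uniq// => y.
  rewrite !mem_filter; case: (P y) => //=; case: (boolP (y \in T)) => //= yT.
  by rewrite (fsubsetP (sub T TK)).
rewrite big_seq; under eq_bigr do rewrite spr//.
rewrite -big_seq.
rewrite (exchange_big_dep P)/=; last by move=> T y _ /andP[].
rewrite mulr_sumr.
under eq_bigr => y Py.
  under eq_bigl do rewrite Py /=.
  rewrite big_const_seq iter_addr_0.
  over.
(* every triangle is counted at most [n] times for each of its vertices *)
apply: (@le_trans _ _ (\sum_(y <- V | P y) n%:R * \sum_(T' <- K | y \in T') f T')).
  rewrite big_seq_cond [X in _ <= X]big_seq_cond; apply: ler_sum => y /andP[yV Py].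
  rewrite -[X in X <= _]mulr_natl; apply: ler_wpM2r.
    by rewrite big_seq_cond sumr_ge0// => T /andP[TK _]; exact: f0.
  rewrite ler_nat.
  have /bigfcupP[T /andP[TK _] yT] := yV.
  exact: cnt TK yT Py.
under eq_bigr do rewrite mulr_sumr.
rewrite (exchange_big_dep xpredT)//=.
rewrite big_seq [X in _ <= X]big_seq; apply: ler_sum => T TK.
rewrite -spr// (@le_trans _ _ (\sum_(y <- T) n%:R * f T))//.
  rewrite big_mkcond; apply: ler_sum => y _; case: ifP => // _.
  by rewrite mulr_ge0 ?f0.
rewrite big_const_seq iter_addr_0 count_predT.
by rewrite (card_triangle (tri T TK)) -[X in X <= _]mulr_natl mulrA.
Qed.

End Segment.

(** The constant of the global estimate.  Its inner sum bounds the error on a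
    triangle, 1024 = 2 * 512 and 5120 being the constants of the triangle
    estimate; s1 ^+ n bounds the ratio of diameters in a fan. *)
Definition error_const {R : realType} (kap s1 : R) (n : nat) : R :=
  8 * (1024 * kap ^+ 2 * s1 + (1024 * kap ^+ 2 * s1 * (s1 ^+ n) ^+ 3 +
    5120 * kap ^+ 2 * s1 ^+ 2 * s1 ^+ n)) ^+ 2 * (1 + 3 * n%:R).

Section Estimates.
Context {R : realType}.
Implicit Types (x y z p c : plane R) (T : {fset plane R}) (W S : set (plane R)).
Variables (Omega : set (plane R)) (K : mesh R) (h sigma kap M : R).
Hypothesis oO : open Omega.
Hypothesis rO : Omega = (closure Omega)°.
Hypothesis tK : triangulation Omega K.
Hypothesis hK : mesh_size K h.
Hypothesis sK : forall T, T \in K -> diam T <= sigma * inscribed_diam (hull T).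
Hypothesis bK : step_bound kap.

Variables (u uh v err g20 g11 g02 : plane R -> R) (q : {fset plane R} -> plane R -> R).
Hypothesis vu : forall x, Omega x -> v x = u x.
Hypothesis mv : measurable_plane v.
Hypothesis vM : forall z, `|v z| <= M.
Hypothesis gP : forall g, [\/ g = g20, g = g11 | g = g02] -> measurable_plane g /\
  mu2.-integrable setT (EFin \o (fun z => g z ^+ 2)).
Hypothesis w20 : weak_tens Omega v 2 0 g20.
Hypothesis w11 : weak_tens Omega v 1 1 g11.
Hypothesis w02 : weak_tens Omega v 0 2 g02.
Hypothesis cu : forall x, closure Omega x -> forall a : R, 0 < a ->
  exists2 dl, 0 < dl & forall z, Omega z -> box x dl z -> `|u z - u x| <= a.
Hypothesis merr : measurable_plane err.
Hypothesis ierr : mu2.-integrable setT (EFin \o (fun z => err z ^+ 2)).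
Hypothesis errE : forall z, Omega z -> err z = u z - uh z.
Hypothesis qa : forall T, T \in K -> affine (q T) /\ (forall x, (hull T)° x -> uh x = q T x).
Hypothesis qm : forall T x y, T \in K -> x \in T -> y \in T -> x != y ->
  uh (midpoint x y) = q T (midpoint x y).

Definition energy W : R := sqint W g20 + sqint W g11 + sqint W g02.

Lemma energy_ge0 W : 0 <= energy W.
Proof. by rewrite !addr_ge0 ?sqint_ge0. Qed.

Lemma interior_Omega S : S `<=` closure Omega -> S° `<=` Omega.
Proof. by move=> SO; rewrite rO; exact: interiorS. Qed.

Let kap0 : 0 <= kap. Proof. by case: bK => /(_ 0) + _; exact: le_trans. Qed.

(** The setting common to triangles and polygons: [S] is convex and its interior
    lies in [W]. *)
Lemma convex_estimate S W c x (rho d : R) : segment_closed S -> S `<=` closure Omega ->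
  measurable_region W -> S° `<=` W -> 0 < rho -> box c (2 * rho) `<=` S -> S x ->
  `|c.1 - x.1| + rho <= d -> `|c.2 - x.2| + rho <= d ->
  `|u x - avg_taylor v c rho x| <= 8 * kap ^+ 2 * d ^+ 2 / rho * Num.sqrt (energy W).
Proof.
move=> cS SO mW SW r0 bS Sx d1 d2.
have seg t : 0 < t -> t <= 1 ->
    box (x.1 + t * (c.1 - x.1), x.2 + t * (c.2 - x.2)) (t * rho) `<=` Omega `&` W.
  move=> t0 t1 z zb; have := segment_box cS r0 bS Sx t0 t1 zb => zS.
  by split; [exact: (interior_Omega SO)|exact: SW].
have ct (a : R) : 0 < a -> exists2 dl, 0 < dl &
    forall z, Omega z -> box x dl z -> `|v z - u x| <= a.
  move=> a0; have [dl dl0 H] := cu (SO _ Sx) a0.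
  by exists dl => // z Oz bz; rewrite vu//; exact: H.
have := local_estimate bK mv vM mW r0 d1 d2 seg gP w20 w11 w02 ct.
move=> /le_trans; apply; rewrite /taylor_bound.
have d0 : 0 <= d by apply: le_trans d1; rewrite addr_ge0// ltW.
rewrite [X in _ <= X](_ : _ = 2 * kap ^+ 2 * d ^+ 2 / rho * (4 * Num.sqrt (energy W))); last by ring.
apply: ler_wpM2l; first by rewrite divr_ge0 ?(ltW r0)// !mulr_ge0.
by apply: sqrt_sum3; exact: sqint_ge0.
Qed.

Let s1 : R := `|sigma| + 1.
Let s1_ge1 : 1 <= s1. Proof. by rewrite lerDr. Qed.

Lemma hull_segment T : is_triangle T -> segment_closed (hull T).
Proof. by move=> tT p p' s s0 s1' hp hp'; exact: hull_convex. Qed.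

Lemma disc_diam T c (r : R) : T \in K -> 0 < r -> disc c r `<=` hull T -> hull T c /\ r <= diam T.
Proof.
move=> TK r0 dT.
have hc : hull T c.
  by apply: dT; rewrite /disc /=; apply: edist_le; [exact: ltW|rewrite !subrr expr0n addr0 sqr_ge0].
split => //.
have hd : hull T (c.1 + r, c.2).
  apply: dT; rewrite /disc /=; apply: edist_le; first exact: ltW.
  by rewrite /= subrr opprD addrA subrr sub0r sqrrN expr0n /= addr0.
apply: le_trans (le_diam tK hK TK hc hd).
by apply: le_trans (edist1 _ _); rewrite /= opprD addrA subrr sub0r normrN ler_norm.
Qed.

(** The bump sits in an inscribed disc, of radius at least a fixed fraction of the
    diameter.  At midpoints, the averaged Taylor polynomial of [uh] is [uh]
    itself. *)
Lemma triangle_estimate T : T \in K -> exists2 p, affine p &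
  (forall x, hull T x ->
     `|u x - p x| <= 512 * kap ^+ 2 * s1 * (diam T * Num.sqrt (energy (cell K T)))) /\
  (forall x y, x \in T -> y \in T -> x != y ->
     `|p (midpoint x y) - uh (midpoint x y)| <=
     5120 * kap ^+ 2 * s1 ^+ 2 * (Num.sqrt (sqint (cell K T) err) / diam T)).
Proof.
move=> TK; have tT := mesh_triangle tK TK.
have [c [r [r0 dT dr]]] := inscribed_disc tK hK sK TK.
have D0 := diam_gt0 tK hK TK.
have [hc rD] := disc_diam TK r0 dT.
pose rho := r / 4.
have rho0 : 0 < rho by rewrite divr_gt0.
have bT : box c (2 * rho) `<=` hull T.
  by move=> z zb; apply/dT/disc_box; move: zb; rewrite /rho (_ : 2 * (r / 4) = r / 2)//; field.
have rho_le : rho <= diam T.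
  by apply: le_trans rD; rewrite ler_pdivrMr// ler_peMr ?(ltW r0)// ler1n.
have d1 x : hull T x -> `|c.1 - x.1| + rho <= 2 * diam T.
  move=> hx; rewrite mulr_natl mulr2n lerD//.
  exact: le_trans (edist1 c x) (le_diam tK hK TK hc hx).
have d2 x : hull T x -> `|c.2 - x.2| + rho <= 2 * diam T.
  move=> hx; rewrite mulr_natl mulr2n lerD//.
  exact: le_trans (edist2 c x) (le_diam tK hK TK hc hx).
have mc := measurable_cell tK TK.
have ri : rho^-1 <= 16 * s1 / diam T.
  rewrite /rho invf_div ler_pdivlMr// mulrAC ler_pdivrMr//.
  rewrite [X in _ <= X](_ : _ = 4 * (4 * s1 * r)); last by ring.
  by rewrite ler_wpM2l.
exists (avg_taylor v c rho); first exact: avg_taylor_affine mv vM rho0.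
split=> [x hx|x y xT yT xy].
  apply: le_trans (convex_estimate (hull_segment tT) (hull_closure tK TK) mc
    (interior_cell tK TK) rho0 bT hx (d1 x hx) (d2 x hx)) _.
  rewrite mulrA ler_wpM2r// ?sqrtr_ge0//.
  apply: (@le_trans _ _ (8 * kap ^+ 2 * (2 * diam T) ^+ 2 * (16 * s1 / diam T))).
    by rewrite ler_wpM2l// !mulr_ge0 ?(ltW D0).
  by rewrite le_eqVlt; apply/orP; left; apply/eqP; field; rewrite gt_eqF.
set z := midpoint x y.
have hz : hull T z by exact: hull_mid.
have [qT uq] := qa TK.
rewrite (qm TK xT yT xy) -/z -(avg_taylor_id c z qT rho0).
have bI z' : box c rho z' -> (hull T)° z'.
  move=> zb; have := @segment_box _ _ _ _ _ _ (hull_segment tT) rho0 bT hc ltr01 (lexx 1) z'.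
  by rewrite !subrr !mulr0 !addr0 mul1r; apply.
have [N qN] := affine_bounded_box c rho qT.
have E : avg_taylor v c rho z - avg_taylor (q T) c rho z = \int[mu2]_z' (err z' * tker z c rho z').
  rewrite /avg_taylor -RintegralB//.
  - apply: eq_Rintegral => z' _; rewrite -mulrBl.
    have [->|/(tker_supp rho0)/bI zI] := eqVneq (tker z c rho z') 0; first by rewrite !mulr0.
    have Oz := interior_Omega (hull_closure tK TK) zI.
    by rewrite vu// errE// uq.
  - by apply: (integrable_tker bK rho0 (d1 _ hz) (d2 _ hz) mv) => z' _; exact: vM.
  - exact: (integrable_tker bK rho0 (d1 _ hz) (d2 _ hz) (affine_measurable qT) qN).
rewrite E.
apply: le_trans (tker_pairing bK rho0 (d1 _ hz) (d2 _ hz) mc merr ierr _) _.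
  by move=> z' /bI; exact: (interior_cell tK TK).
rewrite [X in _ <= X]mulrCA [X in X <= _]mulrC ler_wpM2l ?sqrtr_ge0//.
rewrite -exprVn.
apply: (@le_trans _ _ (10 * kap ^+ 2 * (2 * diam T) * (16 * s1 / diam T) ^+ 2)).
  apply: ler_wpM2l; first by rewrite !mulr_ge0 ?(ltW D0).
  have s10 : 0 <= s1 by exact: le_trans s1_ge1.
  have n1 : 0 <= rho^-1 by rewrite invr_ge0 ltW.
  by apply: lerXn2r => //; rewrite nnegrE//; exact: le_trans ri.
by rewrite le_eqVlt; apply/orP; left; apply/eqP; field; rewrite gt_eqF.
Qed.

(** The form of all pointwise bounds: [d] is a diameter, [a] the energy of the
    second derivatives and [b] that of the discretization error. *)
Definition scaled_error (d a b : R) : R := d * Num.sqrt a + Num.sqrt b / d.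

Lemma scaled_error_ge0 d a b : 0 <= d -> 0 <= scaled_error d a b.
Proof. by move=> d0; rewrite addr_ge0 ?mulr_ge0 ?invr_ge0 ?sqrtr_ge0. Qed.

Lemma le_scaled_error d a b a' b' : 0 <= d -> a <= a' -> b <= b' -> scaled_error d a b <= scaled_error d a' b'.
Proof.
move=> d0 aa bb; apply: lerD; first by rewrite ler_wpM2l// ler_wsqrtr.
by rewrite ler_wpM2r ?invr_ge0// ler_wsqrtr.
Qed.

Lemma scaled_error_diam (k d d' a b : R) : 0 < d -> 0 < d' -> d' <= k * d -> d <= k * d' ->
  scaled_error d' a b <= k * scaled_error d a b.
Proof.
move=> d0 d0' h1 h2; rewrite /scaled_error mulrDr !mulrA; apply: lerD.
  by rewrite ler_wpM2r ?sqrtr_ge0.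
rewrite ler_pdivrMr// -[X in _ <= X](_ : Num.sqrt b * (k * d' / d) = _); last by field; rewrite gt_eqF.
by rewrite ler_peMr ?sqrtr_ge0// ler_pdivlMr// mul1r.
Qed.

Let C12 : R := 5120 * kap ^+ 2 * s1 ^+ 2.
Let s1_ge0 : 0 <= s1. Proof. exact: le_trans s1_ge1. Qed.
Let C12_ge0 : 0 <= C12.
Proof. exact: mulr_ge0 (mulr_ge0 (ler0n _ _) (sqr_ge0 _)) (sqr_ge0 _). Qed.

Lemma mid_estimate T x y : T \in K -> x \in T -> y \in T -> x != y ->
  `|u (midpoint x y) - uh (midpoint x y)| <=
  C12 * scaled_error (diam T) (energy (cell K T)) (sqint (cell K T) err).
Proof.
move=> TK xT yT xy; have [p _ [h1 h2]] := triangle_estimate TK.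
have hm := hull_mid (mesh_triangle tK TK) xT yT.
rewrite -(subrKA (p (midpoint x y))).
apply: le_trans (ler_normD _ _) _; rewrite /scaled_error mulrDr; apply: lerD; last exact: h2.
apply: le_trans (h1 _ hm) _; apply: ler_wpM2r.
  by rewrite mulr_ge0 ?sqrtr_ge0// ltW// (diam_gt0 tK hK).
apply: (@le_trans _ _ (5120 * kap ^+ 2 * s1)).
  apply: ler_wpM2r => //; apply: ler_wpM2r; first exact: sqr_ge0.
  by rewrite ler_nat.
rewrite /C12; apply: ler_wpM2l; first exact: mulr_ge0 (ler0n _ _) (sqr_ge0 _).
by rewrite [X in _ <= X]expr2 ler_peMr.
Qed.

Section Patch.
Variables (y0 : plane R) (ys : seq (plane R)) (n : nat).
Hypothesis iv : interior_vertex Omega K y0.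
Hypothesis cm : cyclic_midpoints K y0 ys.
Hypothesis cv : convex_set (polygon_region y0 ys).
Hypothesis sn : (size ys <= n)%N.

Let Q : R := s1 ^+ n.
Let Q_ge1 : 1 <= Q. Proof. exact: exprn_ege1. Qed.
Let Q_ge0 : 0 <= Q. Proof. exact: le_trans Q_ge1. Qed.

Definition star : set (plane R) := [set p | exists2 T, T \in K & y0 \in T /\ cell K T p].

Lemma star_sqint w : mu2.-integrable setT (EFin \o (fun z => w z ^+ 2)) ->
  measurable_region star /\ sqint star w = \sum_(T <- K | y0 \in T) sqint (cell K T) w.
Proof.
move=> iw; rewrite -big_filter.
have -> : star = [set p | exists2 T, T \in seq.filter (fun T : {fset plane R} => y0 \in T) K &
    cell K T p].
  apply/seteqP; split => p /= [T].
    by move=> TK [yT cp]; exists T => //; rewrite mem_filter yT.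
  by rewrite mem_filter => /andP[yT TK] cp; exists T.
apply: sqint_bigcup => //.
- by rewrite filter_uniq// fset_uniq.
- by move=> T; rewrite mem_filter => /andP[_]; exact: (measurable_cell tK).
- move=> T T' p; rewrite !mem_filter => /andP[_ TK] /andP[_ T'K]; exact: cell_disjoint.
Qed.

Lemma star_energy : energy star = \sum_(T <- K | y0 \in T) energy (cell K T).
Proof.
rewrite /energy !big_split /=.
by congr (_ + _ + _); apply: (star_sqint _).2;
  apply: (gP _).2; [apply: Or31|apply: Or32|apply: Or33].
Qed.

Lemma region_segment : segment_closed (polygon_region y0 ys).
Proof.
move=> p p' s s0 s1' hp hp'.
have := @convex_set_seg _ _ p p' (1 - s) cv hp hp'; rewrite opprB addrCA subrr addr0; apply.
  by rewrite subr_ge0.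
by rewrite lerBlDr lerDl.
Qed.

(** The bump is centred at [y0]; its radius is governed by the smallest triangle
    of the fan, and the size of the polygon by the largest. *)
Lemma patch_estimate T : T \in K -> y0 \in T -> exists2 p, affine p &
  forall x, polygon_region y0 ys x ->
    `|u x - p x| <= 512 * kap ^+ 2 * s1 * Q ^+ 3 * (diam T * Num.sqrt (energy star)).
Proof.
move=> TK yT.
have D0 := diam_gt0 tK hK TK.
have s1_gt0 : 0 < s1 by exact: lt_le_trans s1_ge1.
have Q_gt0 : 0 < Q by exact: lt_le_trans Q_ge1.
have ss_ge1 : 1 <= s1 * Q by rewrite -[1](mulr1 1) ler_pM.
(* a lower bound for the inscribed radii of all triangles of the fan *)
pose rd := diam T / (4 * s1 * Q).
have rd0 : 0 < rd by rewrite divr_gt0// !mulr_gt0.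
have dR : disc y0 rd `<=` polygon_region y0 ys.
  apply: (region_disc oO tK iv cm) => T' T'K yT'.
  have [c [r [r0 dr Dr]]] := inscribed_disc tK hK sK T'K.
  exists c, r; split => //.
  rewrite /rd ler_pdivrMr ?mulr_gt0//.
  apply: le_trans (fan_diam tK hK sK cm sn TK T'K yT yT') _.
  rewrite -/s1 -/Q [X in _ <= X](_ : _ = Q * (4 * s1 * r)); last by ring.
  by rewrite ler_wpM2l.
pose rho := rd / 4.
have rho0 : 0 < rho by rewrite divr_gt0.
have bR : box y0 (2 * rho) `<=` polygon_region y0 ys.
  by move=> z zb; apply/dR/disc_box; move: zb; rewrite /rho (_ : 2 * (rd / 4) = rd / 2)//; field.
have rho_le : rho <= Q * diam T.
  apply: (@le_trans _ _ (diam T)); last by rewrite ler_peMl// ltW.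
  rewrite /rho /rd -mulrA ler_piMr ?(ltW D0)// -invfM invf_le1 ?mulr_gt0//.
  rewrite (_ : 4 * s1 * Q * 4 = s1 * Q * 16); last by ring.
  by apply: le_trans ss_ge1 _; rewrite ler_peMr ?ler1n// mulr_ge0.
have far x : polygon_region y0 ys x -> Defs.edist y0 x <= Q * diam T.
  move=> /(region_triangle tK cm)[T' T'K [yT' hx _]].
  apply: le_trans (fan_diam tK hK sK cm sn T'K TK yT' yT).
  by apply: (le_diam tK hK T'K) => //; apply: hull_vertex => //; exact: (mesh_triangle tK).
have mW := (star_sqint (gP (Or31 _ _ erefl)).2).1.
exists (avg_taylor v y0 rho); first exact: avg_taylor_affine mv vM rho0.
move=> x hx.
have SW : (polygon_region y0 ys)° `<=` star.
  move=> z /interior_subset /(region_cell tK cm)[T' T'K [yT' cz]].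
  by exists T'.
have d1 : `|y0.1 - x.1| + rho <= 2 * (Q * diam T).
  by rewrite mulr_natl mulr2n lerD// (le_trans (edist1 _ _))// far.
have d2 : `|y0.2 - x.2| + rho <= 2 * (Q * diam T).
  by rewrite mulr_natl mulr2n lerD// (le_trans (edist2 _ _))// far.
apply: le_trans (convex_estimate region_segment (region_closure tK cm) mW SW rho0 bR hx d1 d2) _.
rewrite le_eqVlt; apply/orP; left; apply/eqP; rewrite /rho /rd.
by field; rewrite !gt_eqF.
Qed.

Let C4 : R := 1024 * kap ^+ 2 * s1 * Q ^+ 3 + C12 * Q.

(** Both [u] and the midpoint values are close to the same affine function, which
    Wachspress coordinates reproduce. *)
Lemma vertex_estimate T : T \in K -> y0 \in T ->
  `|u y0 - \sum_(z <- ys) wachspress ys y0 z * uh z| <=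
  C4 * scaled_error (diam T) (\sum_(T' <- K | y0 \in T') energy (cell K T'))
    (\sum_(T' <- K | y0 \in T') sqint (cell K T') err).
Proof.
move=> TK yT.
have D0 := diam_gt0 tK hK TK.
have [w0 w1 wy] := fan_wachspress tK iv cm cv.
have [p ap pu] := patch_estimate TK yT.
set A := \sum_(T' <- K | y0 \in T') energy _; set B := \sum_(T' <- K | y0 \in T') sqint _ _.
pose N := 512 * kap ^+ 2 * s1 * Q ^+ 3 * (diam T * Num.sqrt (energy star)).
have mid z : z \in ys -> `|u z - uh z| <= C12 * (Q * scaled_error (diam T) A B).
  move=> /(fan_triangle cm)[a [b [T'K -> _ S0]]].
  have [n1 _ _] := signed_area_neq (lt0r_neq0 S0).
  set T' := [fset y0; a; b]%fset in T'K.
  have yT' : y0 \in T' by rewrite !inE eqxx.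
  have aT' : a \in T' by rewrite !inE eqxx orbT.
  have D0' := diam_gt0 tK hK T'K.
  apply: le_trans (mid_estimate T'K yT' aT' n1) _.
  apply: ler_wpM2l; first exact: C12_ge0.
  apply: le_trans (scaled_error_diam _ _ D0 D0' (fan_diam tK hK sK cm sn T'K TK yT' yT)
    (fan_diam tK hK sK cm sn TK T'K yT yT')) _.
  rewrite -/s1 -/Q; apply: ler_wpM2l => //; apply: le_scaled_error; first exact: ltW.
    rewrite /A (big_rem T')//= yT' lerDl sumr_ge0// => S _; exact: energy_ge0.
  rewrite /B (big_rem T')//= yT' lerDl sumr_ge0// => S _; exact: sqint_ge0.
have py : p y0 = \sum_(z <- ys) wachspress ys y0 z * p z by rewrite -[in LHS]wy affine_sum.
have NA : N <= 512 * kap ^+ 2 * s1 * Q ^+ 3 * scaled_error (diam T) A B.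
  rewrite /N star_energy -/A; apply: ler_wpM2l; first exact: mulr_ge0 (mulr_ge0 (mulr_ge0 (ler0n _ _) (sqr_ge0 _)) s1_ge0) (exprn_ge0 _ Q_ge0).
  by rewrite lerDl divr_ge0 ?sqrtr_ge0// ltW.
have h1 : `|u y0 - p y0| <= N by apply: pu; exact: (region_center tK iv cm).
have h2 : `|p y0 - \sum_(z <- ys) wachspress ys y0 z * uh z| <= N + C12 * (Q * scaled_error (diam T) A B).
  rewrite py -sumrB.
  apply: le_trans (ler_norm_sum _ _ _) _.
  rewrite -[X in _ <= X]mul1r -w1 mulr_suml big_seq [X in _ <= X]big_seq.
  apply: ler_sum => z zs; rewrite -mulrBr normrM (ger0_norm (w0 z zs)).
  apply: ler_wpM2l; first exact: w0.
  rewrite -(subrKA (u z)) (le_trans (ler_normD _ _))//; apply: lerD; last exact: mid.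
  by rewrite distrC; apply: pu; exact: (region_node cm).
rewrite -(subrKA (p y0)) (le_trans (ler_normD _ _))//.
apply: le_trans (lerD h1 h2) _.
apply: (@le_trans _ _ (2 * (512 * kap ^+ 2 * s1 * Q ^+ 3 * scaled_error (diam T) A B) + C12 * (Q * scaled_error (diam T) A B))).
  by rewrite addrA lerD2r mulr_natl mulr2n lerD.
by rewrite le_eqVlt; apply/orP; left; apply/eqP; rewrite /C4; ring.
Qed.

End Patch.

Variable n : nat.
Hypothesis conv : convex_polygons Omega K.
Hypothesis sides : polygon_sides_le Omega K n.

(** The energy seen by a triangle: its own, and that of the fans around its
    interior vertices.  Boundary vertices carry the values of [u], and the
    number of triangles around them is not controlled. *)
Definition spread (f : {fset plane R} -> R) T : R :=
  f T + \sum_(y <- T | `[< Omega y >]) \sum_(T' <- K | y \in T') f T'.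

Let Q : R := s1 ^+ n.
Let Q_ge1 : 1 <= Q. Proof. exact: exprn_ege1. Qed.
Let Q_ge0 : 0 <= Q. Proof. exact: le_trans Q_ge1. Qed.
Let C4 : R := 1024 * kap ^+ 2 * s1 * Q ^+ 3 + C12 * Q.
Let a_ T := energy (cell K T).
Let b_ T := sqint (cell K T) err.

Let C3_ge0 : 0 <= 1024 * kap ^+ 2 * s1 * Q ^+ 3.
Proof. exact: mulr_ge0 (mulr_ge0 (mulr_ge0 (ler0n _ _) (sqr_ge0 _)) s1_ge0) (exprn_ge0 _ Q_ge0). Qed.
Let C4_ge0 : 0 <= C4.
Proof. exact: addr_ge0 C3_ge0 (mulr_ge0 C12_ge0 Q_ge0). Qed.

Lemma spread_self f T : (forall T, 0 <= f T) -> f T <= spread f T.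
Proof. by move=> f0; rewrite lerDl !sumr_ge0// => y _; rewrite sumr_ge0. Qed.

Lemma spread_star f T y : (forall T, 0 <= f T) -> Omega y -> y \in T ->
  \sum_(T' <- K | y \in T') f T' <= spread f T.
Proof.
move=> f0 Oy yT; rewrite /spread (big_rem y)//= asboolT// addrCA lerDl addr_ge0//.
by rewrite sumr_ge0// => z _; rewrite sumr_ge0.
Qed.

Let a0 T : 0 <= a_ T. Proof. exact: energy_ge0. Qed.
Let b0 T : 0 <= b_ T. Proof. exact: sqint_ge0. Qed.

(** The midpoint of a vertex with itself is that vertex, so this covers all
    nodes of the half mesh in [T]. *)
Lemma nodal_estimate T x y : T \in K -> x \in T -> y \in T ->
  `|u (midpoint x y) - nodal_value Omega K u uh (midpoint x y)| <=
  C4 * scaled_error (diam T) (spread a_ T) (spread b_ T).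
Proof.
move=> TK xT yT; have D0 := ltW (diam_gt0 tK hK TK).
rewrite /nodal_value; case: asboolP => [_|/contrapT Om].
  by rewrite subrr normr0 mulr_ge0// scaled_error_ge0.
have [xy|xy] := eqVneq x y.
  move: Om; rewrite -xy midpointxx => Ox.
  have iv : interior_vertex Omega K x by split => //; exists T.
  rewrite asboolT//; have [cm cv] := conv iv.
  apply: le_trans (vertex_estimate iv cm cv (sides iv) TK xT) _.
  by apply: ler_wpM2l; [exact: C4_ge0|apply: le_scaled_error => //; exact: spread_star].
rewrite asboolF; last first.
  by move=> [_ [T' T'K]]; apply/negP; exact: (midpoint_not_vertex tK TK).
apply: le_trans (mid_estimate TK xT yT xy) _.
apply: (@le_trans _ _ (C4 * scaled_error (diam T) (a_ T) (b_ T))).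
  apply: ler_wpM2r; first exact: scaled_error_ge0.
  by apply: ler_wpDl; [exact: C3_ge0|rewrite ler_peMr].
by apply: ler_wpM2l; [exact: C4_ge0|apply: le_scaled_error => //; exact: spread_self].
Qed.

Let C5 : R := 1024 * kap ^+ 2 * s1 + C4.
Let C5_ge0 : 0 <= C5.
Proof. exact: addr_ge0 (mulr_ge0 (mulr_ge0 (ler0n _ _) (sqr_ge0 _)) s1_ge0) C4_ge0. Qed.

Lemma element_estimate T p : T \in K -> hull T p ->
  `|u p - IW Omega K u uh p| <= C5 * scaled_error (diam T) (spread a_ T) (spread b_ T).
Proof.
move=> TK hp; have D0 := ltW (diam_gt0 tK hK TK).
have [f af [fu _]] := triangle_estimate TK.
set B := scaled_error _ _ _; pose k : R := 512 * kap ^+ 2 * s1.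
have k0 : 0 <= k by exact: mulr_ge0 (mulr_ge0 (ler0n _ _) (sqr_ge0 _)) s1_ge0.
have hB x : hull T x -> `|u x - f x| <= k * B.
  move=> hx; apply: le_trans (fu x hx) _; apply: ler_wpM2l => //.
  apply: ler_wpDr; first by rewrite divr_ge0 ?sqrtr_ge0.
  by rewrite ler_wpM2l// ler_wsqrtr//; exact: spread_self.
rewrite -(subrKA (f p)) (le_trans (ler_normD _ _))//.
apply: (@le_trans _ _ (k * B + (k * B + C4 * B))).
  apply: lerD; first exact: hB.
  apply: (IW_error tK TK hp af) => x y xT yT.
  rewrite -(subrKA (u (midpoint x y))) (le_trans (ler_normD _ _))//.
  apply: lerD; last exact: nodal_estimate.
  by rewrite distrC; apply: hB; apply: hull_mid => //; exact: (mesh_triangle tK).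
rewrite le_eqVlt; apply/orP; left; apply/eqP; rewrite /k /C5.
by move: {hB} B C4 => B' c4; ring.
Qed.

Lemma sum_cells w : mu2.-integrable setT (EFin \o (fun z => w z ^+ 2)) ->
  \sum_(T <- K) sqint (cell K T) w <= sqint setT w.
Proof.
move=> iw; have [||||m <-] := @sqint_bigcup _ _ K (cell K) w.
- exact: fset_uniq.
- by move=> T; exact: (measurable_cell tK).
- by move=> T T' p; exact: cell_disjoint.
- exact: iw.
- by apply: sqint_subset => //; exact: measurableT.
Qed.

Lemma scaled_error_sqr (d a b : R) : 0 < d -> 0 <= a -> 0 <= b ->
  scaled_error d a b ^+ 2 * (4 * d ^+ 2) <= 8 * (d ^+ 4 * a + b).
Proof.
move=> d0 a0' b0'.
have -> : scaled_error d a b ^+ 2 * (4 * d ^+ 2) = 4 * (d ^+ 2 * Num.sqrt a + Num.sqrt b) ^+ 2.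
  by rewrite /scaled_error; move: (Num.sqrt a) (Num.sqrt b) => r t; field; rewrite gt_eqF.
rewrite -{2}(sqr_sqrtr a0') -{2}(sqr_sqrtr b0').
move: (Num.sqrt a) (Num.sqrt b) => r t.
have := sqr_ge0 (d ^+ 2 * r - t).
by move: (d ^+ 2) (exprM d 2 2) => d2 ->; nra.
Qed.

Lemma global_estimate : 
  (\int[mu2]_z ((((fun x => u x - IW Omega K u uh x) \_ Omega) z) ^+ 2)%:E <=
   (error_const kap s1 n * (h ^+ 4 * energy setT + sqint setT err))%:E)%E.
Proof.
change (error_const kap s1 n) with (8 * C5 ^+ 2 * (1 + 3 * n%:R)).
pose M_ T := C5 * scaled_error (diam T) (spread a_ T) (spread b_ T).
have sp0 f T : (forall T, 0 <= f T) -> 0 <= spread f T.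
  by move=> f0; exact: le_trans (f0 T) (spread_self T f0).
apply: le_trans (@integral_sqr_le _ _ K (cell K) M_ (fun T => 4 * diam T ^+ 2) _ _ _ _ _) _.
- by move=> T; exact: (measurable_cell tK).
- by move=> T TK; apply: mulr_ge0 => //; apply: scaled_error_ge0; exact: ltW (diam_gt0 tK hK TK).
- move=> T TK; have D0 := ltW (diam_gt0 tK hK TK).
  have tT := mesh_triangle tK TK; have [x [y [z [E _]]]] := tT.
  have xT : x \in T by rewrite E !inE eqxx.
  rewrite -(mu2_box x D0); apply: le_measure; rewrite ?inE.
  + exact: (measurable_cell tK).
  + exact: measurable_box.
  move=> p /cell_hull hp; have hx := hull_vertex tT xT.
  by apply/boxP; split;
    [apply: le_trans (edist1 _ _) _|apply: le_trans (edist2 _ _) _]; exact: (le_diam tK hK TK).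
- move=> z; rewrite patchE; case: ifPn; last by rewrite eqxx.
  rewrite inE => Oz _; have [T TK cz] := cell_cover tK (subset_closure Oz).
  exists T => //; split => //; apply: element_estimate => //; exact: cell_hull cz.
rewrite lee_fin.
apply: (@le_trans _ _ (8 * C5 ^+ 2 * (h ^+ 4 * \sum_(T <- K) spread a_ T + \sum_(T <- K) spread b_ T))).
  rewrite mulr_sumr -big_split mulr_sumr big_seq [X in _ <= X]big_seq; apply: ler_sum => T TK /=.
  have D0 := diam_gt0 tK hK TK.
  rewrite /M_ exprMn -[X in X <= _]mulrA (mulrC 8) -[X in _ <= X]mulrA.
  apply: ler_wpM2l; first exact: sqr_ge0.
  apply: le_trans (scaled_error_sqr D0 (sp0 _ _ a0) (sp0 _ _ b0)) _.
  apply: ler_wpM2l => //; rewrite lerD2r; apply: ler_wpM2r; first exact: sp0.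
  have Dh := diam_le_h tK hK TK.
  by apply: lerXn2r => //; rewrite nnegrE; [exact: ltW|exact: le_trans (ltW D0) Dh].
rewrite -[X in _ <= X]mulrA; apply: ler_wpM2l; first by exact: mulr_ge0 (ler0n _ _) (sqr_ge0 _).
have cnt y T : T \in K -> y \in T -> `[< Omega y >] ->
    (count (fun T : {fset plane R} => y \in T) K <= n)%N.
  move=> TK yT /asboolP Oy; have iv : interior_vertex Omega K y by split => //; exists T.
  have [cm _] := conv iv; exact: leq_trans (fan_valence tK cm) (sides iv).
rewrite mulrDr; apply: lerD.
  rewrite mulrCA; apply: ler_wpM2l; first by rewrite -[4%N]/(2 * 2)%N exprM sqr_ge0.
  apply: le_trans (sum_spread (mesh_triangle tK) (fun T _ => a0 T) cnt) _.
  apply: ler_wpM2l; first by rewrite addr_ge0// mulr_ge0.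
  rewrite /a_ /energy !big_split /=; apply: lerD; first apply: lerD.
  - by apply: sum_cells; apply: (gP _).2; exact: Or31.
  - by apply: sum_cells; apply: (gP _).2; exact: Or32.
  - by apply: sum_cells; apply: (gP _).2; exact: Or33.
apply: le_trans (sum_spread (mesh_triangle tK) (fun T _ => b0 T) cnt) _.
apply: ler_wpM2l; first by rewrite addr_ge0// mulr_ge0.
exact: sum_cells.
Qed.

End Estimates.

(** * Sobolev norms and the theorem *)

Section Setup.
Context {R : realType}.
Implicit Types (Omega : set (plane R)) (u w : plane R -> R).

(** Boundedness is for the max norm, whose closed balls are boxes. *)
Lemma bounded_closure_compact Omega : bounded_set Omega -> compact (closure Omega).
Proof.
move=> [M0 [_ /(_ (M0 + 1))]]; rewrite ltrDl ltr01 => /(_ erefl) OM.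
pose M := M0 + 1; apply: (@subclosed_compact _ _ (box (0 : plane R) M)); first exact: closed_closure.
  by apply: compact_setX; exact: segment_compact.
have cb : closed (box (0 : plane R) M).
  apply: compact_closed; first exact: norm_hausdorff.
  by apply: compact_setX; exact: segment_compact.
rewrite ((closure_id (box (0 : plane R) M)).1 cb); apply: closure_subset => z /OM /=;
  rewrite prod_normE ge_max => /andP[h1 h2].
by apply/boxP; rewrite !subr0.
Qed.

Lemma continuous_closure_bounded Omega u : bounded_set Omega ->
  {within closure Omega, continuous u} -> exists M : R, forall z, `|(u \_ Omega) z| <= M.
Proof.
move=> bO cu; have := compact_bounded (continuous_compact cu (bounded_closure_compact bO)).
move=> [M0 [_ /(_ (M0 + 1))]]; rewrite ltrDl ltr01 => /(_ erefl) uM.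
pose M := M0 + 1; exists `|M| => z; rewrite patchE; case: ifPn; last by rewrite normr0.
rewrite inE => Oz; apply: le_trans (ler_norm M); apply: uM.
by exists z => //; exact: subset_closure.
Qed.

Lemma within_modulus Omega u x (a : R) : {within closure Omega, continuous u} ->
  closure Omega x -> 0 < a ->
  exists2 dl, 0 < dl & forall z, Omega z -> box x dl z -> `|u z - u x| <= a.
Proof.
move=> /subspace_continuousP cu Ox a0.
have /cvgrPdist_le /(_ a a0) near := cu x Ox.
have [dl dl0 H] := interior_box near.
exists dl => // z Oz zb; rewrite distrC; apply: (H z zb).
exact: subset_closure.
Qed.

Lemma wD_spec Omega i j u : H2 Omega u -> (i + j <= 2)%N ->
  L2 Omega (wD Omega i j u) /\ weak_partial Omega i j u (wD Omega i j u).
Proof. by move=> [_ H] /H ex; exact: (xgetPex (cst 0) ex). Qed.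

Lemma H2seminormE Omega u : H2 Omega u ->
  H2seminorm Omega u = (Num.sqrt (energy (wD Omega 2 0 u \_ Omega) (wD Omega 1 1 u \_ Omega)
    (wD Omega 0 2 u \_ Omega) setT))%:E.
Proof.
move=> uH.
have E i j : (i + j <= 2)%N ->
    (L2norm Omega (wD Omega i j u) ^+ 2 = (sqint setT (wD Omega i j u \_ Omega))%:E)%E.
  move=> ij; rewrite (L2norm_sqint (wD_spec uH ij).1) -EFin_expe sqr_sqrtr//.
  exact: sqint_ge0.
rewrite /H2seminorm.
rewrite (eq_bigr (fun i : 'I_3 => (sqint setT (wD Omega i (2 - i) u \_ Omega))%:E)); last first.
  by move=> i _; apply: E; rewrite subnKC// -ltnS.
rewrite sumEFin !big_ord_recr big_ord0 /= add0r.
rewrite /energy (_ : 2 - 0 = 2)%N// (_ : 2 - 1 = 1)%N// (_ : 2 - 2 = 0)%N//.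
have S (a b d : R) : 0 <= a -> 0 <= b -> 0 <= d ->
    ((a + b + d) `^ 2^-1)%:E = (Num.sqrt (d + b + a))%:E.
  by move=> a0 b0 d0; rewrite powR12_sqrt ?addr_ge0// addrC addrA addrAC.
exact: S (sqint_ge0 _ _) (sqint_ge0 _ _) (sqint_ge0 _ _).
Qed.

(** The finite bound on the norm supplies integrability of the difference. *)
Lemma L2_of_norm Omega u uh (a : R) : L2 Omega u -> L2 Omega uh ->
  (L2norm Omega (u \- uh)%R <= a%:E)%E -> L2 Omega (u \- uh).
Proof.
move=> uL vL le; rewrite /L2 inE; apply/andP; split.
  rewrite inE /=.
  have -> : (u \- uh) \_ Omega = (u \_ Omega) \- (uh \_ Omega).
    by apply/funext => z; rewrite /= !patchE; case: ifP => // _; rewrite subr0.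
  by apply: measurable_funB; exact: L2_measurable.
by rewrite inE /= /finite_norm; apply: le_lt_trans le _; exact: ltry.
Qed.

End Setup.

Theorem theorem5p4 (R : realType) (sigma C0 : R) (s : nat) :
  exists C : R,
  forall (Omega : set (plane R)) (H : set R) (K : R -> mesh R),
    polygonal_domain Omega ->
    mesh_family Omega H K ->
    shape_regular sigma H K ->
    (forall h, H h -> convex_polygons Omega (K h)) ->
    (forall h, H h -> polygon_sides_le Omega (K h) s) ->
  forall (h : R) (u uh : plane R -> R),
    H h ->
    H2 Omega u ->
    {within closure Omega, continuous u} ->
    CR_space Omega (K h) uh ->
    (L2norm Omega (u \- uh)%R <= (C0 * h ^+ 2)%:E * H2seminorm Omega u)%E ->
    half_space Omega (K h) (IW Omega (K h) u uh) /\
    (L2norm Omega (u \- IW Omega (K h) u uh)%R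
       <= (C * h ^+ 2)%:E * H2seminorm Omega u)%E.
Proof.
have [kap bK] := @step_bound_ex R.
pose c := error_const kap (`|sigma| + 1) s.
have c0 : 0 <= c.
  by apply: mulr_ge0; [apply: mulr_ge0; [exact: ler0n|exact: sqr_ge0]|rewrite addr_ge0// mulr_ge0].
exists (Num.sqrt (c * (1 + C0 ^+ 2))).
move=> Omega H K [oO _ bO rO _] mf sr conv sides h u uh Hh uH cu [uhL [q [qa _ qm]]] near.
have [h0 tK hK] := mf h Hh.
split; first exact: (IW_spec tK u uh).1.
pose g20 := wD Omega 2 0 u \_ Omega; pose g11 := wD Omega 1 1 u \_ Omega.
pose g02 := wD Omega 0 2 u \_ Omega; pose A := energy g20 g11 g02 setT.
have semi : H2seminorm Omega u = (Num.sqrt A)%:E := H2seminormE uH.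
move: near; rewrite semi -!EFinM => near.
have A0 : 0 <= A by exact: energy_ge0.
have uL : L2 Omega u by case: uH.
have eL := L2_of_norm uL uhL near.
pose err := (u \- uh) \_ Omega; pose B := sqint setT err.
have BA : B <= C0 ^+ 2 * h ^+ 4 * A.
  move: near; rewrite (L2norm_sqint eL) lee_fin -/err -/B => le.
  have B0 : 0 <= B by exact: sqint_ge0.
  rewrite -(sqr_sqrtr B0) -[X in _ <= _ * X](sqr_sqrtr A0) -[4%N]/(2 * 2)%N exprM -!exprMn.
  by apply: lerXn2r; rewrite // nnegrE ?sqrtr_ge0// (le_trans _ le) ?sqrtr_ge0.
have [M uM] := continuous_closure_bounded bO cu.
have gP g : [\/ g = g20, g = g11 | g = g02] -> measurable_plane g /\
    mu2.-integrable setT (EFin \o (fun z => g z ^+ 2)).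
  move=> [] ->; split.
  - exact: L2_measurable (wD_spec (i := 2) (j := 0) uH isT).1.
  - exact: L2_sqr_integrable (wD_spec (i := 2) (j := 0) uH isT).1.
  - exact: L2_measurable (wD_spec (i := 1) (j := 1) uH isT).1.
  - exact: L2_sqr_integrable (wD_spec (i := 1) (j := 1) uH isT).1.
  - exact: L2_measurable (wD_spec (i := 0) (j := 2) uH isT).1.
  - exact: L2_sqr_integrable (wD_spec (i := 0) (j := 2) uH isT).1.
have vu x : Omega x -> (u \_ Omega) x = u x by move=> Ox; rewrite patchE mem_set.
have errE z : Omega z -> err z = u z - uh z by move=> Oz; rewrite /err patchE mem_set.
have w20 : weak_tens Omega (u \_ Omega) 2 0 g20.
  exact: weak_partial_tens (wD_spec (i := 2) (j := 0) uH isT).2.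
have w11 : weak_tens Omega (u \_ Omega) 1 1 g11.
  exact: weak_partial_tens (wD_spec (i := 1) (j := 1) uH isT).2.
have w02 : weak_tens Omega (u \_ Omega) 0 2 g02.
  exact: weak_partial_tens (wD_spec (i := 0) (j := 2) uH isT).2.
have mod x : closure Omega x -> forall a : R, 0 < a ->
    exists2 dl, 0 < dl & forall z, Omega z -> box x dl z -> `|u z - u x| <= a.
  by move=> Ox a; exact: within_modulus cu Ox.
have sK T : T \in K h -> diam T <= sigma * inscribed_diam (hull T) by exact: sr.
have est := global_estimate oO rO tK hK sK bK vu (L2_measurable uL) uM gP w20 w11 w02 mod
  (L2_measurable eL) (L2_sqr_integrable eL) errE qa qm (conv h Hh) (sides h Hh).
have X0 : 0 <= c * (h ^+ 4 * A + B).
  apply: mulr_ge0 => //; apply: addr_ge0; last exact: sqint_ge0.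
  by apply: mulr_ge0 => //; apply: exprn_ge0; exact: ltW.
apply: le_trans (L2norm_le X0 est) _; rewrite lee_fin.
have h2 : h ^+ 2 * Num.sqrt A = Num.sqrt (h ^+ 4 * A).
  by rewrite sqrtrM ?exprn_ge0 ?ltW// -[4%N]/(2 * 2)%N exprM sqrtr_sqr ger0_norm ?sqr_ge0.
rewrite -[X in _ <= X]mulrA h2 -sqrtrM; last first.
  by apply: mulr_ge0 => //; apply: addr_ge0 => //; exact: sqr_ge0.
apply: ler_wsqrtr; rewrite -[X in _ <= X]mulrA; apply: ler_wpM2l => //.
by rewrite mulrDl mul1r lerD2l mulrA.
Qed.
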